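(* Let $R$ be a countable Dedekind domain that is not a field. For $\alpha<\omega_1$ let $\mathcal E_\alpha$ be the exact structure on the category $\mathbf{Flat}(R)$ of countable flat $R$-modules projectively generated by the countable flat modules of plain tree length at most $\alpha_n$, for $n\in\omega$. Then $(\mathcal E_\alpha)_{\alpha<\omega_1}$ is a strictly decreasing chain of nontrivial exact structures on $\mathbf{Flat}(R)$.
   Context: For each countable limit ordinal $\lambda$ fix an increasing sequence $(\lambda_n)$ of successor ordinals cofinal in $\lambda$; if $\alpha$ is zero or a successor put $\alpha_n=\alpha$ for all $n$. ''Finite'' means finitely generated. The exact structure projectively generated by a class $\mathfrak I$ of objects of $\mathbf{Flat}(R)$ consists of the short exact sequences $A\to B\to C$ of countable flat modules such that $\mathrm{Hom}(X,B)\to\mathrm{Hom}(X,C)$ is surjective for every $X\in\mathfrak I$. An exact structure is nontrivial if it contains a non-split short exact sequence. Wedge sums. Given flat modules $M_1$, $M_{(i;0)}$ ($i\in\omega$) and homomorphisms $\psi_i:M_1\to M_{(i;0)}$, the wedge sum $\bigoplus_{(M_1,\psi_i)}M_{(i;0)}$ is the quotient of $M_1\oplus\bigoplus_iM_{(i;0)}$ by the pure submodule generated by the elements $y-\psi_i(y)$, $y\in M_1$, $i\in\omega$. Plain tree length. A countable flat module has plain tree length $0$ iff it is finite. For $\alpha$ a countable successor ordinal, $C$ has plain tree length at most $\alpha$ iff it is a direct summand of a wedge sum $\bigoplus_{(M_1,\psi_i)}M_{(i;0)}$ with $M_1$ finite flat, each $M_{(i;0)}$ countable flat of plain tree length at most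 $(\alpha-1)_i$, and each $\psi_i$ injective. *)

(* Defs.v *)
From HB Require Import structures.
From mathcomp Require Import all_boot all_order all_algebra.
From mathcomp Require Import generic_quotient ring_quotient.
From mathcomp Require Import fraction mxpoly sesquilinear.
From mathcomp Require Import boolp classical_sets functions cardinality wochoice.

Set Implicit Arguments.
Unset Strict Implicit.
Unset Printing Implicit Defensive.

Import Order.TTheory GRing.Theory.

Local Open Scope ring_scope.
Local Open Scope quotient_scope.

(* Classically every Prop P has a boolean view `[< P >]`, so a quantification
   over {pred V} ranges over all the subsets of V. *)

Section Dedekind.
Variable R : idomainType.

(* R^o is R as a module over itself, so its submodules are the ideals. *)
Definition noetherian : Prop :=
  forall I : {pred R^o}, submod_closed I ->
  exists n (g : 'I_n -> R),
    forall x : R, x \in I <-> exists c : 'I_n -> R, x = \sum_i c i * g i.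

Definition integrally_closed : Prop :=
  forall x : {fraction R}, integralOver (@tofrac R) x ->
  exists r : R, x = tofrac r.

(* [idealr_closed] includes properness (1 \notin I). *)
Definition prime_ideals_maximal : Prop :=
  forall I : {pred R}, idealr_closed I -> prime_idealr_closed I ->
    (exists2 x, x \in I & x != 0) ->
  forall J : {pred R}, idealr_closed J -> {subset I <= J} -> {subset J <= I}.

Definition dedekind_domain : Prop :=
  [/\ noetherian, integrally_closed & prime_ideals_maximal].

End Dedekind.

Section FlatModules.
Variable R : comNzRingType.

Definition is_tensor_product (A M T : lmodType R) (t : {bilinear A -> M -> T}) :
    Prop :=
  forall (P : lmodType R) (b : {bilinear A -> M -> P}),
  exists2 g : {linear T -> P}, (forall x m, g (t x m) = b x m) &
    forall g' : {linear T -> P}, (forall x m, g' (t x m) = b x m) -> g' =1 g.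

(* Tensoring with M preserves injectivity:
   g is the map f (x) M : A (x) M -> B (x) M induced by f. *)
Definition flat (M : lmodType R) : Prop :=
  forall (A B : lmodType R) (f : {linear A -> B}), injective f ->
  forall (TA TB : lmodType R)
    (tA : {bilinear A -> M -> TA}) (tB : {bilinear B -> M -> TB}),
  is_tensor_product tA -> is_tensor_product tB ->
  forall g : {linear TA -> TB}, (forall x m, g (tA x m) = tB (f x) m) ->
  injective g.

Definition finitely_generated (M : lmodType R) : Prop :=
  exists n (g : 'I_n -> M),
    forall x, exists c : 'I_n -> R, x = \sum_i c i *: g i.

(* The objects of the category Flat(R); its morphisms are the linear maps. *)
Record Flat := MkFlat {
  flat_mod :> lmodType R;
  flat_countable : countable [set: flat_mod];
  flat_flat : flat flat_mod
}.

Definition direct_summand (C V : lmodType R) : Prop :=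
  exists (D : lmodType R) (f : {linear (C * D)%type -> V}), bijective f.

End FlatModules.

Section DirectSum.
Variables (R : comNzRingType) (M : nat -> lmodType R).

Definition finite_support (f : forall i, M i) : Prop :=
  finite_set [set i | f i != 0].

Record dsum := DSum { dsum_fun :> forall i, M i; _ : finite_support dsum_fun }.

HB.instance Definition _ := gen_eqMixin dsum.
HB.instance Definition _ := gen_choiceMixin dsum.

Lemma dsumP (x : dsum) : finite_support x. Proof. by case: x. Qed.

Lemma dsum_ext (x y : dsum) : (forall i, x i = y i) -> x = y.
Proof.
case: x y => [f fP] [g gP] /= fg.
have {}fg : f = g by apply: functional_extensionality_dep.
by rewrite {}fg in fP *; congr DSum; apply: Prop_irrelevance.
Qed.

Fact dsum0_subproof : finite_support (fun=> 0).
Proof.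
by apply: (sub_finite_set _ (finite_set0 nat)) => i /=; rewrite eqxx.
Qed.

Fact dsumN_subproof (x : dsum) : finite_support (fun i => - x i).
Proof. by apply: (sub_finite_set _ (dsumP x)) => i /=; rewrite oppr_eq0. Qed.

Fact dsumD_subproof (x y : dsum) : finite_support (fun i => x i + y i).
Proof.
have xyP : finite_set ([set i | x i != 0] `|` [set i | y i != 0])%classic.
  by rewrite finite_setU; split; apply: dsumP.
apply: (sub_finite_set _ xyP) => i /=; have [->|] := eqVneq (x i) 0.
  by rewrite add0r; right.
by left.
Qed.

Fact dsumZ_subproof a (x : dsum) : finite_support (fun i => a *: x i).
Proof.
apply: (sub_finite_set _ (dsumP x)) => i /=.
by apply: contra_neq => ->; rewrite scaler0.
Qed.

Definition dsum_zero := DSum dsum0_subproof.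
Definition dsum_opp x := DSum (dsumN_subproof x).
Definition dsum_add x y := DSum (dsumD_subproof x y).
Definition dsum_scale a x := DSum (dsumZ_subproof a x).

Fact dsum_addA : associative dsum_add.
Proof. by move=> x y z; apply: dsum_ext => i /=; rewrite addrA. Qed.
Fact dsum_addC : commutative dsum_add.
Proof. by move=> x y; apply: dsum_ext => i /=; rewrite addrC. Qed.
Fact dsum_add0 : left_id dsum_zero dsum_add.
Proof. by move=> x; apply: dsum_ext => i /=; rewrite add0r. Qed.
Fact dsum_addN : left_inverse dsum_zero dsum_opp dsum_add.
Proof. by move=> x; apply: dsum_ext => i /=; rewrite addNr. Qed.

HB.instance Definition _ :=
  GRing.isZmodule.Build dsum dsum_addA dsum_addC dsum_add0 dsum_addN.

Fact dsum_scaleA a b (x : dsum) :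
  dsum_scale a (dsum_scale b x) = dsum_scale (a * b) x.
Proof. by apply: dsum_ext => i /=; rewrite scalerA. Qed.
Fact dsum_scale1 : left_id 1 dsum_scale.
Proof. by move=> x; apply: dsum_ext => i /=; rewrite scale1r. Qed.
Fact dsum_scaleDr : right_distributive dsum_scale +%R.
Proof. by move=> a x y; apply: dsum_ext => i /=; rewrite scalerDr. Qed.
Fact dsum_scaleDl x : {morph dsum_scale^~ x : a b / a + b}.
Proof. by move=> a b; apply: dsum_ext => i /=; rewrite scalerDl. Qed.

HB.instance Definition _ := GRing.Zmodule_isLmodule.Build R dsum
  dsum_scaleA dsum_scale1 dsum_scaleDr dsum_scaleDl.

Fact dsum_inj_subproof i (x : M i) : finite_support (dfwith (fun j => 0 : M j) x).
Proof.
apply: (sub_finite_set _ (finite_set1 i)) => j /=.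
by apply: contraNeq => ji; rewrite dfwith_out // eq_sym.
Qed.

Definition dsum_inj i (x : M i) := DSum (dsum_inj_subproof x).

End DirectSum.

Section PureSubmodules.
Variables (R : comNzRingType) (V : lmodType R).

(* Purity: a finite system of linear equations with constants in N that is
   solvable in V is solvable in N. *)
Definition pure_submod_closed (N : {pred V}) : Prop :=
  submod_closed N /\
  forall m n (a : 'M[R]_(m, n)) (c : 'I_m -> V), (forall i, c i \in N) ->
    (exists x : 'I_n -> V, forall i, \sum_j a i j *: x j = c i) ->
  exists2 x : 'I_n -> V, (forall j, x j \in N) &
    forall i, \sum_j a i j *: x j = c i.

(* The pure submodule generated by S. Over a domain, when V is flat, a multiple
   r *: x (r != 0) in the plain span of S puts x in pure_span S, so this is in
   general larger than the span. *)
Definition pure_span (S : {pred V}) : {pred V} :=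
  fun x => `[< forall N, pure_submod_closed N -> {subset S <= N} -> x \in N >].

Fact pure_span_submod_closed S : submod_closed (pure_span S).
Proof.
split=> [|a u v /asboolP Nu /asboolP Nv].
  by apply/asboolP => N [[]].
apply/asboolP => N Np SN; have [[_ NZ] _] := Np.
by apply: NZ; [apply: Nu | apply: Nv].
Qed.

HB.instance Definition _ S :=
  GRing.isSubmodClosed.Build R V (pure_span S) (pure_span_submod_closed S).

End PureSubmodules.

Section PureQuotient.
Variables (R : comNzRingType) (V : lmodType R) (S : {pred V}).

Definition pure_quot : Type := Quotient.quot (pure_span S).

HB.instance Definition _ := GRing.Zmodule.on pure_quot.
HB.instance Definition _ := EqQuotient.on pure_quot.

Definition pure_quot_scale (a : R) (x : pure_quot) : pure_quot :=
  \pi_(pure_quot) (a *: repr x).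

Fact pure_quot_scaleE a (v : V) :
  pure_quot_scale a (\pi_(pure_quot) v) = \pi_(pure_quot) (a *: v).
Proof.
apply/eqP; rewrite -Quotient.idealrBE -scalerBr rpredZ //.
by rewrite Quotient.idealrBE reprK.
Qed.

Fact pure_quot_scaleA a b x :
  pure_quot_scale a (pure_quot_scale b x) = pure_quot_scale (a * b) x.
Proof. by rewrite pure_quot_scaleE scalerA. Qed.
Fact pure_quot_scale1 : left_id 1 pure_quot_scale.
Proof. by move=> x; rewrite /pure_quot_scale scale1r reprK. Qed.
Fact pure_quot_scaleDr : right_distributive pure_quot_scale +%R.
Proof.
move=> a x y; rewrite -[x]reprK -[y]reprK -[_ + _]pi_addr.
by rewrite !pure_quot_scaleE scalerDr pi_addr.
Qed.
Fact pure_quot_scaleDl x : {morph pure_quot_scale^~ x : a b / a + b}.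
Proof. by move=> a b; rewrite /pure_quot_scale scalerDl pi_addr. Qed.

HB.instance Definition _ := GRing.Zmodule_isLmodule.Build R pure_quot
  pure_quot_scaleA pure_quot_scale1 pure_quot_scaleDr pure_quot_scaleDl.

End PureQuotient.

Section WedgeSum.
Variables (R : comNzRingType) (M1 : lmodType R) (M : nat -> lmodType R).
Variable psi : forall i, {linear M1 -> M i}.

Definition wedge_relations : {pred (M1 * dsum M)%type} :=
  fun z => `[< exists i (y : M1), z = (y, 0) - (0, dsum_inj (psi i y)) >].

Definition wedge_sum : lmodType R := pure_quot wedge_relations.

End WedgeSum.

Section Ordinals.
Variables (d : Order.disp_t) (W : orderType d).
Implicit Types a b l : W.

(* W is a well-order of type omega_1, so its elements are the countable
   ordinals. *)
Definition is_omega1 : Prop :=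
  [/\ well_order (<=%O : rel W),
      forall a, countable [set b : W | (b < a)%O]
    & ~ countable [set: W]].

Definition is_zero a : Prop := forall b, (a <= b)%O.

Definition is_succ_of a b : Prop :=
  (b < a)%O /\ forall c, (b < c)%O -> (a <= c)%O.

Definition is_succ a : Prop := exists b, is_succ_of a b.

Definition is_limit a : Prop := ~ is_zero a /\ ~ is_succ a.

(* f a n is the ordinal written a_n. *)
Definition fundamental_sequences (f : W -> nat -> W) : Prop :=
  (forall l, is_limit l ->
    [/\ {homo f l : m n / (m < n)%N >-> (m < n)%O},
        forall n, is_succ (f l n),
        forall n, (f l n < l)%O
      & forall b, (b < l)%O -> exists n, (b <= f l n)%O]) /\
  (forall a, ~ is_limit a -> forall n, f a n = a).

End Ordinals.

(* Plain tree length at most a, for a zero or a successor (no C has this for a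
   limit a: the notion is only used at the ordinals a_n). *)
Inductive plain_tree_length_le (R : comNzRingType) d (W : orderType d)
    (f : W -> nat -> W) : W -> Flat R -> Prop :=
| PlainTreeLength0 a (C : Flat R) :
    is_zero a -> finitely_generated C -> plain_tree_length_le f a C
| PlainTreeLengthS a b (C M1 : Flat R) (M : nat -> Flat R)
    (psi : forall i, {linear M1 -> M i}) :
    is_succ_of a b -> finitely_generated M1 ->
    (forall i, plain_tree_length_le f (f b i) (M i)) ->
    (forall i, injective (psi i)) ->
    direct_summand C (wedge_sum psi) ->
    plain_tree_length_le f a C.

Section ExactStructures.
Variable R : comNzRingType.

Definition short_exact (A B C : lmodType R)
    (i : {linear A -> B}) (p : {linear B -> C}) : Prop :=
  [/\ injective i, forall c, exists b, p b = c
    & forall b, p b = 0 <-> exists a, i a = b].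

Definition split_epi (B C : lmodType R) (p : {linear B -> C}) : Prop :=
  exists s : {linear C -> B}, forall c, p (s c) = c.

(* Classes of composable pairs A -> B -> C in Flat(R). *)
Definition pair_class : Type :=
  forall A B C : Flat R, {linear A -> B} -> {linear B -> C} -> Prop.

(* Kernels, cokernels, pushouts and pullbacks are those of the category
   Flat(R): their universal properties only test against objects of Flat(R). *)
Definition is_kernel (A B C : Flat R)
    (i : {linear A -> B}) (p : {linear B -> C}) : Prop :=
  (forall a, p (i a) = 0) /\
  forall (X : Flat R) (f : {linear X -> B}), (forall x, p (f x) = 0) ->
  exists2 g : {linear X -> A}, i \o g =1 f &
    forall g' : {linear X -> A}, i \o g' =1 f -> g' =1 g.

Definition is_cokernel (A B C : Flat R)
    (i : {linear A -> B}) (p : {linear B -> C}) : Prop :=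
  (forall a, p (i a) = 0) /\
  forall (X : Flat R) (f : {linear B -> X}), (forall a, f (i a) = 0) ->
  exists2 g : {linear C -> X}, g \o p =1 f &
    forall g' : {linear C -> X}, g' \o p =1 f -> g' =1 g.

Definition is_pushout (A B A' P : Flat R)
    (i : {linear A -> B}) (f : {linear A -> A'})
    (i' : {linear A' -> P}) (f' : {linear B -> P}) : Prop :=
  f' \o i =1 i' \o f /\
  forall (X : Flat R) (u : {linear B -> X}) (v : {linear A' -> X}),
    u \o i =1 v \o f ->
  exists2 g : {linear P -> X}, g \o f' =1 u /\ g \o i' =1 v &
    forall g' : {linear P -> X}, g' \o f' =1 u -> g' \o i' =1 v -> g' =1 g.

Definition is_pullback (B C C' P : Flat R)
    (p : {linear B -> C}) (f : {linear C' -> C})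
    (p' : {linear P -> C'}) (f' : {linear P -> B}) : Prop :=
  p \o f' =1 f \o p' /\
  forall (X : Flat R) (u : {linear X -> B}) (v : {linear X -> C'}),
    p \o u =1 f \o v ->
  exists2 g : {linear X -> P}, f' \o g =1 u /\ p' \o g =1 v &
    forall g' : {linear X -> P}, f' \o g' =1 u -> p' \o g' =1 v -> g' =1 g.

Section Quillen.
Variable E : pair_class.

Definition admissible_monic (A B : Flat R) (i : {linear A -> B}) : Prop :=
  exists (C : Flat R) (p : {linear B -> C}), E i p.

Definition admissible_epic (B C : Flat R) (p : {linear B -> C}) : Prop :=
  exists (A : Flat R) (i : {linear A -> B}), E i p.

Definition iso_closed : Prop :=
  forall (A B C A' B' C' : Flat R)
    (i : {linear A -> B}) (p : {linear B -> C})
    (i' : {linear A' -> B'}) (p' : {linear B' -> C'})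
    (a : {linear A -> A'}) (b : {linear B -> B'}) (c : {linear C -> C'}),
  bijective a -> bijective b -> bijective c ->
  b \o i =1 i' \o a -> c \o p =1 p' \o b -> E i p -> E i' p'.

(* Exact structures in the sense of Quillen, with the axioms as in
   T. Buehler, Exact categories, Definition 2.1. *)
Record exact_structure : Prop := MkExactStructure {
  exact_kernel_cokernel : forall (A B C : Flat R)
    (i : {linear A -> B}) (p : {linear B -> C}),
    E i p -> is_kernel i p /\ is_cokernel i p;
  exact_iso_closed : iso_closed;
  exact_id_monic : forall A : Flat R,
    admissible_monic (idfun : {linear A -> A});
  exact_id_epic : forall A : Flat R,
    admissible_epic (idfun : {linear A -> A});
  exact_comp_monic : forall (A B C : Flat R)
    (i : {linear A -> B}) (j : {linear B -> C}),
    admissible_monic i -> admissible_monic j ->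
    admissible_monic (j \o i : {linear A -> C});
  exact_comp_epic : forall (A B C : Flat R)
    (p : {linear A -> B}) (q : {linear B -> C}),
    admissible_epic p -> admissible_epic q ->
    admissible_epic (q \o p : {linear A -> C});
  exact_pushout : forall (A B A' : Flat R)
    (i : {linear A -> B}) (f : {linear A -> A'}), admissible_monic i ->
    exists (P : Flat R) (i' : {linear A' -> P}) (f' : {linear B -> P}),
      is_pushout i f i' f' /\ admissible_monic i';
  exact_pullback : forall (B C C' : Flat R)
    (p : {linear B -> C}) (f : {linear C' -> C}), admissible_epic p ->
    exists (P : Flat R) (p' : {linear P -> C'}) (f' : {linear P -> B}),
      is_pullback p f p' f' /\ admissible_epic p'
}.

Definition nontrivial_class : Prop :=
  exists (A B C : Flat R) (i : {linear A -> B}) (p : {linear B -> C}),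
    [/\ E i p, short_exact i p & ~ split_epi p].

End Quillen.

Definition sub_class (E F : pair_class) : Prop :=
  forall (A B C : Flat R) (i : {linear A -> B}) (p : {linear B -> C}),
    E A B C i p -> F A B C i p.

Definition proper_sub_class (E F : pair_class) : Prop :=
  sub_class E F /\ ~ sub_class F E.

Definition projectively_generated (I : Flat R -> Prop) : pair_class :=
  fun A B C i p => short_exact i p /\
    forall X : Flat R, I X -> forall f : {linear X -> C},
    exists g : {linear X -> B}, p \o g =1 f.

End ExactStructures.

Definition plain_exact (R : comNzRingType) d (W : orderType d)
    (f : W -> nat -> W) (a : W) : pair_class R :=
  projectively_generated
    (fun X => exists n, plain_tree_length_le f (f a n) X).
Arguments plain_exact R {d W} f a.

(* Main.v *)
(* Over a Dedekind domain, flat means torsion-free, by the injectivity of divisible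
   modules, and pure submodules are those closed under division by nonzero
   scalars. A class of flat modules projectively generates an exact structure, and
   plain tree length is monotone, so the E_a decrease. That E_a differs from
   E_{a+1} is witnessed by an E_a-exact sequence with cokernel a module X_a of
   plain tree length at most a+1, which nevertheless does not split.

   The X_a are attached to well-founded trees whose nodes are labelled by ordinals:
   the children of a node labelled c > 0 are labelled by the predecessors of the
   c_i. At a leaf (label 0) X is the fraction field K, and at a node it is an
   extension of the direct sum of the modules Z_i of the children by R e. Such an
   extension has plain tree length at most a+1 because it is the wedge sum over R e
   of the preimages of the Z_i. The extensions are given by generic elements of a
   completion of R, chosen by a Baire argument, so that X is rigid: an
   endomorphism killing e is zero.

   The sequence over K is a free resolution. Given nonsplit covers B_i -> Z_i, the
   cover of X is the direct sum over n of the pullbacks to X of the direct sum of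
   the Z_i for i < n and of the B_i for i >= n. A map from a wedge sum over a
   finite module sends this finite module to finitely many of the Z_i, so that,
   for n large, the rest can be lifted componentwise by induction. By rigidity a
   section of the cover of X would give sections of B_i -> Z_i for large i. *)
From HB Require Import structures.
Require Import Defs.
From mathcomp Require Import all_boot all_order all_algebra.
From mathcomp Require Import generic_quotient ring_quotient.
From mathcomp Require Import fraction mxpoly sesquilinear.
From mathcomp Require Import boolp classical_sets functions cardinality.
From mathcomp Require Import ring.

Set Implicit Arguments.
Unset Strict Implicit.
Unset Printing Implicit Defensive.

Import Order.TTheory GRing.Theory.

Local Open Scope ring_scope.
Local Open Scope quotient_scope.

(** * Submodules and quotients *)

Section Linear.
Variable R : comNzRingType.

(** A cover of X has to resist splitting and yet lift every module of bounded length. The plain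
    direct sum of the B_i fails the second demand: the part of a map that lands in the first few Z_i
    may come from a module too long for those B_i. Putting the identity of Z_i in place of B_i there
    repairs this, but how many terms must be replaced depends on the map, so the covers for all n
    have to be summed. A section could then spread over infinitely many of them; rigidity prevents
    it, because the components of a section give endomorphisms of X determined by their value at e,
    and almost all of them kill e. To obtain rigidity, each leaf vector is tied to each of its
    ancestors by its own parameter in the completion, and all divisibility at inner nodes comes from
    these parameters. An endomorphism killing e then forces congruences that are polynomial in the
    parameters with coefficients in R. As R is countable, there are only countably many such
    polynomials, so one generic family of parameters serves all trees and all endomorphisms at
    once. *)

Definition mk_linear (U V : lmodType R) (f : U -> V) (fL : linear f) :
  {linear U -> V} := HB.pack f (GRing.isLinear.Build R U V *:%R f fL).

Lemma mk_linearE (U V : lmodType R) (f : U -> V) (fL : linear f) x :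
  mk_linear fL x = f x.
Proof. by []. Qed.

Lemma linear_exists (U V : lmodType R) (f : U -> V) :
  linear f -> exists g : {linear U -> V}, g =1 f.
Proof. by move=> fL; exists (mk_linear fL). Qed.

Lemma lift_injective (X S V : lmodType R) (i : {linear S -> V})
    (f : {linear X -> V}) :
  injective i -> (forall x, exists s, i s = f x) ->
  exists g : {linear X -> S}, forall x, i (g x) = f x.
Proof.
move=> i_inj /choice[g gP].
have gL : linear g by move=> a x y; apply: i_inj; rewrite gP !linearP !gP.
by exists (mk_linear gL).
Qed.

Lemma factor_surjective (V Q P : lmodType R) (p : {linear V -> Q})
    (f : {linear V -> P}) :
  (forall q, exists v, p v = q) -> (forall v, p v = 0 -> f v = 0) ->
  exists g : {linear Q -> P}, forall v, g (p v) = f v.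
Proof.
move=> /choice[s sP] pf.
have eqf v w : p v = p w -> f v = f w.
  by move=> pvw; apply/subr0_eq; rewrite -linearB pf // linearB pvw subrr.
have gL : linear (f \o s).
  by move=> a x y /=; rewrite -linearP; apply: eqf; rewrite linearP !sP.
by exists (mk_linear gL) => v; apply: eqf; rewrite sP.
Qed.

Section Submodule.
Variables (V : lmodType R) (P : {pred V}) (PZ : submod_closed P).

(** The alias takes the closure proof as an argument, so that the structure of an arbitrary closed
    [P] can be inferred from syntax. *)
Definition submod_pred (_ : submod_closed P) : {pred V} := P.
HB.instance Definition _ :=
  GRing.isSubmodClosed.Build R V (submod_pred PZ) PZ.

Record submod := Submod { submod_val :> V; _ : submod_val \in submod_pred PZ }.
HB.instance Definition _ := [isSub for submod_val].
HB.instance Definition _ := [Choice of submod by <:].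
HB.instance Definition _ := [SubChoice_isSubLmodule of submod by <:].

Definition quot_mod : Type := Quotient.quot (submod_pred PZ).
HB.instance Definition _ := GRing.Zmodule.on quot_mod.
HB.instance Definition _ := EqQuotient.on quot_mod.

Definition quot_mod_scale (a : R) (x : quot_mod) : quot_mod :=
  \pi_(quot_mod) (a *: repr x).

Fact quot_mod_scaleE a (v : V) :
  quot_mod_scale a (\pi_(quot_mod) v) = \pi_(quot_mod) (a *: v).
Proof.
apply/eqP; rewrite -Quotient.idealrBE -scalerBr rpredZ //.
by rewrite Quotient.idealrBE reprK.
Qed.

Fact quot_mod_scaleA a b x :
  quot_mod_scale a (quot_mod_scale b x) = quot_mod_scale (a * b) x.
Proof. by rewrite quot_mod_scaleE scalerA. Qed.
Fact quot_mod_scale1 : left_id 1 quot_mod_scale.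
Proof. by move=> x; rewrite /quot_mod_scale scale1r reprK. Qed.
Fact quot_mod_scaleDr : right_distributive quot_mod_scale +%R.
Proof.
move=> a x y; rewrite -[x]reprK -[y]reprK -[_ + _]pi_addr.
by rewrite !quot_mod_scaleE scalerDr pi_addr.
Qed.
Fact quot_mod_scaleDl x : {morph quot_mod_scale^~ x : a b / a + b}.
Proof. by move=> a b; rewrite /quot_mod_scale scalerDl pi_addr. Qed.

HB.instance Definition _ := GRing.Zmodule_isLmodule.Build R quot_mod
  quot_mod_scaleA quot_mod_scale1 quot_mod_scaleDr quot_mod_scaleDl.

Lemma submod_exists :
  exists (S : lmodType R) (i : {linear S -> V}), injective i /\
    forall v, v \in P <-> exists s, i s = v.
Proof.
exists submod; have iL : linear (submod_val : submod -> V) by [].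
exists (mk_linear iL); split=> [x y /val_inj // | v].
by split=> [Pv | [[w Pw] <-]] //; exists (Submod (Pv : v \in submod_pred PZ)).
Qed.

Lemma quotient_exists :
  exists (Q : lmodType R) (p : {linear V -> Q}),
    (forall q, exists v, p v = q) /\ forall v, p v = 0 <-> v \in P.
Proof.
exists quot_mod.
have pL : linear (\pi_(quot_mod)%qT : V -> quot_mod).
  by move=> a x y; rewrite pi_addr -quot_mod_scaleE.
exists (mk_linear pL); split=> [q | v]; first by exists (repr q); apply: reprK.
rewrite mk_linearE; have -> : (v \in P) = (v - 0 \in submod_pred PZ).
  by rewrite subr0.
by rewrite Quotient.idealrBE pi_zeror; split=> /eqP.
Qed.

End Submodule.

Lemma pure_quot_proj (V : lmodType R) (S : {pred V}) :
  exists p : {linear V -> pure_quot S}, (forall q, exists v, p v = q) /\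
    forall v, p v = 0 <-> v \in pure_span S.
Proof.
have pL : linear (\pi_(pure_quot S)%qT : V -> pure_quot S).
  by move=> a x y; rewrite pi_addr -pure_quot_scaleE.
exists (mk_linear pL); split=> [q | v]; first by exists (repr q); apply: reprK.
rewrite mk_linearE; have -> : (v \in pure_span S) = (v - 0 \in pure_span S).
  by rewrite subr0.
by rewrite Quotient.idealrBE pi_zeror; split=> /eqP.
Qed.

Lemma submod_closedP (V : lmodType R) (P : V -> Prop) :
  P 0 -> (forall a u v, P u -> P v -> P (a *: u + v)) ->
  submod_closed (fun v => `[< P v >]).
Proof.
move=> P0 PZ; split; first exact/asboolP.
by move=> a u v /asboolP Pu /asboolP Pv; apply/asboolP/PZ.
Qed.

Definition torsion_free (M : lmodType R) : Prop :=
  forall (r : R) (m : M), r != 0 -> r *: m = 0 -> m = 0.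

End Linear.

Lemma countable_inj T U (f : T -> U) :
  injective f -> countable [set: U] -> countable [set: T].
Proof.
move=> f_inj /countable_injP[g g_inj]; apply/countable_injP; exists (g \o f).
by move=> x y _ _ /= /(g_inj _ _ (in_setT _) (in_setT _)) /f_inj.
Qed.

Lemma countable_surj T U (f : T -> U) :
  (forall u, exists t, f t = u) -> countable [set: T] -> countable [set: U].
Proof.
by move=> /choice[g gP]; apply: (@countable_inj _ _ g) => x y gxy; rewrite -(gP x) gxy.
Qed.

(** * Invertible ideals *)

Section Ideals.
Variable R : idomainType.
Implicit Types P Q : R -> Prop.

(** Unlike in [idealr_closed], the unit ideal is allowed: sums of ideals and colon ideals may be
    everything. *)
Definition ideal P : Prop := P 0 /\ forall a x y, P x -> P y -> P (a * x + y).

(* The elements b i / s of the fraction field multiply P into R. *)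
Definition invertible P : Prop :=
  exists (s : R) (I : finType) (a b : I -> R),
    [/\ s != 0, forall i, P (a i),
        forall i x, P x -> exists r, b i * x = s * r & \sum_i b i * a i = s].

Lemma idealM P a x : ideal P -> P x -> P (a * x).
Proof. by case=> P0 PM Px; rewrite -[_ * _]addr0; apply: PM. Qed.

Lemma idealD P x y : ideal P -> P x -> P y -> P (x + y).
Proof. by case=> P0 PM Px Py; rewrite -[x]mul1r; apply: PM. Qed.

Lemma noetherian_fg P : noetherian R -> ideal P ->
  exists n (g : 'I_n -> R),
    forall x, P x <-> exists c : 'I_n -> R, x = \sum_i c i * g i.
Proof.
move=> noeth [P0 PM].
have [n [g gP]] := noeth (fun x => `[< P x >])
  (@submod_closedP R R^o P P0 (fun a u v => PM a u v)).
by exists n, g => x; rewrite -gP; split => /asboolP.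
Qed.

(** Without a maximal member, choice yields a strictly increasing chain in [F]; its union is
    finitely generated, hence already contained in one term of the chain. *)
Lemma noetherian_max (F : (R -> Prop) -> Prop) :
  noetherian R -> (forall P, F P -> ideal P) -> (exists P, F P) ->
  exists P, F P /\ forall Q, F Q -> (forall x, P x -> Q x) ->
    forall x, Q x -> P x.
Proof.
move=> noeth Fideal [P0 FP0]; apply: contrapT => nomax.
have step (P : {P | F P}) : exists Q : {P | F P},
    (forall x, sval P x -> sval Q x) /\ exists x, sval Q x /\ ~ sval P x.
  case: P => P FP /=; apply: contrapT => noQ; apply: nomax; exists P.
  split=> // Q FQ PQ x Qx; apply: contrapT => nPx; apply: noQ.
  by exists (exist _ Q FQ); split => //; exists x.
have [next nextP] := choice step.
pose c n := iter n next (exist _ P0 FP0).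
have cS n x : sval (c n) x -> sval (c n.+1) x by apply: (nextP (c n)).1.
have c_le m n x : (m <= n)%N -> sval (c m) x -> sval (c n) x.
  by move=> /subnK <-; elim: (n - m)%N => //= k IHk /IHk; apply: cS.
pose U x := exists n, sval (c n) x.
have Uideal : ideal U.
  split=> [|a x y [m xm] [n yn]].
    by exists 0%N; have [] := Fideal _ (svalP (c 0%N)).
  exists (maxn m n); have [_] := Fideal _ (svalP (c (maxn m n))); apply.
    exact: c_le (leq_maxl _ _) xm.
  exact: c_le (leq_maxr _ _) yn.
have [n [g gP]] := noetherian_fg noeth Uideal.
have /choice[N NP] (i : 'I_n) : exists N, sval (c N) (g i).
  by apply/gP; exists (fun j => (j == i)%:R);
    rewrite (bigD1 i) //= eqxx mul1r big1 ?addr0 // => j /negbTE->; rewrite mul0r.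
pose M := \max_i N i.
have UM x : U x -> sval (c M) x.
  have [cM0 cMM] := Fideal _ (svalP (c M)).
  move=> /gP[a ->]; elim/big_rec: _ => // i y _ yM; apply: cMM => //.
  by apply: c_le (NP i); apply: leq_bigmax.
have [_ [x [xS nx]]] := nextP (c M).
by apply: nx; apply: UM; exists M.+1.
Qed.

(** [L] is the colon ideal (P : J). A fraction b / s taking [J] into R takes [P] into [L], since (b
    x / s) w = (b w / s) x for x in [P] and w in [J]. Products of the dual generators of [J] and [L]
    therefore serve for [P]. *)
Lemma invertible_mul P J L :
  ideal P -> invertible J -> invertible L ->
  (forall x, P x -> J x) -> (forall z, L z <-> forall w, J w -> P (z * w)) ->
  invertible P.
Proof.
move=> Pid [s [I [a [b [s0 aJ bJ sE]]]]] [s' [I' [a' [b' [s'0 aL bL sE']]]]] PJ LE.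
exists (s * s'), (I * I')%type, (fun k => a k.1 * a' k.2),
  (fun k => b k.1 * b' k.2).
split=> [|[i j] /=|[i j] x Px /=|]; first by rewrite mulf_neq0.
- by rewrite mulrC; have /LE := aL j; apply; apply: aJ.
- have [r rE] := bJ i x (PJ x Px).
  have /bL-/(_ j)[r' r'E] : L r.
    apply/LE => w Jw; have [t tE] := bJ i w Jw.
    have -> : r * w = t * x.
      by apply: (mulfI s0); rewrite !mulrA -rE -tE; ring.
    exact: idealM.
  by exists r'; rewrite mulrAC rE -[s * r * _]mulrA [r * _]mulrC r'E; ring.
- rewrite -[X in X * _]sE -sE' mulr_suml.
  rewrite (eq_bigr (fun i => \sum_j b i * a i * (b' j * a' j))); last first.
    by move=> i _; rewrite mulr_sumr.
  by rewrite pair_big; apply: eq_bigr => -[i j] _ /=; ring.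
Qed.

(** Multiplication by b / a would stabilise a finitely generated ideal, whose vector of generators
    is then an eigenvector of a matrix over R. So b / a is a root of a characteristic polynomial,
    hence lies in R. *)
Lemma not_integral_ideal P a b : noetherian R -> integrally_closed R ->
  ideal P -> (exists2 x, P x & x != 0) -> a != 0 -> (forall c, b <> a * c) ->
  (forall x, P x -> exists2 c, P c & b * x = a * c) -> False.
Proof.
move=> noeth icl Pid [x0 Px0 x0_neq0] a0 nab bP.
have [n [g gP]] := noetherian_fg noeth Pid.
have Pg i : P (g i).
  by apply/gP; exists (fun j => (j == i)%:R);
    rewrite (bigD1 i) //= eqxx mul1r big1 ?addr0 // => j /negbTE->; rewrite mul0r.
have /choice[C CE] i : exists c : 'I_n -> R, b * g i = a * \sum_j c j * g j.
  by have [c /gP[c' ->] ->] := bP _ (Pg i); exists c'.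
pose A : 'M[R]_n := \matrix_(j, i) C i j.
pose u := tofrac b / tofrac a.
have ta0 : tofrac a != 0 by rewrite tofrac_eq0.
have [|r ur] := icl u.
  exists (char_poly A); first exact: char_poly_monic.
  rewrite map_char_poly -eigenvalue_root_char; apply/eigenvalueP.
  exists (\row_i tofrac (g i)).
    apply/rowP => i; rewrite !mxE.
    apply: (mulfI ta0); rewrite mulrA /u mulrCA divff // mulr1.
    rewrite -tofracM CE tofracM; congr (_ * _).
    by rewrite raddf_sum /=; apply: eq_bigr => j _; rewrite !mxE tofracM mulrC.
  apply: contraNneq x0_neq0 => /rowP g0.
  have [c ->] : exists c : 'I_n -> R, x0 = \sum_i c i * g i by apply/gP.
  rewrite big1 // => i _; have := g0 i; rewrite !mxE => /eqP.
  by rewrite tofrac_eq0 => /eqP ->; rewrite mulr0.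
apply: (nab r); apply/eqP; rewrite -tofrac_eq tofracM -ur /u mulrCA divff //.
by rewrite mulr1.
Qed.

Lemma prime_ideal_maximal P Q : prime_ideals_maximal R -> ideal P -> ~ P 1 ->
  (forall x y, P (x * y) -> P x \/ P y) -> (exists2 x, P x & x != 0) ->
  ideal Q -> ~ Q 1 -> (forall x, P x -> Q x) -> forall x, Q x -> P x.
Proof.
move=> pmax Pid P1 Pprime [a Pa a0] Qid Q1 PQ x Qx; apply/asboolP.
have idealP S : ideal S -> ~ S 1 -> idealr_closed (fun x : R => `[< S x >]).
  move=> [S0 SM] S1; split; [exact/asboolP|exact/asboolP|].
  by move=> e u v /asboolP Su /asboolP Sv; apply/asboolP/SM.
apply: (pmax (fun x => `[< P x >]) _ _ _ (fun x => `[< Q x >])).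
- exact: idealP.
- by move=> u v /asboolP/Pprime[] h; apply/orP; [left|right]; apply/asboolP.
- by exists a => //; apply/asboolP.
- exact: idealP.
- by move=> y /asboolP/PQ/asboolP.
- exact/asboolP.
Qed.

(* An ideal maximal among the nonzero noninvertible ones is prime, hence maximal.
   It is then a colon ideal (a : b), where b / a is not in R, and an ideal stable
   under b / a would make b / a integral. *)
Lemma dedekind_invertible P : dedekind_domain R -> ideal P ->
  (exists2 x, P x & x != 0) -> invertible P.
Proof.
case=> noeth icl pmax; move: P.
suff noF : ~ exists P,
    [/\ ideal P, exists2 x, P x & x != 0 & ~ invertible P].
  by move=> P Pid Pnz; apply: contrapT => Pinv; apply: noF; exists P.
move=> exF; have [|P [[Pid Pnz Pninv] Pmax]] := noetherian_max noeth _ exF.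
  by move=> P [].
have [P0 PM] := Pid; have [a Pa a0] := Pnz.
have P1 : ~ P 1.
  move=> P1; apply: Pninv; exists 1, unit, (fun=> 1), (fun=> 1).
  split=> //; first exact: oner_neq0.
    by move=> _ x _; exists x.
  by rewrite big_const card_unit /= mul1r addr0.
have bigger Q y : ideal Q -> (forall x, P x -> Q x) -> Q y -> ~ P y ->
    invertible Q.
  move=> Qid PQ Qy nPy; apply: contrapT => Qninv; apply: nPy.
  by apply: (Pmax Q) => //; split=> //; exists a => //; apply: PQ.
(* Otherwise [J] = P + R x and [L] = (P : J), which contains [y], are strictly larger than [P],
   hence invertible, and [P] would be invertible too. *)
have Pprime x y : P (x * y) -> P x \/ P y.
  move=> Pxy; apply: contrapT => /not_orP[nPx nPy].
  pose J z := exists c p, P p /\ z = c * x + p.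
  pose L z := forall w, J w -> P (z * w).
  apply: Pninv; apply: (@invertible_mul P J L) => //.
  - apply: (bigger _ x) => //.
    + split; first by exists 0, 0; rewrite mul0r addr0.
      move=> e _ _ [c [p [Pp ->]]] [c' [p' [Pp' ->]]].
      by exists (e * c + c'), (e * p + p'); split; [apply: PM | ring].
    + by move=> z Pz; exists 0, z; rewrite mul0r add0r.
    + by exists 1, 0; rewrite mul1r addr0.
  - apply: (bigger _ y) => //.
    + split; first by move=> w _; rewrite mul0r.
      move=> e z z' Lz Lz' w Jw; rewrite mulrDl -mulrA.
      by apply: PM; [apply: Lz | apply: Lz'].
    + by move=> z Pz w _; rewrite mulrC; apply: idealM.
    + move=> _ [c [p [Pp ->]]]; rewrite mulrDr; apply: idealD => //.
        by rewrite mulrCA [y * x]mulrC; apply: idealM.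
      exact: idealM.
  - by move=> z Pz; exists 0, z; rewrite mul0r add0r.
(* [colon b] consists of the r with r b / a in R. A maximal one among those inside [P] is prime and
   contains [a], so it is all of [P]. *)
pose colon b r := exists c, r * b = a * c.
pose F2 Q := exists b, Q = colon b /\ forall r, colon b r -> P r.
have colon_ideal b : ideal (colon b).
  split; first by exists 0; rewrite mul0r mulr0.
  move=> e x y [c xc] [c' yc']; exists (e * c + c').
  by rewrite mulrDl -mulrA xc yc'; ring.
have colon_a b : colon b a by exists b.
have [||Q [[b [QE bP]] Qmax]] := @noetherian_max F2 noeth.
- by move=> Q [b [-> _]]; apply: colon_ideal.
- exists (colon 1), 1; split=> // r [c]; rewrite mulr1 => ->.
  by rewrite mulrC; apply: idealM.
have Q1 : ~ colon b 1 by move=> /bP.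
have Qprime x y : colon b (x * y) -> colon b x \/ colon b y.
  move=> bxy; apply: contrapT => /not_orP[nbx nby].
  (* This colon ideal contains both [colon b] and [y]; by maximality it cannot lie inside [P] unless
     [y] is in [colon b]. *)
  have : ~ forall r, colon (b * x) r -> P r.
    move=> bxP; apply: nby; rewrite -QE; apply: (Qmax (colon (b * x))).
    - by exists (b * x).
    - by rewrite QE => r [c rc]; exists (c * x); rewrite mulrA rc mulrA.
    - by case: bxy => c xyc; exists c; rewrite -xyc; ring.
  move=> /existsNP[v /not_implyP[[c vc] nPv]].
  apply: nbx; rewrite -QE; apply: (Qmax (colon (b * v))).
  - exists (b * v); split=> // r [e re].
    have /bP/Pprime[] // : colon b (r * v) by exists e; rewrite -re; ring.
  - by rewrite QE => r [e re]; exists (e * v); rewrite mulrA re mulrA.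
  - by exists c; rewrite -vc; ring.
have PQ x : P x -> colon b x.
  move: x; apply: (prime_ideal_maximal pmax) => //; first by exists a.
have nab c : b <> a * c by move=> bac; apply: Q1; exists c; rewrite mul1r.
have : ~ forall x, P x -> exists2 c, P c & b * x = a * c.
  by move=> h; apply: (not_integral_ideal noeth icl Pid Pnz a0 nab h).
(* For some q in [P] the element y = b q / a lies in R but not in [P]; as [P] is maximal, P + R y
   contains 1. *)
move=> /existsNP[q /not_implyP[Pq noy]].
have [y yE] := PQ q Pq.
have nPy : ~ P y by move=> Py; apply: noy; exists y; rewrite 1?mulrC.
have [m [r [Pm E1]]] : exists m r, P m /\ 1 = m + r * y.
  apply: contrapT => noJ; apply: nPy.
  pose J z := exists r p, P p /\ z = p + r * y.
  apply: (@prime_ideal_maximal P J) => //.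
  - split; first by exists 0, 0; rewrite mul0r addr0.
    move=> e u v [c [p [Pp ->]]] [c' [p' [Pp' ->]]].
    by exists (e * c + c'), (e * p + p'); split; [apply: PM|ring].
  - by move=> [r [p [Pp E]]]; apply: noJ; exists p, r.
  - by move=> z Pz; exists 0, z; rewrite mul0r addr0.
  - by exists 1, 0; rewrite mul1r add0r.
(* The dual basis is read off 1 = m + r y with y = b q / a: [m] is paired with 1 and [q] with r b /
   a, over the common denominator [a]. *)
apply: Pninv; exists a, bool, (fun i => if i then m else q),
  (fun i => if i then a else r * b).
split=> //; first by case.
- move=> [] x Px; first by exists x.
  by have [c xc] := PQ x Px; exists (r * c); rewrite -mulrA [b * x]mulrC xc; ring.
- by rewrite big_bool /= -[RHS]mulr1 E1 -mulrA [b * q]mulrC yE; ring.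
Qed.

End Ideals.

(** * Flatness and purity *)

Section FractionModule.
Variable R : idomainType.

Definition frac_mod := {fraction R}.
HB.instance Definition _ := GRing.Zmodule.on frac_mod.

Fact frac_scaleA (a b : R) (x : {fraction R}) :
  tofrac a * (tofrac b * x) = tofrac (a * b) * x.
Proof. by rewrite tofracM mulrA. Qed.
Fact frac_scale1 (x : {fraction R}) : tofrac (1 : R) * x = x.
Proof. by rewrite tofrac1 mul1r. Qed.
Fact frac_scaleDr (a : R) (x y : {fraction R}) :
  tofrac a * (x + y) = tofrac a * x + tofrac a * y.
Proof. exact: mulrDr. Qed.
Fact frac_scaleDl (x : {fraction R}) (a b : R) :
  tofrac (a + b) * x = tofrac a * x + tofrac b * x.
Proof. by rewrite tofracD mulrDl. Qed.

HB.instance Definition _ := GRing.Zmodule_isLmodule.Build R frac_mod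
  frac_scaleA frac_scale1 frac_scaleDr frac_scaleDl.

Lemma frac_modZ (r : R) (x : {fraction R}) :
  r *: (x : frac_mod) = (tofrac r * x : {fraction R}).
Proof. by []. Qed.

End FractionModule.

Section Flatness.
Variable R : idomainType.
Hypothesis R_dedekind : dedekind_domain R.

Definition divisible (D : lmodType R) : Prop :=
  forall (r : R) (d : D), r != 0 -> exists d', r *: d' = d.

Lemma ideal_hom_extension (D : lmodType R) (P : R -> Prop) (h : R -> D) :
  divisible D -> ideal P ->
  (forall a x y, P x -> P y -> h (a * x + y) = a *: h x + h y) ->
  exists d, forall x, P x -> h x = x *: d.
Proof.
move=> Ddiv Pid hL; have [P0 PM] := Pid.
have h0 : h 0 = 0.
  have := hL (-1) 0 0 P0 P0; rewrite mulr0 addr0 => ->.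
  by rewrite scaleN1r addNr.
have [Pnz|Pz] := pselect (exists2 x, P x & x != 0); last first.
  exists 0 => x Px; rewrite scaler0; have [->//|x0] := eqVneq x 0.
  by case: Pz; exists x.
have [s [I [a [b [s0 aP bP sE]]]]] := dedekind_invertible R_dedekind Pid Pnz.
have /choice[d dE] i : exists d, a i *: d = h (a i).
  by have [->|/Ddiv//] := eqVneq (a i) 0; exists 0; rewrite h0 scaler0.
have /choice[r rE] i : exists r, b i * a i = s * r by apply: bP.
exists (\sum_i r i *: d i) => x Px.
have /choice[t tE] i : exists t, b i * x = s * t by apply: bP.
have xE : x = \sum_i t i * a i.
  apply: (mulfI s0); rewrite -[in LHS]sE mulr_suml mulr_sumr.
  by apply: eq_bigr => i _; rewrite mulrA -tE; ring.
transitivity (\sum_i t i *: h (a i)).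
  rewrite [in LHS]xE.
  suff [] : P (\sum_i t i * a i) /\
    h (\sum_i t i * a i) = \sum_i t i *: h (a i) by [].
  elim/big_rec2: _ => // i u v _ [Pv hv].
  by split; [apply: PM | rewrite hL // hv].
rewrite scaler_sumr; apply: eq_bigr => i _; rewrite -dE !scalerA.
congr (_ *: _); apply: (mulfI s0).
by rewrite mulrA -tE mulrCA -rE; ring.
Qed.

Section GraphExtension.
Variables (B D : lmodType R) (D_divisible : divisible D).

(** Graphs of partial linear maps: chains of them are joined by plain unions, which is the form in
    which Zorn's lemma is applied. *)
Definition linear_graph (G : set (B * D)) : Prop :=
  [/\ G (0, 0),
      forall a u v, G u -> G v -> G (a *: u.1 + v.1, a *: u.2 + v.2)
    & forall d, G (0, d) -> d = 0].

Lemma linear_graphP G a b d b' d' : linear_graph G -> G (b, d) -> G (b', d') ->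
  G (a *: b + b', a *: d + d').
Proof. by move=> [_ GL _] /GL h /h; apply. Qed.

Lemma linear_graph_fun G b d d' :
  linear_graph G -> G (b, d) -> G (b, d') -> d = d'.
Proof.
move=> Ggraph Gd Gd'; have [_ _ G0] := Ggraph; apply/eqP.
rewrite -subr_eq0 addrC -scaleN1r; apply/eqP/G0.
by have := linear_graphP (-1) Ggraph Gd' Gd; rewrite !scaleN1r addNr.
Qed.

Lemma linear_graph_step G b : linear_graph G ->
  exists G', [/\ linear_graph G', (G `<=` G')%classic & exists d, G' (b, d)].
Proof.
move=> Ggraph; have [G00 GL G0] := Ggraph.
(* The scalars taking [b] into the domain of [G] form an ideal; a value at [b] amounts to an
   extension to R of the map that [G] induces on this ideal. *)
pose P (r : R) := exists d, G (r *: b, d).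
have Pid : ideal P.
  split; first by exists 0; rewrite scale0r.
  move=> a x y [d xd] [d' yd']; exists (a *: d + d').
  by rewrite scalerDl -scalerA; apply: linear_graphP.
have /choice[h hP] r : exists d, P r -> G (r *: b, d).
  by have [[d ?]|nPr] := pselect (P r); [exists d | exists 0].
have [d dE] : exists d, forall r, P r -> h r = r *: d.
  apply: (ideal_hom_extension D_divisible Pid) => a x y Px Py.
  apply: (linear_graph_fun Ggraph (hP _ _)); first exact: (Pid.2).
  rewrite scalerDl -scalerA; exact: linear_graphP (hP _ Px) (hP _ Py).
pose G' (u : B * D) := exists v r, G v /\ u = (v.1 + r *: b, v.2 + r *: d).
exists G'; split.
- split; first by exists (0, 0), 0; rewrite !scale0r !addr0.
  + move=> a _ _ [v [r [Gv ->]]] [v' [r' [Gv' ->]]].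
    exists (a *: v.1 + v'.1, a *: v.2 + v'.2), (a * r + r'); split; first exact: GL.
    by congr pair; rewrite /= scalerDr scalerDl scalerA addrACA.
  + move=> d0 [[v1 v2] [r [Gv []]]] /= /esym/eqP; rewrite addr_eq0 => /eqP v1E ->.
    have Gr : G (r *: b, - v2).
      have := linear_graphP (-1) Ggraph Gv G00.
      by rewrite !scaleN1r !addr0 v1E opprK.
    have Pr : P r by exists (- v2).
    by rewrite -dE // -(linear_graph_fun Ggraph Gr (hP _ Pr)) addrN.
- by move=> [v1 v2] Gv; exists (v1, v2), 0; rewrite !scale0r !addr0.
- by exists d, (0, 0), 1; rewrite !scale1r !add0r.
Qed.

Lemma linear_graph_extension G0 : linear_graph G0 ->
  exists psi : {linear B -> D}, forall b d, G0 (b, d) -> psi b = d.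
Proof.
move=> G0graph; pose ok S := linear_graph S /\ (G0 `<=` S)%classic.
(* The guard lets the empty set through, as it is the union of the empty chain; it is not maximal,
   since [G0] is larger. *)
pose P (S : set (B * D)) := (exists x, S x) -> ok S.
have [F FP Ftot|A [PA Amax]] := @Zorn_bigcup _ P.
  move=> [x0 [X0 FX0 X0x0]].
  have F_ok X x : F X -> X x -> ok X by move=> FX Xx; apply: (FP X FX); exists x.
  have both X Y u v : F X -> F Y -> X u -> Y v -> exists Z, [/\ F Z, Z u & Z v].
    move=> FX FY Xu Yv; have [XY|YX] := Ftot _ _ FX FY.
      by exists Y; split=> //; apply: XY.
    by exists X; split=> //; apply: YX.
  have [[X00 _ _] G0X0] := F_ok _ _ FX0 X0x0.
  split; last by move=> u /G0X0; exists X0.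
  split; first by exists X0.
  - move=> a u v [X FX Xu] [Y FY Yv]; have [Z [FZ Zu Zv]] := both _ _ _ _ FX FY Xu Yv.
    by exists Z => //; have [[_ ZL _] _] := F_ok _ _ FZ Zu; apply: ZL.
  - by move=> d [X FX Xd]; have [[_ _ Xfun] _] := F_ok _ _ FX Xd; apply: Xfun.
have Aok : ok A.
  apply: PA; apply: contrapT => A_empty; apply: (Amax G0); last by move=> _; split.
  rewrite properEneq; split; last by move=> x Ax; case: A_empty; exists x.
  by apply/eqP => AG0; apply: A_empty; exists (0, 0); rewrite AG0; case: G0graph.
have [Agraph G0A] := Aok.
have /choice[psi psiP] b : exists d, A (b, d).
  have [G' [G'graph AG' [d G'd]]] := linear_graph_step b Agraph.
  exists d; suff -> : A = G' by [].
  apply: contrapT => AG'neq; apply: (Amax G').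
    by rewrite properEneq; split=> //; apply/eqP.
  by move=> _; split=> // u /G0A/AG'.
have psiL : linear psi.
  by move=> a u v; apply: (linear_graph_fun Agraph (psiP _)); apply: linear_graphP.
by exists (mk_linear psiL) => b d /G0A Ad; apply: linear_graph_fun Ad.
Qed.

End GraphExtension.

Lemma divisible_injective (A B D : lmodType R) (f : {linear A -> B})
    (phi : {linear A -> D}) :
  divisible D -> injective f ->
  exists psi : {linear B -> D}, forall a, psi (f a) = phi a.
Proof.
move=> Ddiv f_inj.
have [|psi psiP] := @linear_graph_extension B D Ddiv
    (fun u => exists a, u = (f a, phi a)).
- split; first by exists 0; rewrite !linear0.
    by move=> a _ _ [x ->] [y ->]; exists (a *: x + y); rewrite !linearP.
  by move=> d [a [/esym fa0 ->]]; rewrite (f_inj a 0) ?linear0.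
- by exists psi => a; apply: psiP; exists a.
Qed.

Definition mk_bilinear (U U' V : lmodType R) (f : U -> U' -> V)
    (fL : bilinear_for *:%R *:%R f) : {bilinear U -> U' -> V} :=
  HB.pack f (bilinear_isBilinear.Build R U U' V *:%R *:%R f fL).

(** Torsion-freeness makes r m |-> phi m well defined on r M, and injectivity of [D] extends this
    map to [M]. *)
Lemma hom_divisible (M D : lmodType R) : divisible D -> torsion_free M ->
  forall (r : R) (phi : {linear M -> D}), r != 0 ->
  exists psi : {linear M -> D}, forall m, r *: psi m = phi m.
Proof.
move=> Ddiv Mtf r phi r0.
have [|psi psiP] := @linear_graph_extension M D Ddiv
    (fun u => exists m, u = (r *: m, phi m)).
- split; first by exists 0; rewrite scaler0 linear0.
    move=> a _ _ [x ->] [y ->]; exists (a *: x + y).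
    by rewrite linearP scalerDr !scalerA mulrC.
  by move=> d [m [/esym/(Mtf _ _ r0) -> ->]]; rewrite linear0.
- by exists psi => m; rewrite -linearZ; apply: psiP; exists m.
Qed.

End Flatness.

Section FlatTorsionFree.
Variable R : idomainType.

Lemma mul_tensor (M : lmodType R) :
  exists t : {bilinear R^o -> M -> M},
    (forall x m, t x m = x *: m) /\ is_tensor_product t.
Proof.
have tL : bilinear_for *:%R *:%R (fun (x : R^o) (m : M) => x *: m).
  split=> [m a x y | x a m m'] /=; first by rewrite scalerDl scalerA.
  by rewrite scalerDr !scalerA mulrC.
exists (mk_bilinear tL); split=> // P b.
pose tE x m : mk_bilinear tL x m = x *: m := erefl.
have gL : linear (b 1) by move=> a x y; rewrite linearPr.
have bE x m : b 1 (x *: m) = b x m.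
  by rewrite linearZr_LR -linearZl_LR /= -[_ *: _]/(x * 1) mulr1.
exists (mk_linear gL) => [x m | g' g'E m]; first exact: bE.
by rewrite /= -(g'E 1 m) tE scale1r.
Qed.

(** Tensoring the injection x |-> r x of R with [M] gives multiplication by r on [M]. *)
Lemma flat_torsion_free (M : lmodType R) : flat M -> torsion_free M.
Proof.
move=> Mflat r m r0 rm0; have [t [tE tens]] := mul_tensor M.
have fL : linear (fun x : R^o => (r * x : R^o)).
  by move=> a x y; rewrite mulrDr -[a *: x]/(a * x) mulrCA.
have gL : linear (fun m : M => r *: m).
  by move=> a x y; rewrite scalerDr !scalerA mulrC.
have f_inj : injective (mk_linear fL) by move=> x y /(mulfI r0).
apply: (Mflat _ _ _ f_inj _ _ _ _ tens tens (mk_linear gL)).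
  by move=> x n; rewrite !tE !mk_linearE scalerA.
by rewrite linear0.
Qed.

Hypothesis R_dedekind : dedekind_domain R.

(* A nonzero element x of a module is detected by a map into K / ann x, where K
   is the fraction field. *)
Lemma divisible_detects (T : lmodType R) (x : T) : x != 0 ->
  exists (D : lmodType R) (psi : {linear T -> D}), divisible D /\ psi x != 0.
Proof.
move=> x0; pose ann (y : frac_mod R) := exists2 r : R, y = tofrac r & r *: x = 0.
have annZ : submod_closed (fun y => `[< ann y >]).
  apply: submod_closedP; first by exists 0; rewrite ?tofrac0 ?scale0r.
  move=> a _ _ [r -> rx] [s -> sx]; exists (a * r + s).
    by rewrite frac_modZ tofracD tofracM.
  by rewrite scalerDl -scalerA rx sx scaler0 addr0.
have [D [p [p_surj pE]]] := quotient_exists annZ.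
have Ddiv : divisible D.
  move=> r d r0; have [v <-] := p_surj d.
  exists (p ((tofrac r)^-1 * v : {fraction R})); rewrite -linearZ; congr (p _).
  by rewrite frac_modZ mulrA divff ?mul1r // tofrac_eq0.
pose iota (r : R) : frac_mod R := tofrac r.
have iotaL a r s : iota (a * r + s) = a *: iota r + iota s.
  by rewrite /iota frac_modZ tofracD tofracM.
have [|psi psiP] := @linear_graph_extension R R_dedekind T D Ddiv
    (fun u => exists r, u = (r *: x, p (iota r))).
  split.
  - by exists 0; rewrite scale0r /iota tofrac0 linear0.
  - move=> a _ _ [r ->] [s ->]; exists (a * r + s) => /=.
    by rewrite scalerDl -scalerA iotaL linearP.
  - move=> d [r [/esym rx ->]]; apply/pE/asboolP; by exists r.
exists D, psi; split=> //; apply: contraNneq x0 => psix.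
have : p (iota 1) = 0 by rewrite -psix; apply/esym/psiP; exists 1; rewrite scale1r.
move=> /pE/asboolP[r /eqP]; rewrite /iota tofrac_eq => /eqP <-.
by rewrite scale1r => ->.
Qed.

(* Extending A x M -> D to B x M is extending A -> Hom(M, D) to B, and
   Hom(M, D) is divisible. *)
Lemma torsion_free_flat (M : lmodType R) : torsion_free M -> flat M.
Proof.
move=> Mtf A B f f_inj TA TB tA tB tensA tensB g gE.
suff g0 x : g x = 0 -> x = 0.
  by move=> x y gxy; apply/subr0_eq/g0; rewrite linearB gxy subrr.
move=> gx0; apply/eqP; apply: contrapT => /negP x0.
have [D [iota [Ddiv /eqP iotax]]] := divisible_detects x0; apply: iotax.
(* Hom(M, D) is realised as a submodule of the module of all functions. *)
have linZ : submod_closed (fun phi : M -> D => `[< linear phi >]).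
  apply: submod_closedP => [a u v | a phi psi phiL psiL b u v].
    by rewrite /= scaler0 addr0.
  change ((a *: phi + psi) (b *: u + v)) with (a *: phi (b *: u + v) + psi (b *: u + v)).
  change ((a *: phi + psi) u) with (a *: phi u + psi u).
  change ((a *: phi + psi) v) with (a *: phi v + psi v).
  by rewrite phiL psiL !scalerDr !scalerA mulrC addrACA.
have [H [i [i_inj iE]]] := submod_exists linZ.
have iL h : linear (i h) by apply/asboolP; apply/iE; exists h.
have Hdiv : divisible H.
  move=> r h r0.
  have [psi psiE] := hom_divisible R_dedekind Ddiv Mtf (mk_linear (iL h)) r0.
  have [h' h'E] : exists h', i h' = psi.
    by apply/iE/asboolP => a u v; rewrite linearP.
  exists h'; apply: i_inj; rewrite linearZ h'E.
  by apply/funext => m; rewrite -[RHS]psiE.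
have fhomL : linear (fun a : A => (fun m : M => iota (tA a m))).
  move=> c a a'; apply/funext => m.
  by rewrite linearPl linearP.
have [a|phi phiE] := @lift_injective _ _ _ _ i (mk_linear fhomL) i_inj.
  by apply/iE/asboolP => c m m' /=; rewrite linearPr linearP.
have [psi psiE] := divisible_injective R_dedekind phi Hdiv f_inj.
have bL : bilinear_for *:%R *:%R (fun (y : B) (m : M) => i (psi y) m).
  split=> [m a y y' | y a m m'] /=; last exact: iL.
  by rewrite !linearP.
have [theta thetaE _] := tensB _ (mk_bilinear bL).
have cL : bilinear_for *:%R *:%R (fun (a : A) (m : M) => iota (tA a m)).
  by split=> [m c a a' | a c m m'] /=; rewrite ?linearPl ?linearPr linearP.
have [h _ hU] := tensA _ (mk_bilinear cL).
(* [iota] and [theta \o g] agree on pure tensors, so both equal the unique [h]; the second one kills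
   [x]. *)
have -> : iota x = h x by apply: hU.
have <- : (theta \o g) x = h x.
  apply: (hU (theta \o g)) => a m /=.
  by rewrite gE thetaE /= psiE phiE.
by rewrite /= gx0 linear0.
Qed.

End FlatTorsionFree.

(** * Submodules closed under division are pure *)

Section Purity.
Variable R : idomainType.
Hypothesis R_dedekind : dedekind_domain R.

(* e k j is q k * a j, where the q k in the inverse of the ideal generated by
   the a k satisfy \sum_k q k * a k = 1. *)
Lemma row_projector n (a : 'I_n -> R) : exists e : 'I_n -> 'I_n -> R,
  [/\ forall j, \sum_k a k * e k j = a j,
      forall k j l, e k j * a l = e k l * a j
    & (exists l, a l != 0) \/ forall k j, e k j = 0].
Proof.
have [[l al0]|a0] := pselect (exists l, a l != 0); last first.
  exists (fun _ _ => 0); split=> [j|k j l|]; try by rewrite !mul0r.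
    rewrite big1 => [|k _]; last by rewrite mulr0.
    by apply/esym/eqP; apply: contrapT => /negP aj0; apply: a0; exists j.
  by right.
pose J x := exists c : 'I_n -> R, x = \sum_j c j * a j.
have Jid : ideal J.
  split; first by exists (fun=> 0); rewrite big1 // => j _; rewrite mul0r.
  move=> c _ _ [u ->] [v ->]; exists (fun j => c * u j + v j).
  rewrite mulr_sumr -big_split; apply: eq_bigr => j _ /=.
  by rewrite mulrDl mulrA.
have Ja j : J (a j).
  exists (fun i => (i == j)%:R).
  by rewrite (bigD1 j) //= eqxx mul1r big1 ?addr0 // => i /negbTE->; rewrite mul0r.
have [|s [I [al [b [s0 alJ bJ sE]]]]] := dedekind_invertible R_dedekind Jid.
  by exists (a l).
have /choice[u uE] i := alJ i.
have /choice[t tE] i : exists t : 'I_n -> R, forall j, b i * a j = s * t j.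
  by have /choice[t tE] j := bJ i _ (Ja j); exists t.
exists (fun k j => \sum_i u i k * t i j); split; last by left; exists l.
- move=> j; apply: (mulfI s0); rewrite -[in RHS]sE mulr_suml mulr_sumr.
  under eq_bigr do rewrite !mulr_sumr.
  rewrite exchange_big; apply: eq_bigr => i _ /=; rewrite uE.
  rewrite mulr_sumr mulr_suml; apply: eq_bigr => k _.
  rewrite -!mulrA [RHS]mulrCA [a k * a j]mulrC [b i * _]mulrA tE; ring.
- move=> k j j'; rewrite !mulr_suml; apply: eq_bigr => i _.
  rewrite -!mulrA; congr (_ * _); apply: (mulfI s0).
  by rewrite !mulrA -!tE; ring.
Qed.

Variables (V : lmodType R) (N : {pred V}).
Hypotheses (N_submod : submod_closed N)
  (N_rd : forall (r : R) v, r != 0 -> r *: v \in N -> v \in N).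

HB.instance Definition _ :=
  GRing.isSubmodClosed.Build R V N N_submod.

(** Equations are eliminated one at a time. The rows of [e] from [row_projector] are proportional to
    the first equation, so e x lies in [N] after multiplication by a nonzero scalar, hence in [N].
    It solves the first equation, since that row is fixed by [e]; vectors (1 - e) w do not disturb
    this, and are left to solve the other equations, with coefficients multiplied by 1 - e. *)
Lemma rd_closed_system m n (a : 'I_m -> 'I_n -> R) (x : 'I_n -> V) :
  (forall i, \sum_j a i j *: x j \in N) ->
  exists2 y : 'I_n -> V, (forall j, y j \in N) &
    forall i, \sum_j a i j *: y j = \sum_j a i j *: x j.
Proof.
elim: m a => [a _|m IHm a aN].
  by exists (fun=> 0) => [j|[]//]; apply: rpred0.
have sumZ (b : 'I_n -> R) (e : 'I_n -> 'I_n -> R) (z : 'I_n -> V) :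
    \sum_k b k *: \sum_j e k j *: z j = \sum_j (\sum_k b k * e k j) *: z j.
  under eq_bigr do rewrite scaler_sumr.
  rewrite exchange_big; apply: eq_bigr => j _ /=.
  by rewrite scaler_suml; apply: eq_bigr => k _; rewrite scalerA.
have [e [ae ea a0]] := row_projector (a ord0).
pose y k := \sum_j e k j *: x j.
have yN k : y k \in N.
  case: a0 => [[l al0]|e0]; last first.
    by rewrite /y big1 ?rpred0 // => j _; rewrite e0 scale0r.
  apply: (N_rd al0); rewrite scaler_sumr.
  under eq_bigr => j _ do rewrite scalerA mulrC ea -scalerA.
  by rewrite -scaler_sumr rpredZ.
pose a' i j := a (lift ord0 i) j - \sum_k a (lift ord0 i) k * e k j.
have a'E i (z : 'I_n -> V) : \sum_j a' i j *: z j = \sum_j a (lift ord0 i) j *: z j -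
    \sum_k a (lift ord0 i) k *: \sum_j e k j *: z j.
  by rewrite sumZ -sumrB; apply: eq_bigr => j _; rewrite scalerBl.
have [i|w wN wE] := IHm a'.
  by rewrite a'E rpredB // rpred_sum // => k _; rewrite rpredZ // yN.
exists (fun k => y k + (w k - \sum_j e k j *: w j)) => [k|i].
  by rewrite rpredD ?yN // rpredB // rpred_sum // => j _; rewrite rpredZ.
under eq_bigr => k _ do rewrite scalerDr scalerBr.
rewrite big_split sumrB /=; case: (unliftP ord0 i) => [j|] ->.
  by rewrite -a'E wE a'E addrC subrK.
have aeE (z : 'I_n -> V) :
    \sum_k a ord0 k *: \sum_j e k j *: z j = \sum_j a ord0 j *: z j.
  by rewrite sumZ; apply: eq_bigr => j _; rewrite ae.
by rewrite !aeE subrr addr0.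
Qed.

Lemma rd_closed_pure : pure_submod_closed N.
Proof.
split=> // m n a c cN [x xE].
have [i|y yN yE] := @rd_closed_system m n (fun i j => a i j) x.
  by rewrite xE.
by exists y => // i; rewrite yE xE.
Qed.

End Purity.

Section PureSpan.
Variable R : idomainType.
Hypothesis R_dedekind : dedekind_domain R.

(** The kernel of a map to a torsion-free module is closed under division by nonzero scalars, hence
    pure. *)
Lemma pure_span_sub (V W : lmodType R) (S : {pred V}) (f : {linear V -> W}) :
  torsion_free W -> (forall v, v \in S -> f v = 0) ->
  forall v, v \in pure_span S -> f v = 0.
Proof.
move=> Wtf fS v vS; pose N : {pred V} := fun v => f v == 0.
apply/eqP; rewrite -[_ == _]/(v \in N); move/asboolP: vS; apply; last first.
  by move=> u /fS/eqP.
apply: (rd_closed_pure R_dedekind) => [|r u r0].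
  split; first by rewrite -topredE /= /N linear0.
  move=> a u w; rewrite -!topredE /= /N => /eqP fu /eqP fw.
  by rewrite linearP fu fw scaler0 addr0.
by rewrite -!topredE /= /N linearZ => /eqP/(Wtf _ _ r0) ->.
Qed.

Lemma mem_pure_span (V : lmodType R) (S : {pred V}) (r : R) v :
  torsion_free V -> r != 0 ->
  (forall N, submod_closed N -> {subset S <= N} -> r *: v \in N) ->
  v \in pure_span S.
Proof.
move=> Vtf r0 rvN; apply/asboolP => N [Nsub Npure] SN.
have [||x xN xE] := Npure 1%N 1%N (const_mx r) (fun=> r *: v).
- by move=> _; apply: rvN.
- by exists (fun=> v) => i; rewrite big_ord1 mxE.
- suff <- : x ord0 = v by [].
  have := xE ord0; rewrite big_ord1 mxE => /eqP.
  by rewrite -subr_eq0 -scalerBr => /eqP/(Vtf _ _ r0)/eqP; rewrite subr_eq0 => /eqP.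
Qed.

End PureSpan.

(** * Direct sums *)

Section DirectSums.
Variable R : comNzRingType.
Implicit Types (M N Z : nat -> lmodType R) (P : lmodType R).

Lemma dsum_bounded M (x : dsum M) :
  exists n, forall i, (n <= i)%N -> x i = 0.
Proof.
have /finite_seqP[s sE] := dsumP x.
exists (\max_(i <- s) i.+1) => i le_i; apply/eqP; apply: contrapT => /negP xi.
have : [set i | x i != 0]%classic i by [].
rewrite sE /= => i_s; have := @leq_bigmax_seq _ s xpredT (fun i => i.+1) i i_s isT.
by move=> /leq_trans/(_ le_i); rewrite ltnn.
Qed.

Definition dsum_bound M (x : dsum M) : nat := sval (cid (dsum_bounded x)).

Lemma dsum_boundP M (x : dsum M) i : (dsum_bound x <= i)%N -> x i = 0.
Proof. exact: (svalP (cid (dsum_bounded x))). Qed.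

Lemma dsum_injE M i (x : M i) : dsum_inj x i = x.
Proof. by rewrite /dsum_inj /= dfwith_in. Qed.

Lemma dsum_inj_out M i j (x : M i) : j != i -> dsum_inj x j = 0.
Proof. by move=> ji; rewrite /dsum_inj /= dfwith_out // eq_sym. Qed.

Lemma dsumDE M (x y : dsum M) i : (x + y) i = x i + y i. Proof. by []. Qed.
Lemma dsumZE M a (x : dsum M) i : (a *: x) i = a *: x i. Proof. by []. Qed.

(* Unlike mk_linear, the application of opaque_linear does not reduce. *)
Definition opaque_linear (U V : lmodType R) (f : U -> V) (fL : linear f) :
  {linear U -> V} := sval (cid (linear_exists fL)).

Lemma opaque_linearE (U V : lmodType R) (f : U -> V) (fL : linear f) :
  opaque_linear fL =1 f.
Proof. exact: (svalP (cid (linear_exists fL))). Qed.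

Fact dsum_proj_linear M i : linear (fun x : dsum M => x i).
Proof. by []. Qed.
Definition dsum_proj M i : {linear dsum M -> M i} :=
  opaque_linear (@dsum_proj_linear M i).

Lemma dsum_projE M i (x : dsum M) : dsum_proj M i x = x i.
Proof. exact: opaque_linearE. Qed.

Lemma dsum_sumE M I (r : seq I) (Q : pred I) (F : I -> dsum M) i :
  (\sum_(k <- r | Q k) F k) i = \sum_(k <- r | Q k) F k i.
Proof.
by rewrite -dsum_projE linear_sum; apply: eq_bigr => k _; rewrite dsum_projE.
Qed.

Fact dsum_inj_linear M i : linear (@dsum_inj R M i).
Proof.
move=> a x y; apply: dsum_ext => j; rewrite dsumDE dsumZE.
have [->|ji] := eqVneq j i; first by rewrite !dsum_injE.
by rewrite !dsum_inj_out // scaler0 addr0.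
Qed.
Definition dsum_in M i : {linear M i -> dsum M} :=
  opaque_linear (@dsum_inj_linear M i).

Lemma dsum_in_inj M i (x : M i) : dsum_in M i x = dsum_inj x.
Proof. exact: opaque_linearE. Qed.

Lemma dsum_inE M i (x : M i) : dsum_in M i x i = x.
Proof. by rewrite opaque_linearE dsum_injE. Qed.

Lemma dsum_in_out M i j (x : M i) : j != i -> dsum_in M i x j = 0.
Proof. by move=> ji; rewrite opaque_linearE dsum_inj_out. Qed.

Lemma dsum_decomp M (x : dsum M) n : (forall i, (n <= i)%N -> x i = 0) ->
  x = \sum_(i < n) dsum_in M i (x i).
Proof.
move=> x0; apply: dsum_ext => j; rewrite dsum_sumE.
have [jn|nj] := ltnP j n.
  rewrite (bigD1 (Ordinal jn)) // -[X in _ = X + _]/(dsum_in M j (x j) j).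
  rewrite dsum_inE big1 ?addr0 // => i /andP[_ ij].
  by rewrite dsum_in_out //; apply: contraNneq ij => ji; apply/eqP/val_inj.
rewrite x0 // big1 // => i _; rewrite dsum_in_out //.
by rewrite neq_ltn (leq_trans (ltn_ord i) nj) orbT.
Qed.

Section Universal.
Variables (M : nat -> lmodType R) (P : lmodType R).
Variable g : forall i, {linear M i -> P}.

Let fold (x : dsum M) : P := \sum_(i < dsum_bound x) g i (x i).

Let foldE (x : dsum M) n : (forall i, (n <= i)%N -> x i = 0) ->
  fold x = \sum_(i < n) g i (x i).
Proof.
move=> x0; pose m := maxn n (dsum_bound x).
have widen k : (k <= m)%N -> (forall i, (k <= i)%N -> x i = 0) ->
    \sum_(i < k) g i (x i) = \sum_(i < m) g i (x i).
  move=> km xk; rewrite (big_ord_widen m (fun i => g i (x i)) km) big_mkcond.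
  apply: eq_bigr => i _; case: ltnP => // ki.
  by rewrite xk // linear0.
by rewrite /fold (widen n) ?leq_maxl // widen ?leq_maxr //; apply: dsum_boundP.
Qed.

Let fold_linear : linear fold.
Proof.
move=> a x y; pose m := maxn (dsum_bound x) (dsum_bound y).
have xm i : (m <= i)%N -> x i = 0.
  by rewrite geq_max => /andP[/dsum_boundP].
have ym i : (m <= i)%N -> y i = 0.
  by rewrite geq_max => /andP[_ /dsum_boundP].
rewrite (foldE xm) (foldE ym) (@foldE _ m) => [|i mi]; last first.
  by rewrite dsumDE dsumZE xm // ym // scaler0 addr0.
rewrite scaler_sumr -big_split; apply: eq_bigr => i _ /=.
by rewrite linearP.
Qed.

Definition dsum_rec : {linear dsum M -> P} := opaque_linear fold_linear.

Lemma dsum_recE (x : dsum M) n : (forall i, (n <= i)%N -> x i = 0) ->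
  dsum_rec x = \sum_(i < n) g i (x i).
Proof. by rewrite opaque_linearE; apply: foldE. Qed.

Lemma dsum_rec_in i (x : M i) : dsum_rec (dsum_in M i x) = g i x.
Proof.
rewrite (@dsum_recE _ i.+1) => [|j ij]; last first.
  by rewrite dsum_in_out // neq_ltn ij orbT.
rewrite big_ord_recr /= dsum_inE big1 ?add0r // => j _.
by rewrite dsum_in_out ?linear0 // neq_ltn ltn_ord.
Qed.

End Universal.

Section Map.
Variables (M N : nat -> lmodType R) (g : forall i, {linear M i -> N i}).

Fact dsum_map_support (x : dsum M) : finite_support (fun i => g i (x i)).
Proof.
apply: (sub_finite_set _ (dsumP x)) => i /=.
by apply: contraNneq => ->; rewrite linear0.
Qed.

Fact dsum_map_linear : linear (fun x => DSum (dsum_map_support x)).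
Proof. by move=> a x y; apply: dsum_ext => i /=; rewrite linearP. Qed.

Definition dsum_map : {linear dsum M -> dsum N} := opaque_linear dsum_map_linear.

Lemma dsum_mapE x i : dsum_map x i = g i (x i).
Proof. by rewrite opaque_linearE. Qed.

End Map.

Definition dsum_drop M m : {linear dsum M -> dsum M} :=
  dsum_map (fun i => (if (m <= i)%N then (idfun : {linear M i -> M i}) else
                        (\0 : {linear M i -> M i})) : {linear M i -> M i}).

Lemma dsum_dropE M m (x : dsum M) i :
  dsum_drop M m x i = if (m <= i)%N then x i else 0.
Proof. by rewrite dsum_mapE; case: leqP. Qed.

Lemma dsum_seq M (F : forall i, M i) n :
  exists x : dsum M, forall i, x i = if (i < n)%N then F i else 0.
Proof.
exists (\sum_(i < n) dsum_in M i (F i)) => j; rewrite dsum_sumE.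
case: ltnP => [jn|nj].
  rewrite (bigD1 (Ordinal jn)) // -[LHS]/(dsum_in M j (F j) j + _).
  rewrite dsum_inE big1 ?addr0 // => i /andP[_ ij].
  by rewrite dsum_in_out //; apply: contraNneq ij => ji; apply/eqP/val_inj.
rewrite big1 // => i _; rewrite dsum_in_out //.
by rewrite neq_ltn (leq_trans (ltn_ord i) nj) orbT.
Qed.

Lemma dsum_torsion_free M :
  (forall i, torsion_free (M i)) -> torsion_free (dsum M).
Proof.
move=> Mtf r x r0 rx0; apply: dsum_ext => i; apply: (Mtf i r) => //.
by rewrite -dsumZE rx0.
Qed.

Lemma dsum_countable M : (forall i, countable [set: M i]) ->
  countable [set: dsum M].
Proof.
move=> Mc.
have code_ex i : {f : M i -> nat | injective f}.
  apply: cid; have /countable_injP[f f_inj] := Mc i.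
  by exists f => x y; apply: f_inj; rewrite in_setT.
pose code i := sval (code_ex i).
apply: (@countable_inj (dsum M) (seq nat)
  (fun x => mkseq (fun i => code i (x i)) (dsum_bound x))).
  move=> x y exy; have sxy := congr1 size exy; rewrite !size_mkseq in sxy.
  apply: dsum_ext => i; have [ix|xi] := ltnP i (dsum_bound x); last first.
    by rewrite !dsum_boundP // -sxy.
  have := congr1 (nth 0%N ^~ i) exy; rewrite !nth_mkseq -?sxy //.
  exact: (svalP (code_ex i)).
exact: countableP.
Qed.

Lemma prod_countable T U : countable [set: T] -> countable [set: U] ->
  countable [set: T * U].
Proof.
move=> /countable_injP[f f_inj] /countable_injP[g g_inj].
apply: (@countable_inj _ (nat * nat)%type (fun u => (f u.1, g u.2))).
  by move=> [x y] [x' y'] [fx gy]; congr pair;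
    [apply: f_inj | apply: g_inj]; rewrite ?in_setT.
exact: countableP.
Qed.

Lemma prod_torsion_free (A B : lmodType R) :
  torsion_free A -> torsion_free B -> torsion_free (A * B)%type.
Proof.
by move=> Atf Btf r [a b] r0 [/(Atf _ _ r0)-> /(Btf _ _ r0)->].
Qed.

End DirectSums.

(** * Exact structures *)

Section FlatObjects.
Variable R : idomainType.
Hypothesis R_dedekind : dedekind_domain R.

Lemma Flat_torsion_free (M : Flat R) : torsion_free M.
Proof. exact: flat_torsion_free (@flat_flat R M). Qed.

Definition tf_Flat (M : lmodType R) (Mc : countable [set: M])
    (Mtf : torsion_free M) : Flat R :=
  MkFlat Mc (torsion_free_flat R_dedekind Mtf).

Lemma Flat_sub (V : Flat R) (P : {pred V}) : submod_closed P ->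
  exists (S : Flat R) (i : {linear S -> V}), injective i /\
    forall v, v \in P <-> exists s, i s = v.
Proof.
move=> PZ; have [S [i [i_inj iE]]] := submod_exists PZ.
have Sc := countable_inj i_inj (@flat_countable R V).
have Stf : torsion_free S.
  move=> r s r0 rs0; apply: i_inj; rewrite linear0.
  by apply: (Flat_torsion_free r0); rewrite -linearZ rs0 linear0.
by exists (tf_Flat Sc Stf), i.
Qed.

Lemma Flat_kernel (V W : Flat R) (f : {linear V -> W}) :
  exists (A : Flat R) (i : {linear A -> V}), injective i /\
    forall v, f v = 0 <-> exists a, i a = v.
Proof.
have fZ : submod_closed (fun v => `[< f v = 0 >]).
  apply: submod_closedP => [|a u v fu fv]; first exact: linear0.
  by rewrite linearP fu fv scaler0 addr0.
have [A [i [i_inj iE]]] := Flat_sub fZ; exists A, i; split=> // v.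
by rewrite -iE; split=> /asboolP.
Qed.

Lemma Flat_quotient (V : Flat R) (P : V -> Prop) :
  P 0 -> (forall a u v, P u -> P v -> P (a *: u + v)) ->
  (forall (r : R) v, r != 0 -> P (r *: v) -> P v) ->
  exists (Q : Flat R) (p : {linear V -> Q}), (forall q, exists v, p v = q) /\
    forall v, p v = 0 <-> P v.
Proof.
move=> P0 PL Prd; have [Q [p [p_surj pE]]] := quotient_exists (submod_closedP P0 PL).
have {}pE v : p v = 0 <-> P v by rewrite pE; split=> /asboolP.
have Qc := countable_surj p_surj (@flat_countable R V).
have Qtf : torsion_free Q.
  move=> r q r0; have [v <-] := p_surj q.
  by rewrite -linearZ => /pE/(Prd _ _ r0)/pE.
by exists (tf_Flat Qc Qtf), p.
Qed.

Definition prod_Flat (A B : Flat R) : Flat R :=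
  @tf_Flat (A * B)%type (prod_countable (@flat_countable R A) (@flat_countable R B))
    (prod_torsion_free (@Flat_torsion_free A) (@Flat_torsion_free B)).

Definition dsum_Flat (M : nat -> Flat R) : Flat R :=
  @tf_Flat (dsum M) (dsum_countable (fun i => @flat_countable R (M i)))
    (dsum_torsion_free (fun i => @Flat_torsion_free (M i))).

Lemma zero_Flat_exists : exists Z : Flat R, forall z : Z, z = 0.
Proof.
have zc : countable [set: 'rV[R]_0].
  apply/countable_injP; exists (fun=> 0%N) => x y _ _ _.
  by rewrite [x]thinmx0 [y]thinmx0.
have ztf : torsion_free 'rV[R]_0 by move=> r m _ _; rewrite [m]thinmx0.
by exists (tf_Flat zc ztf) => z; rewrite [z]thinmx0.
Qed.

Lemma Flat_pullback (X B Y : Flat R) (q : {linear X -> Y}) (p : {linear B -> Y}) :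
  exists (P : Flat R) (p1 : {linear P -> X}) (p2 : {linear P -> B}),
  [/\ forall w, q (p1 w) = p (p2 w),
      forall x b, q x = p b -> exists w, p1 w = x /\ p2 w = b
    & forall (T : Flat R) (u : {linear T -> X}) (v : {linear T -> B}),
      (forall t, q (u t) = p (v t)) ->
      exists2 g : {linear T -> P}, (forall t, p1 (g t) = u t /\ p2 (g t) = v t) &
        forall t w, p1 w = u t -> p2 w = v t -> w = g t].
Proof.
have PZ : submod_closed (fun w : prod_Flat X B => `[< q w.1 = p w.2 >]).
  apply: submod_closedP => [|a [x b] [x' b']]; first by rewrite !linear0.
  by rewrite /= !linearP => -> ->.
have [P [i [i_inj iE]]] := Flat_sub PZ.
have iP w : q (i w).1 = p (i w).2 by apply/asboolP/iE; exists w.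
have L1 : linear (fun w => (i w).1) by move=> a x y; rewrite linearP.
have L2 : linear (fun w => (i w).2) by move=> a x y; rewrite linearP.
exists P, (mk_linear L1), (mk_linear L2); split=> [//|x b qp|T u v uv].
  have [w wE] : exists w, i w = (x, b) by apply/iE/asboolP.
  by exists w; rewrite !mk_linearE wE.
have uvL : linear (fun t => (u t, v t) : prod_Flat X B).
  by move=> a t t'; rewrite !linearP.
have [t|g gE] := @lift_injective _ _ _ _ i (mk_linear uvL) i_inj.
  exact/iE/asboolP/uv.
exists g => [t|t w]; first by rewrite !mk_linearE gE.
rewrite !mk_linearE => w1 w2; apply: i_inj; rewrite gE mk_linearE -w1 -w2.
by case: (i w).
Qed.

End FlatObjects.

Section ProjectivelyGenerated.
Variable R : idomainType.
Hypothesis R_dedekind : dedekind_domain R.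
Variable I : Flat R -> Prop.
Local Notation E := (projectively_generated I).

Lemma short_exact_is_kernel (A B C : Flat R) (i : {linear A -> B})
    (p : {linear B -> C}) : short_exact i p -> is_kernel i p /\ is_cokernel i p.
Proof.
move=> [i_inj p_surj ip]; have pi0 a : p (i a) = 0 by apply/ip; exists a.
split; split=> // X f f0.
  have [x|g gE] := @lift_injective _ _ _ _ i f i_inj; first by apply/ip/f0.
  by exists g => // g' g'E x; apply: i_inj; rewrite gE -g'E.
have [b /ip[a <-] //|g gE] := factor_surjective p_surj (f := f).
exists g => // g' g'E c; have [b <-] := p_surj c.
by rewrite gE -g'E.
Qed.

Lemma admissible_epicP (B C : Flat R) (p : {linear B -> C}) :
  (forall c, exists b, p b = c) ->
  (forall X : Flat R, I X -> forall f : {linear X -> C},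
    exists g : {linear X -> B}, p \o g =1 f) ->
  admissible_epic E p.
Proof.
move=> p_surj lift; have [A [i [i_inj iE]]] := Flat_kernel R_dedekind p.
by exists A, i; split.
Qed.

(** The cokernel [W] of [j \o i] is an extension of [S] by [Q]. A map [f] to [W] is first lifted
    along [s]; the error lies in [Q], is lifted along [p], and the result corrects the first
    lift. *)
Lemma projectively_generated_comp_monic (A B C : Flat R)
    (i : {linear A -> B}) (j : {linear B -> C}) :
  admissible_monic E i -> admissible_monic E j ->
  admissible_monic E (j \o i : {linear A -> C}).
Proof.
move=> [Q [p [[i_inj p_surj ip] p_lift]]] [S [s [[j_inj s_surj js] s_lift]]].
have ji0 : exists a, (j \o i) a = 0 by exists 0; rewrite linear0.
have jiL (c : R) u v : (exists a, (j \o i) a = u) -> (exists a, (j \o i) a = v) ->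
    exists a, (j \o i) a = c *: u + v.
  by move=> [a <-] [a' <-]; exists (c *: a + a'); rewrite linearP.
have jird (r : R) v : r != 0 -> (exists a, (j \o i) a = r *: v) ->
    exists a, (j \o i) a = v.
  move=> r0 [a jia].
  have [b bE] : exists b, j b = v.
    apply/js; apply: (Flat_torsion_free r0); rewrite -linearZ -jia.
    by apply/js; exists (i a).
  have [a' a'E] : exists a', i a' = b.
    apply/ip; apply: (Flat_torsion_free r0); rewrite -linearZ; apply/ip.
    by exists a; apply: j_inj; rewrite linearZ /= bE.
  by exists a'; rewrite /= a'E.
have [W [w [w_surj wE]]] := Flat_quotient R_dedekind ji0 jiL jird.
exists W, w; split.
  by split=> // x y /j_inj/i_inj.
have [c /wE[a <-]|t tE] := factor_surjective w_surj (f := s).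
  by apply/js; exists (i a).
have [b /ip[a <-]|k kE] := factor_surjective p_surj (f := w \o j : {linear B -> W}).
  by apply/wE; exists a.
have k_inj : injective k.
  suff k0 x : k x = 0 -> x = 0.
    by move=> x y kxy; apply/subr0_eq/k0; rewrite linearB kxy subrr.
  have [b <-] := p_surj x; rewrite kE => /wE[a] /= /j_inj <-.
  by apply/ip; exists a.
move=> X IX f; have [g gE] := s_lift X IX (t \o f : {linear X -> S}).
have [x|h hE] := @lift_injective _ _ _ _ k
    (f \- (w \o g) : {linear X -> W}) k_inj.
  have [c cE] := w_surj (f x).
  have [b bE] : exists b, j b = c - g x.
    by apply/js; rewrite linearB -[s (g x)]/((s \o g) x) gE /= -cE tE subrr.
  exists (p b); rewrite kE /= bE linearB cE //.
have [h' h'E] := p_lift X IX h.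
exists (g \+ (j \o h') : {linear X -> C}) => x /=.
have := hE x; rewrite -h'E /= kE linearD /= => ->.
by rewrite addrC subrK.
Qed.

(** The pushout has the same cokernel [C] as [i], so a lift of a map X -> C to [B] composes to a
    lift to [P]. Torsion-freeness of [C] also makes the usual quotient of B x A' torsion-free. *)
Lemma projectively_generated_pushout (A B A' : Flat R)
    (i : {linear A -> B}) (f : {linear A -> A'}) : admissible_monic E i ->
  exists (P : Flat R) (i' : {linear A' -> P}) (f' : {linear B -> P}),
    is_pushout i f i' f' /\ admissible_monic E i'.
Proof.
move=> [C [p [[i_inj p_surj ip] p_lift]]].
pose V := prod_Flat R_dedekind B A'.
pose N (v : V) := exists a, v = (i a, - f a).
have N0 : N 0 by exists 0; rewrite !linear0 ?oppr0.
have NL (c : R) u v : N u -> N v -> N (c *: u + v).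
  move=> [a ->] [a' ->]; exists (c *: a + a').
  by rewrite !linearP ?opprD -?scalerN.
have Nrd (r : R) v : r != 0 -> N (r *: v) -> N v.
  case: v => b a' r0 [a [rb ra']].
  have [a0 a0E] : exists a0, i a0 = b.
    by apply/ip/(Flat_torsion_free r0); rewrite -linearZ /= rb; apply/ip; exists a.
  exists a0; rewrite a0E; congr pair; apply/eqP; rewrite -subr_eq0; apply/eqP.
  apply: (Flat_torsion_free r0); rewrite scalerBr ra' scalerN opprK.
  have -> : a = r *: a0 by apply: i_inj; rewrite linearZ a0E.
  by rewrite linearZ /= addNr.
have [P [w [w_surj wE]]] := Flat_quotient R_dedekind N0 NL Nrd.
have iL : linear (fun a' => w (0, a')).
  by move=> c x y; rewrite -linearP; congr (w _); congr pair; rewrite /= ?scaler0 ?addr0.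
have fL : linear (fun b => w (b, 0)).
  by move=> c x y; rewrite -linearP; congr (w _); congr pair; rewrite /= ?scaler0 ?addr0.
exists P, (mk_linear iL), (mk_linear fL); split.
  split=> [a|X u v uv].
    apply/subr0_eq; rewrite /= -linearB; apply/wE; exists a.
    by congr pair; rewrite /= ?subr0 ?sub0r.
  have gL : linear (fun z : V => u z.1 + v z.2).
    by move=> c z z' /=; rewrite !linearP scalerDr addrACA.
  have [z /wE[a ->]|g gE] := factor_surjective w_surj (f := mk_linear gL).
    by rewrite /= linearN -[v _]/((v \o f) a) -uv addrN.
  exists g => [|g' g'u g'v q].
    by split=> x; rewrite /= gE /= linear0 ?addr0 ?add0r.
  have [[b a'] <-] := w_surj q; rewrite gE /= -g'u -g'v /=.
  by rewrite -!linearD; congr (g' (w _)); congr pair; rewrite /= ?addr0 ?add0r.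
exists C.
have cL : linear (fun z : V => p z.1) by move=> c z z' /=; rewrite linearP.
have [z /wE[a ->]|g gE] := factor_surjective w_surj (f := mk_linear cL).
  by apply/ip; exists a.
exists g; split; last first.
  move=> X IX h; have [h' h'E] := p_lift X IX h.
  exists (mk_linear fL \o h' : {linear X -> P}) => x.
  by rewrite /= gE /= -[RHS]h'E.
split=> [x y|c|q].
- move=> /= /eqP; rewrite -subr_eq0 -linearB => /eqP/wE[a [ia fa]].
  apply/subr0_eq; rewrite fa (_ : a = 0) ?linear0 ?oppr0 //.
  by apply: i_inj; rewrite linear0 -ia subr0.
- by have [b <-] := p_surj c; exists (w (b, 0)); rewrite gE.
- have [[b a'] <-] := w_surj q; rewrite gE /=; split.
    move=> /ip[a <-]; exists (a' + f a).
    apply/subr0_eq; rewrite -linearB; apply/wE; exists (- a).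
    by congr pair; rewrite /= ?sub0r ?linearN // opprK addrAC subrr add0r.
  move=> [a0 /= /eqP]; rewrite eq_sym -subr_eq0 -linearB.
  by move=> /eqP/wE[a [/= ia _]]; apply/ip; exists a; rewrite -ia subr0.
Qed.

Theorem projectively_generated_exact : exact_structure E.
Proof.
split.
- by move=> A B C i p [/short_exact_is_kernel].
- move=> A B C A' B' C' i p i' p' a b c abij bbij cbij bi cp [[i_inj p_surj ip] p_lift].
  have inv (U V : Flat R) (u : {linear U -> V}) :
      bijective u -> forall v, exists x, u x = v.
    by move=> [u' _ u'K] v; exists (u' v).
  split; first split.
  + move=> x y; have [x0 <-] := inv _ _ _ abij x; have [y0 <-] := inv _ _ _ abij y.
    rewrite -[i' (a x0)]/((i' \o a) x0) -[i' (a y0)]/((i' \o a) y0) -!bi /=.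
    by move=> /(bij_inj bbij)/i_inj ->.
  + move=> c'; have [c0 <-] := inv _ _ _ cbij c'; have [b0 <-] := p_surj c0.
    by exists (b b0); apply/esym/cp.
  + move=> b'; have [b0 <-] := inv _ _ _ bbij b'.
    rewrite -[p' _]/((p' \o b) b0) -cp /=; split.
      move=> cpb; have /ip[a0 <-] : p b0 = 0.
        by apply: (bij_inj cbij); rewrite cpb linear0.
      by exists (a a0); apply/esym/bi.
    move=> [a' ]; have [a0 <-] := inv _ _ _ abij a'.
    rewrite -[i' (a a0)]/((i' \o a) a0) -bi /= => /(bij_inj bbij) <-.
    by have -> : p (i a0) = 0; [apply/ip; exists a0|rewrite linear0].
  + move=> X IX h.
    have [x|h' h'E] := @lift_injective _ _ _ _ c h (bij_inj cbij); first exact: inv.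
    have [g gE] := p_lift X IX h'.
    exists (b \o g : {linear X -> B'}) => x.
    by rewrite -h'E -gE; apply/esym/cp.
- move=> A; have [Z Z0] := zero_Flat_exists R_dedekind.
  exists Z, (\0 : {linear A -> Z}); split; first split.
  + by [].
  + by move=> z; exists 0; rewrite linear0 [RHS]Z0.
  + by move=> x; split=> // _; exists x.
  + by move=> X _ h; exists (\0 : {linear X -> A}) => x; rewrite [RHS]Z0.
- move=> A; apply: admissible_epicP => [c|X _ h]; first by exists c.
  by exists h.
- exact: projectively_generated_comp_monic.
- move=> A B C p q [K [k [[_ p_surj _] p_lift]]] [K' [k' [[_ q_surj _] q_lift]]].
  apply: admissible_epicP => [c|X IX h].
    have [b <-] := q_surj c; have [a <-] := p_surj b; by exists a.
  have [g gE] := q_lift X IX h; have [g' g'E] := p_lift X IX g.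
  by exists g' => x; rewrite /= -gE /= -g'E.
- exact: projectively_generated_pushout.
- move=> B C C' p f [K [k [[_ p_surj _] p_lift]]].
  have [P [p1 [p2 [pc pw pu]]]] := Flat_pullback R_dedekind f p.
  exists P, p1, p2; split.
    split=> [w|X u v uv]; first by rewrite /= pc.
    have [t|g gE gU] := pu X v u; first exact: esym (uv t).
    exists g; first by split=> t; have [] := gE t.
    by move=> g' g'u g'v t; apply: gU; [apply: g'v | apply: g'u].
  apply: admissible_epicP => [c|X IX h].
    have [b bE] := p_surj (f c); have [w [<- _]] := pw c b (esym bE).
    by exists w.
  have [g gE] := p_lift X IX (f \o h : {linear X -> C}).
  have [t|g' g'E _] := pu X h g; first exact: esym (gE t).
  by exists g' => x; have [] := g'E x.
Qed.

End ProjectivelyGenerated.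

(** * Plain tree length *)

Section Wedges.
Variable R : idomainType.
Hypothesis R_dedekind : dedekind_domain R.

Section WedgeProjection.
Variables (M1 : Flat R) (M : nat -> Flat R) (psi : forall i, {linear M1 -> M i}).

(** Maps to torsion-free modules do not see the passage from the span to the pure span, so among
    these targets the wedge sum has the universal property of an amalgamated sum. *)
Lemma wedge_proj : exists p : {linear (M1 * dsum M)%type -> wedge_sum psi},
  [/\ forall q, exists v, p v = q,
      forall v, p v = 0 <-> v \in pure_span (wedge_relations psi)
    & forall (B : lmodType R) (g0 : {linear M1 -> B})
        (g : forall i, {linear M i -> B}),
      torsion_free B -> (forall i y, g i (psi i y) = g0 y) ->
      exists h : {linear wedge_sum psi -> B},
        forall y x, h (p (y, x)) = g0 y + dsum_rec g x].
Proof.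
have [p [p_surj pE]] := pure_quot_proj (wedge_relations psi).
exists p; split=> // B g0 g Btf gpsi.
have GL : linear (fun v : M1 * dsum M => g0 v.1 + dsum_rec g v.2).
  by move=> a u v /=; rewrite !linearP scalerDr addrACA.
have [v /pE vS|h hE] := factor_surjective p_surj (f := mk_linear GL).
  apply: (pure_span_sub R_dedekind Btf _ vS) => _ /asboolP[i [y ->]].
  rewrite linearB !mk_linearE /= !linear0 addr0 add0r.
  by rewrite -dsum_in_inj dsum_rec_in gpsi subrr.
by exists h => y x; rewrite hE.
Qed.

(** A criterion for [C] to be the wedge sum itself, with zero complement. The kernel condition may
    be tested after multiplication by a nonzero scalar because the relations generate a pure
    submodule. *)
Lemma wedge_summand (C : Flat R) (phi0 : {linear M1 -> C})
    (phi : forall i, {linear M i -> C}) :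
  injective phi0 -> (forall i y, phi i (psi i y) = phi0 y) ->
  (forall c, exists y x, c = phi0 y + dsum_rec phi x) ->
  (forall y x, phi0 y + dsum_rec phi x = 0 ->
    exists2 r : R, r != 0 & forall i, exists y', r *: x i = psi i y') ->
  direct_summand C (wedge_sum psi).
Proof.
move=> phi0_inj phipsi phi_surj phi_ker.
have [p [p_surj pE pU]] := wedge_proj.
have [g gE] := pU C phi0 phi (@Flat_torsion_free R C) phipsi.
have Vtf : torsion_free (M1 * dsum M)%type.
  apply: prod_torsion_free; first exact: Flat_torsion_free.
  by apply: dsum_torsion_free => i; apply: Flat_torsion_free.
have g_inj : injective g.
  suff g0 q : g q = 0 -> q = 0.
    by move=> q q' gq; apply/subr0_eq/g0; rewrite linearB gq subrr.
  have [[y x] <-] := p_surj q; rewrite gE => yx0.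
  have [r r0 /choice[y' y'E]] := phi_ker y x yx0.
  apply/pE/(mem_pure_span Vtf r0) => N NZ SN.
  rewrite -[_ \in N]/(_ \in submod_pred NZ).
  have xE : r *: x = \sum_(i < dsum_bound x) dsum_in M i (psi i (y' i)).
    rewrite {1}(dsum_decomp (@dsum_boundP _ _ x)) scaler_sumr.
    by apply: eq_bigr => i _; rewrite -linearZ -y'E.
  have yE : r *: y = - \sum_(i < dsum_bound x) y' i.
    apply/eqP; rewrite -addr_eq0; apply/eqP/phi0_inj.
    rewrite linear0 linearD linearZ linear_sum /=.
    transitivity (r *: (phi0 y + dsum_rec phi x)); last by rewrite yx0 scaler0.
    rewrite scalerDr; congr (_ + _).
    rewrite -linearZ xE linear_sum; apply: eq_bigr => i _.
    by rewrite dsum_rec_in phipsi.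
  have -> : r *: (y, x) = - \sum_(i < dsum_bound x)
      ((y' i, 0) - (0, dsum_inj (psi i (y' i)))).
    apply/eqP; rewrite -[_ == _]/((r *: y == _) && (r *: x == _)).
    have sumE (I : finType) (F : I -> (M1 * dsum M)%type) :
        \sum_i F i = (\sum_i (F i).1, \sum_i (F i).2).
      by elim/big_rec3: _ => // i u v w _ ->.
    rewrite sumE /= yE xE; apply/andP; split; apply/eqP.
      by congr (- _); apply: eq_bigr => i _; rewrite subr0.
    rewrite -sumrN; apply: eq_bigr => i _.
    by rewrite sub0r opprK dsum_in_inj.
  rewrite rpredN rpred_sum // => i _; apply: SN; apply/asboolP.
  by exists i, (y' i).
have [c|g' g'E] := @lift_injective _ _ _ _ g (idfun : {linear C -> C}) g_inj.
  by have [y [x ->]] := phi_surj c; exists (p (y, x)).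
have fL : linear (fun u : C * 'rV[R]_0 => g' u.1).
  by move=> a u v /=; rewrite linearP.
exists 'rV[R]_0, (mk_linear fL); exists (fun q => (g q, 0)).
  by move=> [c e]; rewrite mk_linearE /= g'E [e]thinmx0.
by move=> q; apply: g_inj; rewrite mk_linearE /= g'E.
Qed.

End WedgeProjection.

End Wedges.

(** * Countable ordinals and fundamental sequences *)

Section Omega1.
Variables (d : Order.disp_t) (W : orderType d) (W_omega1 : is_omega1 W).

Lemma omega1_min (P : W -> Prop) : (exists a, P a) ->
  exists a, P a /\ forall b, P b -> (a <= b)%O.
Proof.
case: W_omega1 => W_wo _ _ [a0 Pa0].
have [|a [[Pa a_min] _]] := W_wo (fun a => `[< P a >]).
  by exists a0; apply/asboolP.
by exists a; split; [apply/asboolP | move=> b Pb; apply: a_min; apply/asboolP].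
Qed.

Lemma omega1_ind (P : W -> Prop) :
  (forall a, (forall b, (b < a)%O -> P b) -> P a) -> forall a, P a.
Proof.
move=> step a; apply: contrapT => nPa.
have [|b [nPb b_min]] := @omega1_min (fun b => ~ P b); first by exists a.
apply: nPb; apply: step => c cb; apply: contrapT => /b_min.
by rewrite leNgt cb.
Qed.

Lemma omega1_succ (a : W) : exists a' : W, is_succ_of a' a.
Proof.
case: (W_omega1) => _ W_cnt W_unc.
have [|a' [aa' a'_min]] := @omega1_min (fun b => (a < b)%O); last by exists a'.
apply: contrapT => a_max; apply: W_unc.
have /countable_injP[g g_inj] := W_cnt a.
have le_a b : (b <= a)%O by rewrite leNgt; apply/negP => ab; apply: a_max; exists b.
apply/countable_injP; exists (fun b => if b == a then 0%N else (g b).+1).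
move=> x y _ _; have [->|xa] := eqVneq x a; have [->|ya] := eqVneq y a => //.
by case=> gxy; apply: g_inj => //; rewrite inE /= lt_neqAle ?xa ?ya le_a.
Qed.

Lemma not_limit (a : W) : ~ is_limit a <-> is_zero a \/ is_succ a.
Proof.
split=> [|[a0|aS] [] //].
by move=> /not_andP[/contrapT|/contrapT]; [left | right].
Qed.

Lemma zero_not_succ (a b : W) : is_zero a -> ~ is_succ_of a b.
Proof. by move=> /(_ b) ab [ba _]; move: ba; rewrite ltNge ab. Qed.

Lemma succ_of_inj (a b c : W) : is_succ_of a b -> is_succ_of a c -> b = c.
Proof.
move=> [ba aP] [ca aP']; have [bc|cb|//] := ltgtP b c.
  by have := aP _ bc; rewrite leNgt ca.
by have := aP' _ cb; rewrite leNgt ba.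
Qed.

Variables (f : W -> nat -> W) (f_fund : fundamental_sequences f).

Lemma fund_not_limit a : ~ is_limit a -> forall n, f a n = a.
Proof. exact: (f_fund.2 a). Qed.

Lemma fund_succ a n : ~ is_zero a -> is_succ (f a n).
Proof.
move=> a0; have [/(f_fund.1)[_ + _ _]|al] := pselect (is_limit a); first exact.
by rewrite fund_not_limit //; have /not_limit[] := al.
Qed.

Lemma fund_nonlimit a n : ~ is_limit (f a n).
Proof.
have [a0|/fund_succ aS] := pselect (is_zero a).
  by rewrite fund_not_limit; apply/not_limit; left.
by apply/not_limit; right.
Qed.

Lemma fund_le a n : (f a n <= a)%O.
Proof.
have [/(f_fund.1)[_ _ + _]|al] := pselect (is_limit a); first by move=> /(_ n)/ltW.
by rewrite fund_not_limit.
Qed.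

Lemma fund_cofinal a b : (b < a)%O -> exists n, (b <= f a n)%O.
Proof.
move=> ba; have [/(f_fund.1)[_ _ _ +]|al] := pselect (is_limit a); first exact.
by exists 0%N; rewrite fund_not_limit // ltW.
Qed.

Lemma fund_dominated b c j : (b <= c)%O -> exists n, (f b j <= f c n)%O.
Proof.
rewrite le_eqVlt => /orP[/eqP ->|/fund_cofinal[n bn]]; first by exists j.
by exists n; apply: le_trans bn; apply: fund_le.
Qed.

Lemma fund_homo a m n : (m <= n)%N -> (f a m <= f a n)%O.
Proof.
rewrite leq_eqVlt => /orP[/eqP -> //|mn].
have [/(f_fund.1)[+ _ _ _]|al] := pselect (is_limit a); first by move=> /(_ _ _ mn)/ltW.
by rewrite !fund_not_limit.
Qed.

End Omega1.

Section PlainTreeLength.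
Variable R : idomainType.
Hypothesis R_dedekind : dedekind_domain R.
Variables (d : Order.disp_t) (W : orderType d) (W_omega1 : is_omega1 W).
Variables (f : W -> nat -> W) (f_fund : fundamental_sequences f).
Local Notation ptl := (@plain_tree_length_le R d W f).

Lemma zero_finitely_generated (Z : lmodType R) :
  (forall z : Z, z = 0) -> finitely_generated Z.
Proof.
move=> Z0; exists 0%N, (fun=> 0) => z.
by exists (fun=> 0); rewrite big_ord0 [LHS]Z0.
Qed.

(* C is the wedge sum, over the zero module, of C itself and of zero modules. *)
Lemma ptl_mono a b (C : Flat R) :
  ptl a C -> (a <= b)%O -> ~ is_limit b -> ptl b C.
Proof.
move: b a C; apply: (omega1_ind W_omega1) => b IHb a C aC ab bl.
move: ab; rewrite le_eqVlt => /orP[/eqP <- //|ab].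
have bS : is_succ b.
  by have /not_limit[/(_ a)|//] := bl; rewrite leNgt ab.
have [c bc] := bS; have [cb c_succ] := bc.
have ac : (a <= c)%O by rewrite leNgt; apply/negP => /c_succ; rewrite leNgt ab.
have al : ~ is_limit a.
  case: aC => [? ? a0 _|? ? ? ? ? ? aS *]; apply/not_limit; first by left.
  by right; eexists; exact: aS.
have [i0 ai0] : exists i0, (a <= f c i0)%O.
  move: ac; rewrite le_eqVlt => /orP[/eqP ac|/(fund_cofinal f_fund)//].
  by exists 0%N; rewrite (fund_not_limit f_fund) -?ac.
have fcb i : (f c i < b)%O by apply: le_lt_trans cb; apply: fund_le.
have [Z Z0] := zero_Flat_exists R_dedekind.
have Zptl i : ptl (f c i) Z.
  have [z [_ z_min]] := omega1_min W_omega1 (ex_intro xpredT b isT).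
  have z0 : is_zero z by move=> x; apply: z_min.
  apply: (IHb _ (fcb i) z) => //; last exact: fund_nonlimit.
  by apply: PlainTreeLength0 => //; apply: zero_finitely_generated.
(* Each module is packed with its map to [C], so that a single case analysis on [i == i0] settles
   both without transport along an equality. *)
pose pack i : {M : Flat R & {linear M -> C}} :=
  if i == i0 then existT _ C (idfun : {linear C -> C})
  else existT _ Z (\0 : {linear Z -> C}).
pose M i := tag (pack i).
pose phi i : {linear M i -> C} := tagged (pack i).
pose psi i := (\0 : {linear Z -> M i}).
have phi_i0 c0 : exists x : M i0, phi i0 x = c0.
  by rewrite /phi /M /pack eqxx; exists c0.
have phi_inj i (x : M i) : phi i x = 0 -> x = 0.
  by move: x; rewrite /phi /M /pack; case: eqP => //= _ x _; apply: Z0.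
have phi_out i (x : M i) : i != i0 -> x = 0.
  by move: x; rewrite /M /pack; case: eqP => //= _ x _; apply: Z0.
apply: (@PlainTreeLengthS _ _ _ _ b c C Z M psi) => //.
- exact: zero_finitely_generated.
- move=> i; rewrite /M /pack; case: eqP => [->|_] //=.
  by apply: (IHb _ (fcb i0) a) => //; apply: fund_nonlimit.
- by move=> i x y _; rewrite (Z0 x) (Z0 y).
apply: (@wedge_summand _ R_dedekind Z M psi C (\0 : {linear Z -> C}) phi).
- by move=> x y _; rewrite (Z0 x) (Z0 y).
- by move=> i y; rewrite linear0.
- move=> c0; have [x <-] := phi_i0 c0; exists 0, (dsum_in M i0 x).
  by rewrite dsum_rec_in add0r.
- move=> y x; rewrite add0r => x0; exists 1; first exact: oner_neq0.
  move=> i; exists 0; rewrite linear0 scale1r.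
  have [->|/phi_out//] := eqVneq i i0; apply: phi_inj; rewrite -[RHS]x0.
  rewrite -dsum_rec_in; congr (dsum_rec _ _); apply: dsum_ext => j.
  have [->|ji] := eqVneq j i0; first by rewrite dsum_inE.
  by rewrite dsum_in_out // [RHS]phi_out.
Qed.

Lemma plain_exact_mono a b :
  (a <= b)%O -> sub_class (plain_exact R f b) (plain_exact R f a).
Proof.
move=> ab A B C i p [ip lift]; split=> // X [n aX].
have [m nm] := fund_dominated f_fund n ab.
by apply: lift; exists m; apply: ptl_mono aX nm _; apply: fund_nonlimit.
Qed.

End PlainTreeLength.

(** * Covers *)

Section Covers.
Variable R : idomainType.
Hypothesis R_dedekind : dedekind_domain R.
Variables (d : Order.disp_t) (W : orderType d) (W_omega1 : is_omega1 W).
Variables (f : W -> nat -> W) (f_fund : fundamental_sequences f).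
Local Notation ptl := (@plain_tree_length_le R d W f).
Local Notation dsumF := (dsum_Flat R_dedekind).

Record cover (Z : Flat R) := Cover {
  cover_mod : Flat R;
  cover_map : {linear cover_mod -> Z};
  cover_surj : forall z, exists b, cover_map b = z
}.

(* Lifting relatively to finitely many elements of the kernel is what makes the
   property pass to direct sums and to wedge sums. *)
Definition lifts Z (c : cover Z) (T : Flat R) : Prop :=
  forall (h : {linear T -> Z}) (ts : seq T), (forall t, t \in ts -> h t = 0) ->
  exists2 g : {linear T -> cover_mod c}, (forall x, cover_map c (g x) = h x) &
    forall t, t \in ts -> g t = 0.

Definition lifts_ptl Z (c : cover Z) (a : W) : Prop :=
  forall T, ptl a T -> lifts c T.

(** [factors c id] says that [c] splits. General [h] are needed because a splitting will be
    assembled from maps that lift one by one and add up to the identity. *)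
Definition factors Z (c : cover Z) (h : Z -> Z) : Prop :=
  exists g : {linear Z -> cover_mod c}, forall z, cover_map c (g z) = h z.

Definition id_cover (Z : Flat R) : cover Z :=
  @Cover Z Z (idfun : {linear Z -> Z}) (fun z => ex_intro _ z erefl).

Lemma id_cover_lifts Z T : lifts (id_cover Z) T.
Proof. by move=> h ts hts; exists h. Qed.

Lemma factors_sum Z (c : cover Z) n (h : 'I_n -> Z -> Z) :
  (forall k, factors c (h k)) -> factors c (fun z => \sum_k h k z).
Proof.
move=> /choice[g gE].
have sL : linear (fun z => \sum_k g k z).
  move=> a x y; rewrite scaler_sumr -big_split; apply: eq_bigr => k _ /=.
  by rewrite linearP.
exists (mk_linear sL) => z; rewrite mk_linearE linear_sum.
by apply: eq_bigr => k _; rewrite gE.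
Qed.

Section DsumCover.
Variables (Z : nat -> Flat R).

Fact dsum_cover_surj (c : forall i, cover (Z i)) (z : dsumF Z) :
  exists b : dsumF (fun i => cover_mod (c i)),
    dsum_map (fun i => cover_map (c i)) b = z.
Proof.
have b_ex i : {b | cover_map (c i) b = z i} by apply/cid/cover_surj.
have [b bE] := dsum_seq (fun i => sval (b_ex i)) (dsum_bound z).
exists b; apply: dsum_ext => i; rewrite dsum_mapE bE; case: ltnP => [_|iz].
  exact: (svalP (b_ex i)).
by rewrite linear0 dsum_boundP.
Qed.

Definition dsum_cover (c : forall i, cover (Z i)) : cover (dsumF Z) :=
  @Cover (dsumF Z) (dsumF (fun i => cover_mod (c i)))
    (dsum_map (fun i => cover_map (c i))) (dsum_cover_surj c).

Lemma dsum_cover_mapE (c : forall i, cover (Z i))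
    (b : cover_mod (dsum_cover c)) i :
  (cover_map (dsum_cover c) b : dsum Z) i = cover_map (c i) ((b : dsum _) i).
Proof. exact: dsum_mapE. Qed.

Lemma finite_lift (c : forall i, cover (Z i)) (T : Flat R) m
    (h : {linear T -> dsumF Z}) (ts : seq T) :
  (forall i, (i < m)%N -> lifts (c i) T) ->
  (forall x i, (m <= i)%N -> (h x : dsum Z) i = 0) ->
  (forall t, t \in ts -> h t = 0) ->
  exists2 g : {linear T -> cover_mod (dsum_cover c)},
    (forall x, cover_map (dsum_cover c) (g x) = h x) &
    forall t, t \in ts -> g t = 0.
Proof.
move=> c_lifts hm hts.
have g_ex i : exists g : {linear T -> cover_mod (c i)}, (i < m)%N ->
    (forall x, cover_map (c i) (g x) = (h x : dsum Z) i) /\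
    forall t, t \in ts -> g t = 0.
  have [im|_] := ltnP i m; last by exists (\0 : {linear T -> cover_mod (c i)}).
  have [|g gE gts] := c_lifts i im (dsum_proj Z i \o h : {linear T -> Z i}) ts.
    by move=> t /hts /= ->; rewrite linear0.
  by exists g; split=> // x; rewrite gE /= dsum_projE.
pose g i := sval (cid (g_ex i)).
have gP i : (i < m)%N -> _ := svalP (cid (g_ex i)).
have GL : linear (fun x : T => \sum_(i < m) dsum_in (fun i => cover_mod (c i)) i (g i x)
    : cover_mod (dsum_cover c)).
  move=> a x y; rewrite scaler_sumr -big_split; apply: eq_bigr => i _ /=.
  by rewrite !linearP.
exists (mk_linear GL) => [x|t tts]; rewrite mk_linearE; last first.
  by rewrite big1 // => i _; have [_ ->] := gP i (ltn_ord i); rewrite ?linear0.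
apply: dsum_ext => j; rewrite dsum_cover_mapE dsum_sumE.
have [jm|mj] := ltnP j m.
  rewrite (bigD1 (Ordinal jm)) // -[X in cover_map _ X]/(dsum_in _ j (g j x) j + _).
  rewrite dsum_inE big1 ?addr0; first by have [-> _] := gP j jm.
  move=> i /andP[_ ij].
  by rewrite dsum_in_out //; apply: contraNneq ij => ji; apply/eqP/val_inj.
rewrite hm // big1 ?linear0 // => i _; rewrite dsum_in_out //.
by rewrite neq_ltn (leq_trans (ltn_ord i) mj) orbT.
Qed.

End DsumCover.

(* The tails of a map to a direct sum kill any prescribed finite set, in
   particular generators of M1, so that they may be lifted on each component
   separately. *)
Lemma wedge_lift (Z : nat -> Flat R) (T M1 : Flat R) (M : nat -> Flat R)
    (psi : forall i, {linear M1 -> M i}) (phi : {linear T -> dsumF Z})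
    (ts : seq T) :
  finitely_generated M1 -> direct_summand T (wedge_sum psi) ->
  (forall t, t \in ts -> phi t = 0) ->
  exists m0, forall m, (m0 <= m)%N -> forall c : forall i, cover (Z i),
    (forall j, lifts (dsum_cover c) (M j)) ->
    exists2 g : {linear T -> cover_mod (dsum_cover c)},
      (forall x, cover_map (dsum_cover c) (g x) = dsum_drop Z m (phi x)) &
      forall t, t \in ts -> g t = 0.
Proof.
move=> [n [gen genE]] [D [F Fbij]] phits.
have [p [p_surj pE pU]] := wedge_proj R_dedekind psi.
have F_surj w : exists u, F u = w by case: Fbij => F' _ F'K; exists (F' w).
have [w|Finv FinvE] := @lift_injective _ _ _ _ F
  (idfun : {linear wedge_sum psi -> wedge_sum psi}) (bij_inj Fbij).
  exact: F_surj.
have FinvK u : Finv (F u) = u by apply: (bij_inj Fbij); rewrite FinvE.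
have rhoL : linear (fun w => (Finv w).1) by move=> a x y; rewrite linearP.
pose Phi : {linear wedge_sum psi -> dsumF Z} := phi \o mk_linear rhoL.
have PhiF t : Phi (F (t, 0)) = phi t by rewrite /Phi /= FinvK.
have in1L : linear (fun y : M1 => (y, 0 : dsum M)).
  by move=> a x y; congr pair; rewrite /= scaler0 addr0.
have in2L : linear (fun x : dsum M => (0 : M1, x)).
  by move=> a x y; congr pair; rewrite /= scaler0 addr0.
have p_psi i y : p (y, 0) = p (0, dsum_in M i (psi i y)).
  apply/subr0_eq; rewrite -linearB; apply/pE/asboolP => N _ SN; apply: SN.
  by apply/asboolP; exists i, y; rewrite dsum_in_inj.
have /choice[rep repE] t := p_surj (F (t, 0)).
(* Everything that a tail has to kill: the images of generators of [M1], and those of the components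
   of representatives of the [ts]. It is finite, so beyond some coordinate all of it vanishes. *)
pose L : seq (dsum Z) := [seq Phi (p (gen k, 0)) | k <- enum 'I_n] ++
  flatten [seq [seq Phi (p (0, dsum_in M j ((rep t).2 j)))
    | j <- iota 0 (dsum_bound (rep t).2)] | t <- ts].
exists (\max_(z <- L) dsum_bound z) => m m0m c M_lifts.
have dropL z : z \in L -> dsum_drop Z m z = 0.
  move=> zL; apply: dsum_ext => i; rewrite dsum_dropE; case: leqP => // mi.
  apply: dsum_boundP; apply: leq_trans (leq_trans m0m mi).
  exact: (@leq_bigmax_seq _ L xpredT (fun z => dsum_bound z) z zL isT).
have drop_gen k : dsum_drop Z m (Phi (p (gen k, 0))) = 0.
  apply: dropL; rewrite mem_cat; apply/orP; left.
  by apply/mapP; exists k; rewrite ?mem_enum.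
have drop_y y : dsum_drop Z m (Phi (p (y, 0))) = 0.
  have [e ->] := genE y; rewrite -[(_, _)]/(mk_linear in1L _).
  rewrite !linear_sum big1 // => k _; rewrite !linearZ /=.
  by rewrite drop_gen scaler0.
have drop_rep t j : t \in ts ->
    dsum_drop Z m (Phi (p (0, dsum_in M j ((rep t).2 j)))) = 0.
  move=> tts; have [jb|bj] := ltnP j (dsum_bound (rep t).2); last first.
    by rewrite dsum_boundP // linear0 -[(_, _)]/(mk_linear in2L 0) !linear0.
  apply: dropL; rewrite mem_cat; apply/orP; right; apply/flattenP.
  eexists; first by apply/mapP; exists t.
  by apply/mapP; exists j; rewrite // mem_iota.
pose h j : {linear M j -> dsumF Z} :=
  dsum_drop Z m \o (Phi \o (p \o (mk_linear in2L \o dsum_in M j))).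
(* The relative form of lifting makes each lift vanish on the image of [M1], so the lifts glue over
   the wedge sum with the zero map on [M1]. *)
have g_ex j : exists g : {linear M j -> cover_mod (dsum_cover c)},
    [/\ forall x, cover_map (dsum_cover c) (g x) = h j x,
        forall y, g (psi j y) = 0 & forall t, t \in ts -> g ((rep t).2 j) = 0].
  have [x|g gE gts] := M_lifts j (h j) ([seq psi j (gen k) | k <- enum 'I_n] ++
      [seq (rep t).2 j | t <- ts]).
    rewrite mem_cat => /orP[/mapP[k _ ->]|/mapP[t tts ->]].
      by rewrite /h /= -p_psi drop_gen.
    by rewrite /h /= drop_rep.
  exists g; split=> // [y|t tts]; last first.
    by apply: gts; rewrite mem_cat; apply/orP; right; apply/mapP; exists t.
  have [e ->] := genE y; rewrite !linear_sum big1 // => k _.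
  rewrite !linearZ /= gts ?scaler0 // mem_cat; apply/orP; left.
  by apply/mapP; exists k; rewrite ?mem_enum.
pose g j := sval (cid (g_ex j)).
have gP j := svalP (cid (g_ex j)).
have [|j y|G GE] := pU (cover_mod (dsum_cover c)) (\0 : {linear M1 -> _}) g.
- exact: Flat_torsion_free.
- by have [_ -> _] := gP j.
have GL : linear (fun t : T => G (F (t, 0))).
  move=> a x y; rewrite -linearP -linearP; congr (G (F _)).
  by congr pair; rewrite /= scaler0 addr0.
exists (mk_linear GL) => [t|t tts]; rewrite mk_linearE -repE; last first.
  rewrite [rep t]surjective_pairing GE add0r.
  rewrite (dsum_recE _ (@dsum_boundP _ _ _)) big1 // => j _.
  by have [_ _ ->] := gP j.
rewrite -PhiF -repE [rep t]surjective_pairing GE add0r.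
move: (rep t).1 (rep t).2 => y x.
have -> : (y, x) = (y, 0) + (0, x) by congr pair; rewrite /= ?addr0 ?add0r.
rewrite !linearD drop_y add0r -[(_, _)]/(mk_linear in2L x).
rewrite (dsum_decomp (@dsum_boundP _ _ x)) !linear_sum; apply: eq_bigr => j _.
by rewrite dsum_rec_in; have [-> _ _] := gP j.
Qed.

(** The map is split into a head with finitely many nonzero coordinates, lifted one coordinate at a
    time, and a tail killing the finite part, lifted on the pieces of the wedge sum by induction. *)
Lemma dsum_cover_lifts a (T : Flat R) : ptl a T ->
  forall (Z : nat -> Flat R) (c : forall i, cover (Z i)),
  (forall i, lifts_ptl (c i) a) -> lifts (dsum_cover c) T.
Proof.
have split_lift Z (c : forall i, cover (Z i)) (T' : Flat R) m
      (h : {linear T' -> dsumF Z}) (ts : seq T') :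
    (forall i, lifts (c i) T') -> (forall t, t \in ts -> h t = 0) ->
    (exists2 g : {linear T' -> cover_mod (dsum_cover c)},
      (forall x, cover_map (dsum_cover c) (g x) = dsum_drop Z m (h x)) &
      forall t, t \in ts -> g t = 0) ->
    exists2 g : {linear T' -> cover_mod (dsum_cover c)},
      (forall x, cover_map (dsum_cover c) (g x) = h x) &
      forall t, t \in ts -> g t = 0.
  move=> c_lifts hts [g gE gts].
  have [x i mi|t tts|g' g'E g'ts] := @finite_lift Z c T' m
    (h \- (dsum_drop Z m \o h) : {linear T' -> dsumF Z}) ts (fun i _ => c_lifts i).
  - rewrite /= -[LHS]/((h x : dsum Z) i - dsum_drop Z m (h x) i).
    by rewrite dsum_dropE mi subrr.
  - by rewrite /= hts // linear0 subr0.
  exists (g' \+ g : {linear T' -> cover_mod (dsum_cover c)}) => [x|t tts] /=.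
    by rewrite linearD gE g'E /= subrK.
  by rewrite g'ts // gts // addr0.
elim=> {a T} [a T a0 [n [gen genE]] Z c c_lifts h ts hts|
    a b T M1 M psi ab M1fg Mptl IHM psi_inj Tsum Z c c_lifts h ts hts].
  have Tptl : ptl a T by apply: PlainTreeLength0 => //; exists n, gen.
  pose m := \max_(k < n) dsum_bound (h (gen k) : dsum Z).
  apply: (split_lift _ _ _ m) => // [i|]; first exact: c_lifts.
  exists (\0 : {linear T -> cover_mod (dsum_cover c)}) => [x|//].
  have [e ->] := genE x; rewrite linear0 !linear_sum big1 // => k _.
  rewrite !linearZ /=; suff -> : dsum_drop Z m (h (gen k)) = 0 by rewrite scaler0.
  apply: dsum_ext => i; rewrite dsum_dropE; case: leqP => // mi.
  by apply: dsum_boundP; apply: leq_trans mi; apply: leq_bigmax.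
have Tptl : ptl a T by apply: (@PlainTreeLengthS _ _ _ _ a b T M1 M psi).
have [m0 m0P] := wedge_lift M1fg Tsum hts.
apply: (split_lift _ _ _ m0) => // [i|]; first exact: c_lifts.
apply: m0P => // j; apply: IHM => i X Xptl; apply: c_lifts.
apply: (ptl_mono R_dedekind W_omega1 f_fund Xptl).
  by apply: le_trans (fund_le f_fund _ _) _; case: ab => /ltW.
by apply/not_limit; right; exists b.
Qed.

(** The vanishing clause of [pb_lift] transports the relative part of [lifts]: the lift kills what
    both of its components kill. *)
Record pullback_cover (X Y : Flat R) (q : {linear X -> Y}) (c : cover Y) :=
  PullbackCover {
    pb_cover : cover X;
    pb_snd : {linear cover_mod pb_cover -> cover_mod c};
    pb_comm : forall w, q (cover_map pb_cover w) = cover_map c (pb_snd w);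
    pb_lift : forall (T : Flat R) (u : {linear T -> X}) (v : {linear T -> cover_mod c}),
      (forall t, q (u t) = cover_map c (v t)) ->
      exists2 g : {linear T -> cover_mod pb_cover},
        (forall t, cover_map pb_cover (g t) = u t) &
        forall t, u t = 0 -> v t = 0 -> g t = 0
  }.

Lemma pullback_cover_exists (X Y : Flat R) (q : {linear X -> Y}) (c : cover Y) :
  inhabited (pullback_cover q c).
Proof.
have [P [p1 [p2 [pc pw pu]]]] := Flat_pullback R_dedekind q (cover_map c).
have p1_surj x : exists w, p1 w = x.
  have [b bE] := cover_surj c (q x); have [w [wx _]] := pw x b (esym bE).
  by exists w.
split; apply: (@PullbackCover _ _ _ _ (Cover p1_surj) p2 pc) => T u v uv.
have [g gE gU] := pu T u v uv; exists g => [t|t ut vt]; first by have [] := gE t.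
by apply/esym/gU; rewrite linear0.
Qed.

(* The cover is the direct sum over n of the pullbacks along q of the direct sums
   of covers that are the identity on Z i for i < n and c i for i >= n: it splits
   over each finite part of the direct sum of the Z i. By rigidity, a section of
   cX only involves finitely many n, hence yields a section of c i for i large. *)
Lemma node_cover (X : Flat R) (Z : nat -> Flat R) (q : {linear X -> dsumF Z})
    (e : X) (c : forall i, cover (Z i)) :
  (forall z, exists x, q x = z) -> q e = 0 ->
  (forall x, q x = 0 -> exists r : R, x = r *: e) ->
  (forall h : {linear X -> X}, h e = 0 -> forall x, h x = 0) ->
  exists cX : cover X,
    ((forall i, ~ factors (c i) id) -> ~ factors cX id) /\
    forall a b T k, is_succ_of a b -> ptl a T ->
      (forall i j, (k <= i)%N -> lifts_ptl (c i) (f b j)) -> lifts cX T.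
Proof.
move=> q_surj qe q_ker rigid.
pose cn n i := if (i < n)%N then id_cover (Z i) else c i.
pose pb n := inhabited_witness (pullback_cover_exists q (dsum_cover (cn n))).
pose P n := cover_mod (pb_cover (pb n)).
pose s : {linear dsumF P -> X} := dsum_rec (fun n => cover_map (pb_cover (pb n))).
have s_surj x : exists b, s b = x.
  have [b <-] := cover_surj (pb_cover (pb 0%N)) x.
  by exists (dsum_in P 0%N b); rewrite /s dsum_rec_in.
exists (Cover s_surj); split=> [c_nsplit [t tE]|a b T k ab Tptl c_lifts]; last first.
  case: Tptl ab => [a' T' /zero_not_succ aS _ /aS//|
    a' b' T' M1 M psi ab' M1fg Mptl psi_inj Tsum ab] h ts hts.
  rewrite {b' ab'}(succ_of_inj ab' ab) in Mptl.
  have [t tts|m0 m0P] := wedge_lift (phi := q \o h : {linear T' -> dsumF Z}) (ts := ts)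
    M1fg Tsum; first by rewrite /= hts ?linear0.
  (* The lift goes into the single summand [m]: past [m0] the tail can be lifted, past [k] the
     covers [c i] are good enough, and below [m] the covers are identities. *)
  pose m := maxn m0 k.
  have [|j|g gE gts] := m0P m _ (cn m); first exact: leq_maxl.
    apply: (dsum_cover_lifts (Mptl j)) => i; rewrite /cn.
    case: ltnP => [_ X' _|mi]; first exact: id_cover_lifts.
    by apply: c_lifts; apply: leq_trans mi; apply: leq_maxr.
  have [i im|x i mi|t tts|g' g'E g'ts] := @finite_lift Z (cn m) T' m
    ((q \o h) \- (dsum_drop Z m \o (q \o h)) : {linear T' -> dsumF Z}) ts.
  - by rewrite /cn im; apply: id_cover_lifts.
  - rewrite /= -[LHS]/((q (h x) : dsum Z) i - dsum_drop Z m (q (h x)) i).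
    by rewrite dsum_dropE mi subrr.
  - by rewrite /= hts // !linear0 ?subr0 ?addr0.
  have [x|l lE l0] := @pb_lift _ _ _ _ (pb m) T' h
    (g' \+ g : {linear T' -> cover_mod (dsum_cover (cn m))}).
    by rewrite /= linearD gE g'E /= subrK.
  exists (dsum_in P m \o l : {linear T' -> dsumF P}) => [x|t tts] /=.
    by rewrite /s dsum_rec_in lE.
  by rewrite l0 ?linear0 ?hts //= g'ts // gts // addr0.
(* A section [t] decomposes into endomorphisms [hn n] of [X] adding up to the identity; those with n
   >= kk kill [e], hence vanish by rigidity. *)
pose kk := dsum_bound (t e : dsum P).
pose tn n : {linear X -> P n} := dsum_proj P n \o t.
pose hn n : {linear X -> X} := cover_map (pb_cover (pb n)) \o tn n.
have hn0 n x : (kk <= n)%N -> hn n x = 0.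
  move=> kn; apply: rigid; rewrite /hn /tn /= dsum_projE dsum_boundP // linear0 //.
have hnE x : x = \sum_(n < kk) hn n x.
  pose N := maxn kk (dsum_bound (t x : dsum P)).
  have tN n : (N <= n)%N -> (t x : dsum P) n = 0.
    by rewrite geq_max => /andP[_ /dsum_boundP].
  rewrite -[LHS]tE /= /s (dsum_recE _ tN).
  rewrite (big_ord_widen N (fun n => hn n x) (leq_maxl _ _)) [RHS]big_mkcond.
  apply: eq_bigr => n _ /=; rewrite /hn /tn /= dsum_projE.
  by case: ltnP => // /hn0 -/(_ x); rewrite /hn /tn /= dsum_projE.
pose vn n : {linear X -> cover_mod (dsum_cover (cn n))} := pb_snd (pb n) \o tn n.
(* The bound [kk] ensures that the i-th cover is [c i] in every summand n < kk; the other bound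
   ensures that the i-th coordinate of each [vn n] kills [e], so that it descends along [q]. *)
pose i := maxn kk (\max_(n < kk) dsum_bound (vn n e : dsum _)).
apply: (c_nsplit i).
have cni (n : 'I_kk) : cn n i = c i.
  by rewrite /cn ltnNge (leq_trans (ltnW (ltn_ord n))) // leq_maxl.
have th_ex (n : 'I_kk) : exists2 th : Z i -> Z i, factors (c i) th &
    forall x z, q x = dsum_in Z i z -> th z = (q (hn n x) : dsum Z) i.
  pose tau : {linear X -> cover_mod (cn n i)} :=
    dsum_proj (fun i => cover_mod (cn n i)) i \o vn n.
  have tau_e : tau e = 0.
    rewrite /tau /= dsum_projE dsum_boundP //.
    by apply: leq_trans (leq_maxr _ _); apply: (leq_bigmax n).
  have [x /q_ker[r ->]|tau' tau'E] := factor_surjective q_surj (f := tau).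
    by rewrite linearZ_LR tau_e scaler0.
  exists (fun z => cover_map (cn n i) (tau' (dsum_in Z i z))).
    rewrite -(cni n); exists (tau' \o dsum_in Z i : {linear Z i -> _}) => z //.
  move=> x z <-; rewrite tau'E /tau /= dsum_projE -dsum_cover_mapE.
  by rewrite -pb_comm.
have /choice[th thP] (n : 'I_kk) : exists th : Z i -> Z i, factors (c i) th /\
    forall x z, q x = dsum_in Z i z -> th z = (q (hn n x) : dsum Z) i.
  by have [th] := th_ex n; exists th.
have [g gE] := factors_sum (fun n => (thP n).1).
exists g => z; rewrite gE; have [x xz] := q_surj (dsum_in Z i z).
(* On a preimage [x] of z, the [th n] add up to the i-th coordinate of q applied to the sum of the
   [hn n x], that is, to [x]. *)
transitivity ((q x : dsum Z) i); last by rewrite xz dsum_inE.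
rewrite [in RHS](hnE x) linear_sum dsum_sumE; apply: eq_bigr => n _.
by have [_ thE] := thP n; apply: thE.
Qed.

End Covers.

(** * Denominators and the fraction field *)

Section Denominators.
Variable R : idomainType.

Lemma fracE (x : {fraction R}) :
  exists a b, b != 0 /\ tofrac b * x = tofrac a.
Proof.
elim/quotW: x => y; exists y.1, y.2; split; first exact: denom_ratioP.
rewrite /GRing.mul /= !piE; apply/eqmodP.
rewrite /= FracField.equivfE /FracField.mulf.
rewrite !numden_Ratio ?mulf_neq0 ?oner_neq0 ?denom_ratioP //.
by rewrite mulr1 mul1r mulrC.
Qed.

Lemma frac_countable : countable [set: R] -> countable [set: frac_mod R].
Proof.
move=> Rc; apply: (@countable_surj (R * R)%type (frac_mod R)
  (fun u => tofrac u.1 / tofrac u.2 : {fraction R})); last exact: prod_countable.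
move=> x; have [a [b [b0 xE]]] := fracE x; exists (a, b).
by rewrite /= -xE mulrAC divff ?mul1r // tofrac_eq0.
Qed.

Lemma frac_torsion_free : torsion_free (frac_mod R).
Proof.
move=> r x r0 /eqP; rewrite frac_modZ (@mulf_eq0 {fraction R}) tofrac_eq0.
by rewrite (negbTE r0) => /eqP.
Qed.

Lemma regular_torsion_free : torsion_free R^o.
Proof. by move=> r x r0 /eqP; rewrite (@mulf_eq0 R) (negbTE r0) => /eqP. Qed.

Definition divides (a b : R) : Prop := exists c, b = c * a.

Lemma divides_refl a : divides a a. Proof. by exists 1; rewrite mul1r. Qed.

Lemma divides_trans a b c : divides a b -> divides b c -> divides a c.
Proof. by move=> [x ->] [y ->]; exists (y * x); rewrite mulrA. Qed.

Lemma divides0 a : divides a 0. Proof. by exists 0; rewrite mul0r. Qed.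

Lemma dividesD a b c : divides a b -> divides a c -> divides a (b + c).
Proof. by move=> [x ->] [y ->]; exists (x + y); rewrite mulrDl. Qed.

Lemma dividesMl a b c : divides a c -> divides a (b * c).
Proof. by move=> [x ->]; exists (b * x); rewrite mulrA. Qed.

Lemma dividesN a b : divides a b -> divides a (- b).
Proof. by move=> [x ->]; exists (- x); rewrite mulNr. Qed.

Lemma dividesB a b c : divides a b -> divides a c -> divides a (b - c).
Proof. by move=> ab /dividesN; apply: dividesD. Qed.

Lemma divides_sum a I (r : seq I) (P : pred I) (F : I -> R) :
  (forall i, P i -> divides a (F i)) -> divides a (\sum_(i <- r | P i) F i).
Proof.
move=> aF; elim/big_rec: _ => [|i x Pi ax]; first exact: divides0.
by apply: dividesD; first exact: aF.
Qed.

(** A sequence cofinal for divisibility: the fraction field is the increasing union of the (dd n)^-1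
    R, and the ideals dd n R define the topology of the completion. *)
Definition denominators (dd : nat -> R) : Prop :=
  [/\ forall n, dd n != 0, forall m n, (m <= n)%N -> divides (dd m) (dd n)
    & forall r, r != 0 -> exists n, divides r (dd n)].

Lemma denominators_exist : countable [set: R] -> exists dd, denominators dd.
Proof.
move=> /countable_injP[code code_inj].
have /choice[g gE] n : exists r : R, r != 0 /\
    forall r', r' != 0 -> code r' = n -> r' = r.
  have [[r [r0 rn]]|nor] := pselect (exists r, r != 0 /\ code r = n).
    exists r; split=> // r' _ r'n; apply: code_inj; rewrite ?in_setT //.
    by rewrite r'n rn.
  by exists 1; split=> [|r r0 rn]; [apply: oner_neq0 | case: nor; exists r].
exists (fun n => \prod_(i < n) g i); split.
- by move=> n; apply/prodf_neq0 => i _; have [] := gE i.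
- move=> m n /subnK <-; elim: (n - m)%N => [|k IHk]; first exact: divides_refl.
  by rewrite addSn big_ord_recr /= mulrC; apply: dividesMl.
- move=> r r0; exists (code r).+1; have [_ rE] := gE (code r).
  by rewrite big_ord_recr /= -(rE r) //; exists (\prod_(i < code r) g i).
Qed.

Variables (dd : nat -> R) (ddP : denominators dd).

Let dd0 n : dd n != 0. Proof. by case: ddP. Qed.
Let dd_le m n : (m <= n)%N -> divides (dd m) (dd n).
Proof. by case: ddP => _ + _; apply. Qed.

(** If x and p are nonzero, x p divides some [dd n], which divides x; so every nonzero p would be a
    unit. *)
Lemma denominators_cap x : ~ GRing.field_axiom R ->
  (forall n, divides (dd n) x) -> x = 0.
Proof.
move=> nfield xdd; apply/eqP; apply: contrapT => /negP x0; apply: nfield => p p0.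
have [_ _ /(_ _ (mulf_neq0 x0 p0))[n [c cE]]] := ddP.
have [e eE] := xdd n; apply/unitrPr; exists (e * c); apply: (mulfI x0).
by rewrite mulr1 [RHS]eE cE; ring.
Qed.

Definition integral (x : {fraction R}) : Prop := exists r, x = tofrac r.

Lemma integralD x y : integral x -> integral y -> integral (x + y).
Proof. by move=> [r ->] [s ->]; exists (r + s); rewrite tofracD. Qed.

Lemma integralM r x : integral x -> integral (tofrac r * x).
Proof. by move=> [s ->]; exists (r * s); rewrite tofracM. Qed.

Lemma integral_sum I (r : seq I) (P : pred I) (F : I -> {fraction R}) :
  (forall i, P i -> integral (F i)) -> integral (\sum_(i <- r | P i) F i).
Proof.
move=> intF; elim/big_rec: _ => [|i x Pi intx]; first by exists 0; rewrite tofrac0.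
by apply: integralD; first exact: intF.
Qed.

Lemma integral_divides r s x : divides r s ->
  integral (tofrac r * x) -> integral (tofrac s * x).
Proof. by move=> [c ->] intx; rewrite tofracM -mulrA; apply: integralM. Qed.

Lemma common_denominator (s : seq {fraction R}) :
  exists n, forall m, (n <= m)%N -> forall x, x \in s -> integral (tofrac (dd m) * x).
Proof.
elim: s => [|x s [n nP]]; first by exists 0%N.
have [a [b [b0 xE]]] := fracE x; have [_ _ /(_ _ b0)[k bk]] := ddP.
exists (maxn k n) => m; rewrite geq_max => /andP[km nm] y.
rewrite inE => /orP[/eqP ->|]; last exact: nP.
by apply: (integral_divides (divides_trans bk (dd_le km))); exists a.
Qed.

Section Leaf.
Hypotheses (R_dedekind : dedekind_domain R) (R_countable : countable [set: R])
  (R_not_field : ~ GRing.field_axiom R).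
Variables (X : Flat R) (kappa : {linear X -> frac_mod R}).
Hypotheses (kappa_inj : injective kappa) (kappa_surj : forall k, exists x, kappa x = k).

Definition regular_Flat : Flat R :=
  @tf_Flat R R_dedekind R^o R_countable regular_torsion_free.

(* Free modules are reduced, while X is divisible. *)
Lemma leaf_cover : exists c : cover X, ~ factors c id /\
  forall T : Flat R, finitely_generated T -> lifts c T.
Proof.
(* The n-th basis vector of the free module is to be sent to 1 / dd n; every fraction lies in the
   image of a single summand. *)
have /choice[y yE] n := kappa_surj ((tofrac (dd n))^-1 : {fraction R}).
have yL n : linear (fun r : R^o => r *: y n).
  by move=> a r s; rewrite scalerDl scalerA.
pose B := dsum_Flat R_dedekind (fun=> regular_Flat).
pose s : {linear B -> X} := dsum_rec (fun n => mk_linear (yL n)).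
have sE n (r : R) : s (dsum_in (fun=> regular_Flat) n r) = r *: y n.
  by rewrite /s dsum_rec_in.
have s_surj x : exists b, s b = x.
  have [n /(_ n (leqnn n))/(_ _ (mem_head _ _))[r rE]] :=
    common_denominator [:: kappa x : {fraction R}].
  exists (dsum_in (fun=> regular_Flat) n r); rewrite sE; apply: kappa_inj.
  rewrite linearZ /= yE frac_modZ -rE mulrAC divff ?mul1r //.
  by rewrite tofrac_eq0.
exists (Cover s_surj); split.
- move=> [g gE]; have [x xE] := kappa_surj (1 : {fraction R}).
  have gx0 : g x = 0.
    apply: dsum_ext => i; apply: (denominators_cap R_not_field) => n.
    have -> : x = dd n *: y n.
      apply: kappa_inj; rewrite linearZ /= yE frac_modZ divff //.
      by rewrite tofrac_eq0.
    rewrite linearZ; exists ((g (y n) : dsum _) i : R).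
    by rewrite mulrC.
  have := gE x; rewrite gx0 linear0 => x0.
  have /eqP := xE; rewrite -[id x]x0 linear0 eq_sym.
  by rewrite (negbTE (@oner_neq0 {fraction R})).
- move=> T [n [gen genE]] h ts hts.
  (* The image of a finitely generated module lies in (dd N)^-1 R, onto which the N-th free summand
     maps isomorphically; the resulting lift vanishes wherever [h] does. *)
  have [N /(_ N (leqnn N)) NP] :=
    common_denominator [seq (kappa (h (gen k)) : {fraction R}) | k <- enum 'I_n].
  have /choice[r rE] x : integral (tofrac (dd N) * kappa (h x)).
    have [c ->] := genE x; rewrite !linear_sum mulr_sumr.
    apply: integral_sum => k _; rewrite !linearZ /= frac_modZ mulrCA.
    by apply/integralM/NP/mapP; exists k; rewrite ?mem_enum.
  have rE' a x z : r (a *: x + z) = a * r x + r z :> R.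
    apply/eqP; rewrite -tofrac_eq tofracD tofracM -!rE !linearP.
    by rewrite mulrDr frac_modZ mulrCA.
  have rL : linear (r : T -> R^o) by move=> a x z; apply: rE'.
  exists (dsum_in (fun=> regular_Flat) N \o mk_linear rL : {linear T -> B}).
    move=> x; rewrite /= sE; apply: kappa_inj; rewrite linearZ /= yE frac_modZ -rE.
    by rewrite mulrAC divff ?mul1r // tofrac_eq0.
  move=> t /hts ht; rewrite /=; have -> : r t = 0; last by rewrite linear0.
  by apply/eqP; rewrite -tofrac_eq0 -rE ht linear0 mulr0.
Qed.

End Leaf.
End Denominators.

(** * Upper bounds for the plain tree length *)

Section PlainTreeLengthBounds.
Variable R : idomainType.
Hypothesis R_dedekind : dedekind_domain R.
Variables (d : Order.disp_t) (W : orderType d) (W_omega1 : is_omega1 W).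
Variables (f : W -> nat -> W) (f_fund : fundamental_sequences f).
Local Notation ptl := (@plain_tree_length_le R d W f).
Local Notation dsumF := (dsum_Flat R_dedekind).

(** The length bounds are proved for all extensions [E] of a tree module by a finitely generated
    one, because the pieces of the wedge sum are preimages of the Z_i and the induction meets such
    extensions again. *)
Definition fg_kernel (E X : lmodType R) (p : {linear E -> X}) : Prop :=
  exists n (g : 'I_n -> E), (forall i, p (g i) = 0) /\
    forall x, p x = 0 -> exists c : 'I_n -> R, x = \sum_i c i *: g i.

Lemma fg_kernel_extend (E S X : lmodType R) (p : {linear E -> X})
    (i : {linear S -> E}) (e : E) :
  injective i -> fg_kernel p -> (forall x, p x = 0 -> exists s, i s = x) ->
  (exists s, i s = e) -> (forall s, exists r : R, p (i s) = r *: p e) ->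
  finitely_generated S.
Proof.
move=> i_inj [n [g [pg gE]]] ker_i [s0 is0] pi.
have /choice[h hE] k : exists s, i s = g k by apply: ker_i.
exists n.+1, (fun k => if unlift ord0 k is Some k' then h k' else s0) => s.
have [r rE] := pi s.
have [|c cE] := gE (i s - r *: e); first by rewrite linearB linearZ rE subrr.
exists (fun k => if unlift ord0 k is Some k' then c k' else r).
apply: i_inj; rewrite linear_sum big_ord_recl linearZ unlift_none is0.
under eq_bigr => k _ do rewrite linearZ liftK hE.
by rewrite -cE addrC subrK.
Qed.

Lemma fg_kernel_comp (E X Y : lmodType R) (p : {linear E -> X})
    (q : {linear X -> Y}) (e : X) :
  (forall x, exists y, p y = x) -> fg_kernel p -> q e = 0 ->
  (forall x, q x = 0 -> exists r : R, x = r *: e) ->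
  fg_kernel (q \o p : {linear E -> Y}).
Proof.
move=> p_surj [n [g [pg gE]]] qe q_ker; have [e' e'E] := p_surj e.
exists n.+1, (fun k => if unlift ord0 k is Some k' then g k' else e').
split=> [k|x /q_ker[r rE]] /=.
  by case: unliftP => [k'|] _; rewrite ?pg ?linear0 ?e'E.
have [|c cE] := gE (x - r *: e'); first by rewrite linearB linearZ rE e'E subrr.
exists (fun k => if unlift ord0 k is Some k' then c k' else r).
rewrite big_ord_recl unlift_none; under eq_bigr => k _ do rewrite liftK.
by rewrite -cE addrC subrK.
Qed.

Section LeafLength.
Variables (dd : nat -> R) (ddP : denominators dd).
Variables (E : Flat R) (q : {linear E -> frac_mod R}).

(* E is the wedge sum of the preimages of the (dd n)^-1 R over that of
   (dd 0)^-1 R. *)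
Lemma leaf_ptl (z a : W) : (forall k, exists x, q x = k) -> fg_kernel q ->
  is_zero z -> is_succ_of a z -> ptl a E.
Proof.
move=> q_surj q_fg z0 az; have [dd0 dd_le _] := ddP.
have SZ n : submod_closed (fun x => `[< integral (tofrac (dd n) * q x) >]).
  apply: submod_closedP => [|r x y intx inty].
    by exists 0; rewrite linear0 mulr0 tofrac0.
  rewrite linearP mulrDr frac_modZ mulrCA.
  by apply: integralD => //; apply: integralM.
pose S n := sval (cid (Flat_sub R_dedekind (SZ n))).
pose i n : {linear S n -> E} := sval (cid (svalP (cid (Flat_sub R_dedekind (SZ n))))).
have [i_inj iE] : (forall n, injective (i n)) /\
    forall n x, integral (tofrac (dd n) * q x) <-> exists s, i n s = x.
  split=> n; have [inj_in in_E] := svalP (cid (svalP (cid (Flat_sub R_dedekind (SZ n))))).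
    exact: inj_in.
  by move=> x; rewrite -in_E; split=> /asboolP.
have S_fg n : finitely_generated (S n).
  have [e eE] := q_surj ((tofrac (dd n))^-1 : {fraction R}).
  have ddn : tofrac (dd n) != 0 by rewrite tofrac_eq0.
  apply: (fg_kernel_extend (e := e) (i_inj n) q_fg).
  - by move=> x qx; apply/iE; exists 0; rewrite qx mulr0 tofrac0.
  - by apply/iE; exists 1; rewrite eE divff ?tofrac1.
  - move=> s; have /iE[r rE] : exists s', i n s' = i n s by exists s.
    by exists r; rewrite frac_modZ -rE eE mulrAC divff ?mul1r.
have psi_ex n : exists psi : {linear S 0%N -> S n}, forall y, i n (psi y) = i 0%N y.
  apply: (lift_injective (i_inj n)) => y; apply/iE.
  apply: (integral_divides (dd_le 0%N n (leq0n n))).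
  by apply/iE; exists y.
pose psi n := sval (cid (psi_ex n)).
have psiE n : forall y, i n (psi n y) = i 0%N y := svalP (cid (psi_ex n)).
apply: (@PlainTreeLengthS _ _ _ _ a z E (S 0%N) S psi) => //.
- move=> n; apply: PlainTreeLength0 => //.
  by rewrite (fund_not_limit f_fund) //; apply/not_limit; left.
- by move=> n x y /(congr1 (i n)); rewrite !psiE => /i_inj.
apply: (@wedge_summand _ R_dedekind _ _ psi E (i 0%N) i) => //.
- move=> c; have [n /(_ n (leqnn n))/(_ _ (mem_head _ _))/iE[s sE]] :=
    common_denominator ddP [:: q c : {fraction R}].
  by exists 0, (dsum_in S n s); rewrite linear0 add0r dsum_rec_in.
(* This scalar is a multiple of every [dd n] that occurs, so it moves each [x n] into the smallest
   preimage [S 0]. *)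
- move=> y x _; exists (dd (dsum_bound x)) => // n.
  have [nb|bn] := ltnP n (dsum_bound x); last first.
    by exists 0; rewrite dsum_boundP // scaler0 linear0.
  have /iE[y' y'E] : integral (tofrac (dd 0%N) * q (dd (dsum_bound x) *: i n (x n))).
    rewrite linearZ /= frac_modZ; apply/integralM.
    by apply: (integral_divides (dd_le _ _ (ltnW nb))); apply/iE; exists (x n).
  by exists y'; apply: (i_inj n); rewrite psiE y'E linearZ.
Qed.

End LeafLength.

(* E is the wedge sum of the preimages of the Z i over the kernel of p. *)
Lemma node_ptl (E : Flat R) (Z : nat -> Flat R) (p : {linear E -> dsumF Z})
    (a b : W) :
  (forall z, exists x, p x = z) -> fg_kernel p -> is_succ_of a b ->
  (forall i (E' : Flat R) (p' : {linear E' -> Z i}),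
    (forall z, exists x, p' x = z) -> fg_kernel p' -> ptl (f b i) E') ->
  ptl a E.
Proof.
move=> p_surj p_fg ab Zptl.
have [N [nu [nu_inj nuE]]] := Flat_kernel R_dedekind p.
have SZ n : submod_closed (fun x => `[< forall j, j != n -> (p x : dsum Z) j = 0 >]).
  apply: submod_closedP => [j jn|r x y px py j jn]; first by rewrite linear0.
  by rewrite linearP -[LHS]/(r *: (p x : dsum Z) j + (p y : dsum Z) j)
    px // py // scaler0 addr0.
pose S n := sval (cid (Flat_sub R_dedekind (SZ n))).
pose i n : {linear S n -> E} := sval (cid (svalP (cid (Flat_sub R_dedekind (SZ n))))).
have [i_inj iE] : (forall n, injective (i n)) /\
    forall n x, (forall j, j != n -> (p x : dsum Z) j = 0) <-> exists s, i n s = x.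
  split=> n; have [inj_in in_E] := svalP (cid (svalP (cid (Flat_sub R_dedekind (SZ n))))).
    exact: inj_in.
  by move=> x; rewrite -in_E; split=> /asboolP.
have pi_out n j (s : S n) : j != n -> (p (i n s) : dsum Z) j = 0.
  by move: j; apply/iE; exists s.
have psi_ex n : exists psi : {linear N -> S n}, forall y, i n (psi y) = nu y.
  apply: (lift_injective (i_inj n)) => y; apply/iE => j jn.
  by rewrite (_ : p (nu y) = 0) //; apply/nuE; exists y.
pose psi n := sval (cid (psi_ex n)).
have psiE n : forall y, i n (psi n y) = nu y := svalP (cid (psi_ex n)).
have pi0 n (s : S n) : (p (i n s) : dsum Z) n = 0 -> exists y, s = psi n y.
  move=> ps0; have /nuE[y yE] : p (i n s) = 0.
    apply: dsum_ext => j; have [->|/pi_out] := eqVneq j n; first exact: ps0.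
    exact.
  by exists y; apply: (i_inj n); rewrite psiE.
apply: (@PlainTreeLengthS _ _ _ _ a b E N S psi) => //.
- apply: (fg_kernel_extend (e := 0) nu_inj p_fg) => [x /nuE//||y].
    by exists 0; rewrite linear0.
  by exists 0; rewrite scale0r; apply/nuE; exists y.
- move=> n; apply: (Zptl n _ (dsum_proj Z n \o (p \o i n) : {linear S n -> Z n})).
    move=> z; have [x xE] := p_surj (dsum_in Z n z).
    have /iE[s sE] : forall j, j != n -> (p x : dsum Z) j = 0.
      by move=> j jn; rewrite xE dsum_in_out.
    by exists s; rewrite /= dsum_projE sE xE dsum_inE.
  have [k [g [pg gE]]] := p_fg.
  have /choice[h hE] j : exists s, i n s = g j.
    by apply/iE => l _; rewrite pg.
  exists k, h; split=> [j|s]; first by rewrite /= dsum_projE hE pg.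
  rewrite /= dsum_projE => /pi0[y ->].
  have [c cE] : exists c : 'I_k -> R, nu y = \sum_j c j *: g j.
    by apply/gE/nuE; exists y.
  exists c; apply: (i_inj n); rewrite psiE cE linear_sum.
  by apply: eq_bigr => j _; rewrite linearZ hE.
- by move=> n x y /(congr1 (i n)); rewrite !psiE => /nu_inj.
apply: (@wedge_summand _ R_dedekind _ _ psi E nu i) => //.
- move=> c; pose z : dsum Z := p c.
  have x_ex n : exists x : S n, p (i n x) = dsum_in Z n (z n).
    have [x xE] := p_surj (dsum_in Z n (z n)).
    have /iE[s sE] : forall j, j != n -> (p x : dsum Z) j = 0.
      by move=> j jn; rewrite xE dsum_in_out.
    by exists s; rewrite sE.
  pose x n := sval (cid (x_ex n)).
  have xE n : p (i n (x n)) = dsum_in Z n (z n) := svalP (cid (x_ex n)).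
  pose X := \sum_(n < dsum_bound z) dsum_in S n (x n).
  have /nuE[y yE] : p (c - dsum_rec i X) = 0.
    rewrite linearB [in X in _ - X]linear_sum [in X in _ - X]linear_sum.
    under eq_bigr => n _ do rewrite dsum_rec_in xE.
    by rewrite -(dsum_decomp (@dsum_boundP _ _ z)) subrr.
  by exists y, X; rewrite yE subrK.
- move=> y x yx0; exists 1; first exact: oner_neq0.
  move=> n; rewrite scale1r; apply: pi0.
  have /(congr1 (fun e => (p e : dsum Z) n)) := yx0.
  rewrite linear0 linearD (_ : p (nu y) = 0) ?add0r; last by apply/nuE; exists y.
  rewrite (dsum_recE _ (@dsum_boundP _ _ x)) linear_sum dsum_sumE.
  have [nb|bn] := ltnP n (dsum_bound x); last by rewrite (dsum_boundP bn) !linear0.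
  rewrite (bigD1 (Ordinal nb)) // big1 => [|j /andP[_ jn]].
    by move=> sum0; rewrite -[LHS]addr0; apply: sum0.
  by rewrite pi_out //; apply: contraNneq jn => nj; apply/eqP/val_inj.
Qed.

End PlainTreeLengthBounds.

(** * Generic elements of the completion *)

Section Generic.
Variable R : idomainType.

(** Polynomials in countably many variables, as lists of monomials: a coefficient and the list of
    its variables. This data is countable when R is. *)
Definition peval (q : seq (R * seq nat)) (x : nat -> R) : R :=
  \sum_(m <- q) m.1 * \prod_(v <- m.2) x v.

Definition polyfun (P : (nat -> R) -> R) : Prop := exists q, peval q =1 P.

Lemma polyfun_const r : polyfun (fun=> r).
Proof. by exists [:: (r, [::])] => x; rewrite /peval big_seq1 big_nil mulr1. Qed.

Lemma polyfun_var v : polyfun (fun x => x v).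
Proof. by exists [:: (1, [:: v])] => x; rewrite /peval !big_seq1 mul1r. Qed.

Lemma polyfunD P Q : polyfun P -> polyfun Q -> polyfun (fun x => P x + Q x).
Proof.
by move=> [p pE] [q qE]; exists (p ++ q) => x; rewrite -pE -qE /peval big_cat.
Qed.

Lemma polyfunM P Q : polyfun P -> polyfun Q -> polyfun (fun x => P x * Q x).
Proof.
move=> [p pE] [q qE].
exists [seq (u.1 * v.1, u.2 ++ v.2) | u <- p, v <- q] => x.
rewrite -pE -qE /peval big_allpairs_dep mulr_suml; apply: eq_bigr => u _.
rewrite mulr_sumr; apply: eq_bigr => v _ /=.
by rewrite big_cat /=; ring.
Qed.

Lemma polyfunB P Q : polyfun P -> polyfun Q -> polyfun (fun x => P x - Q x).
Proof.
move=> Pp Qp; have [q qE] := polyfunD Pp (polyfunM (polyfun_const (-1)) Qp).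
by exists q => x; rewrite qE mulN1r.
Qed.

Lemma polyfun_sum I (r : seq I) (F : I -> (nat -> R) -> R) :
  (forall i, polyfun (F i)) -> polyfun (fun x => \sum_(i <- r) F i x).
Proof.
move=> Fp; elim: r => [|i r IHr].
  by have [q qE] := polyfun_const 0; exists q => x; rewrite qE big_nil.
have [q qE] := polyfunD (Fp i) IHr.
by exists q => x; rewrite qE big_cons.
Qed.

(** For [a = dd n] this is the uniform continuity of polynomials. *)
Lemma polyfun_divides P a x y : polyfun P ->
  (forall v, divides a (x v - y v)) -> divides a (P x - P y).
Proof.
move=> [q qE] xy; rewrite -!qE /peval -sumrB; apply: divides_sum => m _.
rewrite -mulrBr; apply: dividesMl; elim: m.2 => [|v s IHs].
  by rewrite !big_nil subrr; apply: divides0.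
rewrite !big_cons.
have -> : x v * \prod_(j <- s) x j - y v * \prod_(j <- s) y j =
    x v * (\prod_(j <- s) x j - \prod_(j <- s) y j) +
    \prod_(j <- s) y j * (x v - y v) by ring.
by apply: dividesD; apply: dividesMl.
Qed.

Variables (dd : nat -> R) (ddP : denominators dd).

Definition congruent n (x y : nat -> R) : Prop :=
  forall v, divides (dd n) (x v - y v).

(* No polynomial vanishes at the limit of z n unless it vanishes on a whole
   ball: Baire's argument, for the topology given by the ideals (dd n). *)
Definition generic (z : nat -> nat -> R) : Prop :=
  (forall n m, (n <= m)%N -> congruent n (z m) (z n)) /\
  forall P, polyfun P -> (forall n, divides (dd n) (P (z n))) ->
    exists x0 n0, forall x, congruent n0 x x0 -> P x = 0.

Lemma congruent_trans n x y t :
  congruent n x y -> congruent n y t -> congruent n x t.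
Proof.
move=> xy yt v; have -> : x v - t v = (x v - y v) + (y v - t v) by ring.
exact: dividesD.
Qed.

Lemma congruent_le m n x y : (m <= n)%N -> congruent n x y -> congruent m x y.
Proof.
case: ddP => _ dd_le _ mn xy v; apply: divides_trans (xy v); exact: dd_le.
Qed.

Lemma congruent_refl n x : congruent n x x.
Proof. by move=> v; rewrite subrr; apply: divides0. Qed.

Lemma polyfun_enum : countable [set: R] ->
  exists Q : nat -> seq (R * seq nat), forall q, exists k, Q k = q.
Proof.
move=> /countable_injP[code code_inj].
have /choice[g gE] n : exists r : R, forall r', code r' = n -> r' = r.
  have [[r rn]|nor] := pselect (exists r, code r = n).
    by exists r => r' r'n; apply: code_inj; rewrite ?in_setT // r'n rn.
  by exists 0 => r rn; case: nor; exists r.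
exists (fun k => [seq (g m.1, m.2) | m : nat * seq nat <- odflt [::] (unpickle k)]).
move=> q; exists (pickle [seq (code m.1, m.2) | m : R * seq nat <- q]).
rewrite pickleK /= -map_comp -[RHS]map_id; apply: eq_map => -[r s] /=.
by congr pair; apply/esym/gE.
Qed.

Lemma generic_exists : countable [set: R] -> ~ GRing.field_axiom R ->
  exists z, generic z.
Proof.
move=> /polyfun_enum[Q QE] R_not_field; have [_ dd_le _] := ddP.
(* [s] is a ball, given by centre and modulus. If the k-th polynomial does not vanish on the whole
   ball, the centre moves to a point where it is nonzero and the modulus grows until it no longer
   divides the value there. *)
have step k (s : (nat -> R) * nat) : exists s' : (nat -> R) * nat,
    [/\ congruent s.2 s'.1 s.1, (s.2 < s'.2)%N &
     (exists2 y, congruent s.2 y s.1 & peval (Q k) y <> 0) ->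
     ~ divides (dd s'.2) (peval (Q k) s'.1)].
  have [[y ys Py0]|noy] :=
      pselect (exists2 y, congruent s.2 y s.1 & peval (Q k) y <> 0); last first.
    by exists (s.1, s.2.+1); split=> //=; apply: congruent_refl.
  have [m nm] : exists m, ~ divides (dd m) (peval (Q k) y).
    apply: contrapT => alldiv; apply/Py0/(denominators_cap ddP R_not_field) => n.
    by apply: contrapT => nn; apply: alldiv; exists n.
  exists (y, maxn m s.2.+1); split=> //=; first exact: leq_maxr.
  by move=> _ /(divides_trans (dd_le _ _ (leq_maxl m s.2.+1))).
have /choice[nxt nxtP] : forall ks : nat * ((nat -> R) * nat), _ :=
  fun ks => step ks.1 ks.2.
pose st := fix st k := if k is k'.+1 then nxt (k', st k') else (fun=> 0, 0%N).
have st_n k : (k <= (st k).2)%N.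
  by elim: k => //= k IHk; have [_ + _] := nxtP (k, st k); apply: leq_ltn_trans.
have st_n_le j k : (j <= k)%N -> ((st j).2 <= (st k).2)%N.
  move=> /subnK <-; elim: (k - j)%N => //= i IHi.
  by apply: leq_trans IHi _; have [_ /ltnW + _] := nxtP ((i + j)%N, st (i + j)%N).
have st_cong j k : (j <= k)%N -> congruent (st j).2 (st k).1 (st j).1.
  move=> /subnK <-; elim: (k - j)%N => [|i IHi]; first exact: congruent_refl.
  rewrite addSn; apply: congruent_trans IHi.
  have [+ _ _] := nxtP ((i + j)%N, st (i + j)%N).
  by apply: congruent_le; apply: st_n_le; apply: leq_addl.
exists (fun n => (st n).1); split=> [n m nm|P [q qE] Pdiv].
  exact: congruent_le (st_cong _ _ nm).
(* If [P] were nonzero somewhere on the ball of stage k, stage k + 1 would make its value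
   indivisible by the new modulus, and by continuity this persists at all later centres. *)
have [k kE] := QE q; exists (st k).1, (st k).2 => x xk.
apply: contrapT => Px0; have [_ _ /=] := nxtP (k, st k).
rewrite kE -/(st k.+1); case.
  by exists x => //; rewrite qE.
set m := (st k.+1).2.
have Pp : polyfun (peval q) by exists q.
have := polyfun_divides Pp (st_cong k.+1 m (st_n k.+1)).
move=> /dividesB-/(_ _ (Pdiv m))/dividesN; rewrite qE.
by congr divides; rewrite qE; ring.
Qed.

End Generic.

(** * Tree modules *)

Section TreeModules.
Variable R : idomainType.
Hypotheses (R_dedekind : dedekind_domain R) (R_countable : countable [set: R]).
Variables (dd : nat -> R) (ddP : denominators dd).
Variables (z : nat -> nat -> R) (z_generic : generic dd z).
Variable leaf : pred (seq nat).

Let code := CodeSeq.code.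
Let decode := CodeSeq.decode.
Let codeK : cancel code decode := CodeSeq.codeK.
Let decodeK : cancel decode code := CodeSeq.decodeK.

(* A node is the reversed list of the choices leading to it from the root, so
   that the ancestors of a node are its suffixes. *)
Inductive below : seq nat -> seq nat -> Prop :=
| below_refl u : below u u
| below_child u i t : ~~ leaf u -> below (i :: u) t -> below u t.

Lemma below_suffix u t : below u t -> suffix u t.
Proof.
elim=> {u t} [u|u i t _ _]; first exact: suffix_refl.
by apply: suffix_trans; rewrite -cat1s suffix_suffix.
Qed.

Lemma below_inv u t : below u t ->
  t = u \/ exists2 i, ~~ leaf u & below (i :: u) t.
Proof. by case=> {u t} [u|u i t lu ut]; [left | right; exists i]. Qed.

Lemma below_leaf u t : leaf u -> below u t -> t = u.
Proof. by move=> lu /below_inv[//|[i]]; rewrite lu. Qed.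

Lemma below_trans u s t : below u s -> below s t -> below u t.
Proof.
by elim=> {u s} // u i s lu _ IHs st; apply: below_child (IHs st).
Qed.

Lemma suffix_child_uniq i j (u t : seq nat) :
  suffix (i :: u) t -> suffix (j :: u) t -> i = j.
Proof. by rewrite !suffixE /= => /eqP -> /eqP[]. Qed.

Lemma suffix_child_self i (u : seq nat) : ~~ suffix (i :: u) u.
Proof. by apply/negP => /size_suffix /=; rewrite ltnn. Qed.

Lemma below_between u s t : below u s -> below u t -> suffix s t -> below s t.
Proof.
elim=> {u s} // u i s lu us IHs /below_inv[-> su|[j _ ut] st].
  have := suffix_trans (below_suffix us) su.
  by rewrite (negbTE (suffix_child_self _ _)).
apply: IHs => //; suff -> : i = j by [].
by apply: suffix_child_uniq (suffix_trans (below_suffix us) st) (below_suffix ut).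
Qed.

Definition var (t s : seq nat) : nat := code [:: code t; code s].

Lemma var_inj t s t' s' : var t s = var t' s' -> t = t' /\ s = s'.
Proof.
move=> /(can_inj codeK)[tt' ss'].
by split; apply: (can_inj codeK).
Qed.

(* The sequence n |-> z n (var t s) converges to an element z_(t,s) of the limit
   of the R / dd n, and tree_form s k c approximates the sum of c_s and of the
   z_(t,s) c_t, for t a leaf below s. The module of the node u consists of the
   vectors c supported below u for which this limit is integral at each inner
   node s. *)
Definition coef (s : seq nat) (x : nat -> R) (t : seq nat) : R :=
  if t == s then 1 else if leaf t && suffix s t then x (var t s) else 0.

Lemma coef_polyfun s t : polyfun (fun x => coef s x t).
Proof.
rewrite /coef; case: eqP => _; first exact: (polyfun_const 1).
case: (leaf t && suffix s t); last exact: (polyfun_const 0).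
exact: (polyfun_var _ (var t s)).
Qed.

Lemma coef_divides n m s t : (n <= m)%N ->
  divides (dd n) (coef s (z m) t - coef s (z n) t).
Proof.
move=> nm; apply: (polyfun_divides (coef_polyfun s t)).
by have [zc _] := z_generic; apply: zc.
Qed.

Local Notation G := (dsum (fun _ : nat => frac_mod R)).

Fact mul_frac_linear (r : R) : linear (fun x : frac_mod R => r *: x).
Proof. by move=> a x y; rewrite scalerDr !scalerA mulrC. Qed.

Definition tree_form s k : {linear G -> frac_mod R} :=
  dsum_rec (fun n => mk_linear (mul_frac_linear (coef s (z k) (decode n)))).

Lemma tree_formE s k (c : G) b : (forall n, (b <= n)%N -> c n = 0) ->
  tree_form s k c = \sum_(n < b) coef s (z k) (decode n) *: c n.
Proof. by move=> cb; rewrite /tree_form (dsum_recE _ cb). Qed.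

Lemma tree_form_in s k n (a : frac_mod R) :
  tree_form s k (dsum_in _ n a) = coef s (z k) (decode n) *: a.
Proof. by rewrite /tree_form dsum_rec_in. Qed.

Lemma tree_form_ext s k (c c' : G) :
  (forall n, coef s (z k) (decode n) != 0 -> c n = c' n) ->
  tree_form s k c = tree_form s k c'.
Proof.
move=> cc'; pose b := maxn (dsum_bound c) (dsum_bound c').
rewrite !(@tree_formE _ _ _ b).
- apply: eq_bigr => n _; have [->|/cc' -> //] := eqVneq (coef s (z k) (decode n)) 0.
  by rewrite !scale0r.
- by move=> n; rewrite geq_max => /andP[_ /dsum_boundP].
- by move=> n; rewrite geq_max => /andP[/dsum_boundP].
Qed.

Lemma clear_denominators (c : G) :
  exists k0, forall k, (k0 <= k)%N -> forall n, integral (dd k *: c n).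
Proof.
have [k0 k0P] := common_denominator ddP
  [seq (c n : {fraction R}) | n <- iota 0 (dsum_bound c)].
exists k0 => k k0k n; have [nb|bn] := ltnP n (dsum_bound c).
  by apply: (k0P _ k0k); apply/mapP; exists n; rewrite // mem_iota.
by rewrite dsum_boundP // scaler0; exists 0; rewrite tofrac0.
Qed.

(** Once [dd k] clears the denominators of [c], the later approximations agree modulo R, so
    integrality of the limit is decided at stage k. *)
Lemma tree_form_stable s (c : G) k k' : (forall n, integral (dd k *: c n)) ->
  (k <= k')%N -> integral (tree_form s k' c - tree_form s k c).
Proof.
move=> ck kk'; rewrite !(tree_formE _ _ (@dsum_boundP _ _ c)) -sumrB.
apply: integral_sum => n _; rewrite -scalerBl.
by apply: (integral_divides (coef_divides s _ kk')); apply: ck.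
Qed.

Definition tree_pred (u : seq nat) (c : G) : Prop :=
  (forall n, c n != 0 -> below u (decode n)) /\
  forall s, below u s -> ~~ leaf s ->
    exists k0, forall k, (k0 <= k)%N -> integral (tree_form s k c).

Definition G_Flat : Flat R :=
  dsum_Flat R_dedekind (fun=> tf_Flat R_dedekind (frac_countable R_countable)
    (@frac_torsion_free R)).

Lemma tree_pred_closed u : submod_closed (fun c : G_Flat => `[< tree_pred u c >]).
Proof.
apply: submod_closedP => [|a c c' [cS cI] [cS' cI']].
  split=> [n|s _ _]; first by rewrite eqxx.
  by exists 0%N => k _; rewrite linear0; exists 0; rewrite tofrac0.
split=> [n|s us ls].
  rewrite -[X in X != 0]/(a *: (c : G) n + (c' : G) n).
  have [->|/cS //] := eqVneq ((c : G) n) 0.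
  by rewrite scaler0 add0r => /cS'.
have [k0 k0P] := cI s us ls; have [k1 k1P] := cI' s us ls.
exists (maxn k0 k1) => k; rewrite geq_max => /andP[/k0P ck /k1P c'k].
by rewrite linearP; apply: integralD => //; apply: integralM.
Qed.

Definition tree_mod u : Flat R := sval (cid (Flat_sub R_dedekind (@tree_pred_closed u))).
Definition tree_in u : {linear tree_mod u -> G} :=
  sval (cid (svalP (cid (Flat_sub R_dedekind (@tree_pred_closed u))))).

Lemma tree_in_inj u : injective (tree_in u).
Proof. by have [] := svalP (cid (svalP (cid (Flat_sub R_dedekind (@tree_pred_closed u))))). Qed.

Lemma tree_inP u (c : G) : tree_pred u c <-> exists x, tree_in u x = c.
Proof.
have [_ /(_ c) <-] := svalP (cid (svalP (cid (Flat_sub R_dedekind (@tree_pred_closed u))))).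
by split=> /asboolP.
Qed.

Lemma tree_in_pred u x : tree_pred u (tree_in u x).
Proof. by apply/tree_inP; exists x. Qed.

Lemma tree_basis_pred u t : below u t ->
  tree_pred u (dsum_in (fun=> frac_mod R) (code t) (tofrac 1)).
Proof.
move=> ut; split=> [n|s _ _].
  have [->|nt] := eqVneq n (code t); first by rewrite codeK.
  by rewrite dsum_in_out // eqxx.
exists 0%N => k _; rewrite tree_form_in.
by exists (coef s (z k) (decode (code t)) * 1); rewrite frac_modZ tofracM.
Qed.

Lemma tree_basis_ex u t : exists x, below u t ->
  tree_in u x = dsum_in (fun=> frac_mod R) (code t) (tofrac 1).
Proof.
have [ut|nut] := pselect (below u t); last by exists 0.
by have /tree_inP[x xE] := tree_basis_pred ut; exists x.
Qed.

Definition tree_basis u t : tree_mod u := sval (cid (tree_basis_ex u t)).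

Lemma tree_basisE u t : below u t ->
  tree_in u (tree_basis u t) = dsum_in (fun=> frac_mod R) (code t) (tofrac 1).
Proof. exact: (svalP (cid (tree_basis_ex u t))). Qed.

Lemma tree_leaf u : leaf u -> exists kappa : {linear tree_mod u -> frac_mod R},
  injective kappa /\ forall k, exists x, kappa x = k.
Proof.
move=> lu; exists (dsum_proj _ (code u) \o tree_in u); split=> [x y|a] /=.
  rewrite !dsum_projE => xy; apply: tree_in_inj; apply: dsum_ext => n.
  have [->//|nu] := eqVneq n (code u).
  have out x' : tree_in u x' n = 0.
    have [x'S _] := tree_in_pred x'; apply/eqP; apply: contrapT => /negP/x'S.
    by move=> /(below_leaf lu) un; move: nu; rewrite -un decodeK eqxx.
  by rewrite !out.
have /tree_inP[x xE] : tree_pred u (dsum_in _ (code u) a).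
  split=> [n|s /(below_leaf lu) ->]; last by rewrite lu.
  have [->|nt] := eqVneq n (code u); first by rewrite codeK => _; apply: below_refl.
  by rewrite dsum_in_out // eqxx.
by exists x; rewrite dsum_projE xE dsum_inE.
Qed.

Section Node.
Variables (u : seq nat) (u_inner : ~~ leaf u).

Lemma below_childW i t : below (i :: u) t -> below u t.
Proof. exact: below_child. Qed.

Definition restrict i : {linear G -> G} :=
  dsum_map (fun n => (if `[< below (i :: u) (decode n) >]
    then (idfun : {linear frac_mod R -> frac_mod R})
    else (\0 : {linear frac_mod R -> frac_mod R}))
    : {linear frac_mod R -> frac_mod R}).

Lemma restrictE i (c : G) n :
  restrict i c n = if `[< below (i :: u) (decode n) >] then c n else 0.
Proof. by rewrite dsum_mapE; case: asboolP. Qed.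

(** The form of a node under the child i sees only the coordinates under that child. Truncation to
    the subtree therefore respects the integrality conditions. *)
Lemma coef_child_out i s x t : below (i :: u) s -> below u t ->
  ~ below (i :: u) t -> coef s x t = 0.
Proof.
move=> us ut nut; rewrite /coef; case: eqP => [ts|_]; first by case: nut; rewrite ts.
case: ifP => // /andP[_ st]; case: nut.
have iut := suffix_trans (below_suffix us) st.
move: ut => /below_inv[tu|[j _ jut]].
  by move: iut; rewrite tu (negbTE (suffix_child_self _ _)).
by rewrite (suffix_child_uniq iut (below_suffix jut)).
Qed.

Lemma tree_form_restrict i s k (c : G) : below (i :: u) s ->
  (forall n, c n != 0 -> below u (decode n)) ->
  tree_form s k (restrict i c) = tree_form s k c.
Proof.
move=> us cS; apply: tree_form_ext => n cn; rewrite restrictE.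
case: asboolP => // nin; apply/esym/eqP; apply: contrapT => /negP/cS un.
by move: cn; rewrite (coef_child_out _ us un nin) eqxx.
Qed.

Lemma restrict_pred i c : tree_pred u c -> tree_pred (i :: u) (restrict i c).
Proof.
move=> [cS cI]; split=> [n|s us ls].
  by rewrite restrictE; case: asboolP => //; rewrite eqxx.
have [k0 k0P] := cI s (below_childW us) ls; exists k0 => k /k0P.
by rewrite tree_form_restrict.
Qed.

Lemma tree_res_ex i : exists r : {linear tree_mod u -> tree_mod (i :: u)},
  forall x, tree_in (i :: u) (r x) = restrict i (tree_in u x).
Proof.
have [x|r rE] := @lift_injective _ _ _ _ (tree_in (i :: u))
  (restrict i \o tree_in u : {linear tree_mod u -> G}) (@tree_in_inj _).
  exact/tree_inP/restrict_pred/tree_in_pred.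
by exists r.
Qed.

Definition tree_res i := sval (cid (tree_res_ex i)).

Lemma tree_resE i x : tree_in (i :: u) (tree_res i x) = restrict i (tree_in u x).
Proof. exact: (svalP (cid (tree_res_ex i))). Qed.

Fact tree_res_support x : finite_support (fun i => tree_res i x).
Proof.
pose c := tree_in u x.
(* The child of [u] under which the node of coordinate n lies: nodes are reversed lists, so the
   choice made at [u] sits just before the suffix [u]. *)
pose branch (n : nat) := nth 0%N (decode n) (size (decode n) - (size u).+1).
pose m := \max_(n < dsum_bound c) (branch n).+1.
apply: (sub_finite_set _ (finite_II m)) => i /= ri.
suff [n nb iE] : exists2 n, (n < dsum_bound c)%N & i = branch n.
  by rewrite iE; apply: (leq_bigmax (Ordinal nb)).
apply: contrapT => noi; move/eqP: ri; apply; apply: tree_in_inj.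
rewrite tree_resE linear0; apply: dsum_ext => n; rewrite restrictE.
case: asboolP => // /below_suffix iun.
have [nb|] := ltnP n (dsum_bound c); last exact: dsum_boundP.
case: noi; exists n => //; rewrite /branch; move: iun.
by rewrite suffixE /= => /eqP /(congr1 (fun s => nth 0%N s 0)); rewrite nth_drop addn0.
Qed.

Fact tree_quot_linear : linear (fun x => DSum (tree_res_support x)
  : dsum_Flat R_dedekind (fun i => tree_mod (i :: u))).
Proof. by move=> a x y; apply: dsum_ext => i /=; rewrite linearP. Qed.

Definition tree_quot :
    {linear tree_mod u -> dsum_Flat R_dedekind (fun i => tree_mod (i :: u))} :=
  mk_linear tree_quot_linear.

Lemma tree_quotE x i : (tree_quot x : dsum _) i = tree_res i x.
Proof. by []. Qed.

Lemma tree_quot_surj y : exists x, tree_quot x = y.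
Proof.
pose Y : dsum (fun i => tree_mod (i :: u)) := y.
pose c' : G := \sum_(i < dsum_bound Y) tree_in ((i : nat) :: u) (Y i).
have Yn i n : tree_in (i :: u) (Y i) n != 0 -> below (i :: u) (decode n).
  exact: (tree_in_pred (Y i)).1.
have c'E i n : below (i :: u) (decode n) -> c' n = tree_in (i :: u) (Y i) n.
  move=> iun; rewrite /c' dsum_sumE.
  have out j : j != i -> tree_in (j :: u) (Y j) n = 0.
    move=> ji; apply/eqP; apply: contrapT => /negP/Yn jun; case/eqP: ji.
    exact: suffix_child_uniq (below_suffix jun) (below_suffix iun).
  have [ib|bi] := ltnP i (dsum_bound Y); last first.
    rewrite (dsum_boundP bi) linear0 big1 // => j _; apply: out.
    by rewrite neq_ltn (leq_trans (ltn_ord j) bi).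
  rewrite (bigD1 (Ordinal ib)) // big1 => [|j /andP[_ ji]].
    by rewrite -[RHS]addr0.
  by rewrite out //; apply: contraNneq ji => /= ij; apply/eqP/val_inj.
have c'S n : c' n != 0 -> exists i, below (i :: u) (decode n).
  move=> c'n; apply: contrapT => noi; case/eqP: c'n; rewrite /c' dsum_sumE big1 // => j _.
  by apply/eqP; apply: contrapT => /negP/Yn jun; apply: noi; exists j.
have [k0 k0P] := clear_denominators c'.
(* The coordinate at [u] has coefficient 1 in the form of [u] and 0 in the forms below, so it can
   absorb the failure of integrality at [u] without affecting the other conditions. *)
pose a : frac_mod R := - tree_form u k0 c'.
pose c : G := c' + dsum_in _ (code u) a.
have nu i : ~ below (i :: u) u.
  by move=> /below_suffix; rewrite (negbTE (suffix_child_self _ _)).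
have /tree_inP[x xE] : tree_pred u c.
  split=> [n|s us ls].
    rewrite -[X in X != 0]/(c' n + dsum_in _ (code u) a n).
    have [->|nu'] := eqVneq n (code u); first by rewrite codeK => _; apply: below_refl.
    by rewrite dsum_in_out // addr0 => /c'S[i /below_childW].
  move: us => /below_inv[->|[i _ us]].
    exists k0 => k k0k; rewrite linearD tree_form_in codeK /coef eqxx scale1r.
    by apply: tree_form_stable => //; apply: k0P.
  have [_ YI] := tree_in_pred (Y i); have [k1 k1P] := YI s us ls.
  exists k1 => k k1k; rewrite linearD tree_form_in codeK.
  rewrite (coef_child_out _ us (below_refl u) (@nu i)) scale0r addr0.
  suff <- : tree_form s k (tree_in (i :: u) (Y i)) = tree_form s k c' by apply: k1P.
  apply: tree_form_ext => n cn.
  have [iun|niun] := pselect (below (i :: u) (decode n)); first by rewrite (c'E i).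
  have -> : tree_in (i :: u) (Y i) n = 0.
    by apply/eqP; apply: contrapT => /negP/Yn.
  apply/esym/eqP; apply: contrapT => /negP/c'S[j /below_childW un].
  by move: cn; rewrite (coef_child_out _ us un niun) eqxx.
exists x; apply: dsum_ext => i; rewrite tree_quotE; apply: tree_in_inj.
rewrite tree_resE xE; apply: dsum_ext => n; rewrite restrictE.
case: asboolP => [iun|niun]; last first.
  by apply/esym/eqP; apply: contrapT => /negP/Yn.
rewrite -[LHS]/(c' n + dsum_in _ (code u) a n) (c'E i) // dsum_in_out ?addr0 //.
by apply/negP => /eqP nE; apply: (nu i); rewrite -[X in below _ X]codeK -nE.
Qed.

Lemma tree_quot_basis : tree_quot (tree_basis u u) = 0.
Proof.
apply: dsum_ext => i; rewrite tree_quotE; apply: tree_in_inj.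
rewrite tree_resE tree_basisE; last exact: below_refl.
rewrite linear0; apply: dsum_ext => n; rewrite restrictE; case: asboolP => // iun.
rewrite dsum_in_out //; apply/negP => /eqP nE; move: iun; rewrite nE codeK.
by move=> /below_suffix; rewrite (negbTE (suffix_child_self _ _)).
Qed.

Lemma tree_quot_ker x : tree_quot x = 0 -> exists r : R, x = r *: tree_basis u u.
Proof.
move=> qx; pose c := tree_in u x; have [cS cI] := tree_in_pred x.
have cE : c = dsum_in _ (code u) (c (code u)).
  apply: dsum_ext => n; have [->|nu] := eqVneq n (code u); first by rewrite dsum_inE.
  rewrite dsum_in_out //; apply/eqP; apply: contrapT => /negP cn.
  have [nE|[i _ iun]] := below_inv (cS n cn).
    by move: nu; rewrite -nE decodeK eqxx.
  move/eqP: cn; apply; rewrite -[LHS]/(c n).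
  have : restrict i c n = c n by rewrite restrictE; case: asboolP.
  move=> <-; rewrite -tree_resE -tree_quotE qx -[X in tree_in _ X]/(0).
  by rewrite linear0.
have [k0 /(_ k0 (leqnn k0))] := cI u (below_refl u) u_inner.
rewrite -/c cE tree_form_in codeK /coef eqxx scale1r => -[r rE].
exists r; apply: tree_in_inj; rewrite linearZ /= tree_basisE; last exact: below_refl.
rewrite -/c cE rE -linearZ; congr (dsum_in _ _ _).
by rewrite frac_modZ -tofracM mulr1.
Qed.

End Node.

(** * Rigidity of the tree modules *)

Section Rigid.
Hypothesis below_some_leaf : forall s, exists2 t, leaf t & below s t.
Variables (u : seq nat) (u_inner : ~~ leaf u).

(** The range starts at 1, since dropping nothing would return [t] itself. *)
Definition ancestors (t : seq nat) : seq (seq nat) :=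
  [seq s <- [seq drop k t | k <- iota 1 (size t)] | `[< below u s >]].

Lemma ancestors_uniq t : uniq (ancestors t).
Proof.
apply: filter_uniq; rewrite map_inj_in_uniq ?iota_uniq // => k l.
rewrite !mem_iota => /andP[_ kt] /andP[_ lt] /(congr1 size).
rewrite !size_drop => kl; rewrite -(subKn (_ : (k <= size t)%N)) -1?ltnS //.
by rewrite kl subKn // -ltnS.
Qed.

Lemma mem_ancestors s t :
  s \in ancestors t <-> [/\ below u s, suffix s t & s != t].
Proof.
rewrite mem_filter; split=> [/andP[/asboolP us /mapP[k]]|[us st snt]].
  rewrite mem_iota => /andP[k1 kt] sE; split=> //.
    by rewrite sE -{2}(cat_take_drop k t) suffix_suffix.
  apply/negP => /eqP /(congr1 size); rewrite sE size_drop => /eqP.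
  rewrite eqn_leq [X in _ && X]leqNgt => /andP[_ /negP[]].
  by rewrite -{2}(subnK (_ : (k <= size t)%N)) -1?ltnS // -addn1 leq_add2l.
apply/andP; split; first exact/asboolP.
apply/mapP; exists (size t - size s)%N; last by move: st; rewrite suffixE => /eqP.
rewrite mem_iota ltnS leq_subr subn_gt0 andbT ltn_neqAle (size_suffix st) andbT.
apply: contraNneq snt => sst; move: st; rewrite suffixE sst subnn drop0.
by rewrite eq_sym.
Qed.

Lemma ancestors_inner s t : leaf t -> below u t -> s \in ancestors t ->
  below s t /\ ~~ leaf s.
Proof.
move=> lt ut /mem_ancestors[us st snt]; have bst := below_between us ut st.
split=> //; apply/negP => ls; case/eqP: snt; exact/esym/(below_leaf ls).
Qed.

(** On this vector the form of an inner node s takes at stage k >= n the value z_k - z_n of the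
    variable (t,s) if s is an ancestor of [t], and 0 otherwise; both are multiples of [dd n]. *)
Lemma divided_relation t n : leaf t -> below u t -> exists y : tree_mod u,
  dd n *: y = tree_basis u t - \sum_(s <- ancestors t) z n (var t s) *: tree_basis u s.
Proof.
move=> lt ut; have [dd0 _ _] := ddP.
pose c : G := (dsum_in (fun=> frac_mod R) (code t) (tofrac 1) -
  \sum_(s <- ancestors t) z n (var t s) *: dsum_in (fun=> frac_mod R) (code s) (tofrac 1)).
have ddK (a : frac_mod R) : dd n *: (((tofrac (dd n))^-1 * a : {fraction R}) : frac_mod R) = a.
  by rewrite frac_modZ mulrA divff ?mul1r // tofrac_eq0.
have invL : linear (fun a : frac_mod R => ((tofrac (dd n))^-1 * a : {fraction R}) : frac_mod R).
  by move=> r a b; rewrite !frac_modZ mulrDr mulrCA.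
pose inv := dsum_map (fun _ : nat => mk_linear invL).
have invK b : dd n *: inv b = b.
  by apply: dsum_ext => m; rewrite dsumZE dsum_mapE mk_linearE ddK.
have cE : c = tree_in u (tree_basis u t -
    \sum_(s <- ancestors t) z n (var t s) *: tree_basis u s).
  rewrite linearB linear_sum tree_basisE //; congr (_ - _).
  apply: eq_big_seq => s /mem_ancestors[us _ _].
  by rewrite linearZ /= tree_basisE.
have /tree_inP[y yE] : tree_pred u (inv c).
  have [cS _] : tree_pred u c by rewrite cE; apply: tree_in_pred.
  split=> [m|s us ls].
    rewrite dsum_mapE mk_linearE => cm; apply: cS; apply: contraNneq cm => ->.
    by rewrite mulr0.
  exists n => k nk.
  suff [r rE] : exists r, tree_form s k c = tofrac (dd n * r).
    exists r; move/eqP: rE; rewrite -{1}(invK c) linearZ /= frac_modZ tofracM.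
    by rewrite (inj_eq (mulfI _)) ?tofrac_eq0 // => /eqP.
  rewrite linearB linear_sum tree_form_in codeK.
  under eq_big_seq => s' s'anc do
    rewrite linearZ /= tree_form_in codeK scalerA frac_modZ -tofracM mulr1.
  rewrite -(@rmorph_sum _ _ (@tofrac R)) frac_modZ -tofracM mulr1 -tofracB.
  rewrite (_ : \sum_(s' <- ancestors t) _ =
      if s \in ancestors t then z n (var t s) else 0); last first.
    have coef_s s' : s' \in ancestors t ->
        z n (var t s') * coef s (z k) s' = if s' == s then z n (var t s) else 0.
      move=> /(ancestors_inner lt ut)[_ /negbTE ls']; rewrite /coef.
      by case: eqP => [->|_]; rewrite ?mulr1 // ls' mulr0.
    rewrite (eq_big_seq _ coef_s) -big_mkcond /=.
    case: ifP => [sanc|/negP sanc]; last first.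
      by rewrite big_seq_cond big1 // => s' /andP[s'anc /eqP s's]; case: sanc; rewrite -s's.
    by rewrite -big_filter filter_pred1_uniq ?ancestors_uniq // big_seq1.
  have -> : coef s (z k) t = if s \in ancestors t then z k (var t s) else 0.
    rewrite /coef; case: eqP => [ts|/eqP nts]; first by move: ls; rewrite -ts lt.
    rewrite lt /=; case: ifP => [st|/negP nst].
      have -> // : s \in ancestors t.
      by apply/mem_ancestors; split=> //; rewrite eq_sym.
    by case: ifP => // /mem_ancestors[_ /nst].
  case: ifP => _; last by exists 0; rewrite subr0 mulr0.
  have [zc _] := z_generic; have [r rE] := zc _ _ nk (var t s).
  by exists r; rewrite rE mulrC.
by exists y; apply: tree_in_inj; rewrite linearZ /= yE invK cE.
Qed.

Definition update (x : nat -> R) (v : nat) (r : R) : nat -> R :=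
  fun w => if w == v then x w + r else x w.

Lemma update_congruent n x y v : congruent dd n x y ->
  congruent dd n (update x v (dd n)) y.
Proof.
move=> xy w; rewrite /update; case: eqP => // _; rewrite addrAC.
by apply: dividesD; [apply: xy | apply: divides_refl].
Qed.

(** Adding [dd n] to one variable stays in the ball, and the difference of the two values isolates
    the coefficient of that variable. *)
Lemma affine_vanish n x0 t (S : seq (seq nat)) (a : R) (b : seq nat -> R) :
  uniq S ->
  (forall x, congruent dd n x x0 -> a - \sum_(s <- S) x (var t s) * b s = 0) ->
  a = 0 /\ forall s, s \in S -> b s = 0.
Proof.
move=> Suniq vanish; have [dd0 _ _] := ddP.
have b0 s : s \in S -> b s = 0.
  move=> sS; have := vanish _ (update_congruent (var t s) (congruent_refl dd n x0)).
  rewrite -[RHS](vanish _ (congruent_refl dd n x0)) => /addrI/oppr_inj/eqP.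
  rewrite -subr_eq0 -sumrB (bigD1_seq s) //= big1_seq ?addr0 => [|s' /andP[s's _]].
    rewrite /update eqxx -mulrBl addrAC subrr add0r mulf_eq0 (negbTE (dd0 n)).
    by move=> /eqP.
  rewrite /update; case: eqP => [/var_inj[_ ss']|_]; last by rewrite subrr.
  by move: s's; rewrite ss' eqxx.
split=> //; have := vanish _ (congruent_refl dd n x0).
by rewrite big1_seq ?subr0 // => s /andP[_ /b0 ->]; rewrite mulr0.
Qed.

Section Endomorphism.
Variable h : {linear tree_mod u -> tree_mod u}.
Hypothesis h_root : h (tree_basis u u) = 0.
Variables (t : seq nat) (t_leaf : leaf t) (ut : below u t).

Let b s : G := tree_in u (h (tree_basis u s)).

(* A and B are the coordinates of the images of the basis vectors of t and of its
   ancestors; the relation is read off the divisibility by dd n of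
   e_t - \sum_s z_(t,s) e_s. *)
Lemma endomorphism_relation :
  exists (D : R) (NN : nat) (A : nat -> R) (B : seq nat -> nat -> R),
  [/\ D != 0, forall m, D *: b t m = tofrac (A m),
      forall s m, s \in ancestors t -> D *: b s m = tofrac (B s m),
      forall m, (NN <= m)%N -> A m = 0 /\ forall s, s \in ancestors t -> B s m = 0
    & forall s', below u s' -> ~~ leaf s' -> exists x0 n0, forall x, congruent dd n0 x x0 ->
        \sum_(m < NN) coef s' x (decode m) * A m -
        \sum_(s <- ancestors t) x (var t s) *
          \sum_(m < NN) coef s' x (decode m) * B s m = 0].
Proof.
have [dd0 dd_le _] := ddP.
pose L := t :: ancestors t.
have [k0 k0P] : exists k0, forall s, s \in L -> forall m, integral (dd k0 *: b s m).
  elim: L => [|s L [k kP]]; first by exists 0%N.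
  have [k' k'P] := clear_denominators (b s); exists (maxn k k') => s'.
  rewrite inE => /orP[/eqP ->|s'L] m; first exact: (k'P _ (leq_maxr _ _)).
  by apply: (integral_divides (dd_le _ _ (leq_maxl k k'))); apply: kP.
have /choice[B BE] s : exists B : nat -> R, s \in L ->
    forall m, dd k0 *: b s m = tofrac (B m).
  have [/k0P/choice[B BE]|nL] := boolP (s \in L); last by exists (fun=> 0).
  by exists B.
pose NN := \max_(s <- L) dsum_bound (b s).
have B_out s m : s \in L -> (NN <= m)%N -> B s m = 0.
  move=> sL Nm; apply/eqP; rewrite -tofrac_eq0 -BE // dsum_boundP ?scaler0 //.
  apply: leq_trans Nm.
  exact: (@leq_bigmax_seq _ L xpredT (fun s => dsum_bound (b s)) s sL isT).
have ancL s : s \in ancestors t -> s \in L by rewrite inE orbC => ->.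
have tL : t \in L by rewrite inE eqxx.
exists (dd k0), NN, (B t), B; split=> //.
- by move=> m; apply: BE.
- by move=> s m /ancL sL; apply: BE.
- by move=> m Nm; split=> [|s /ancL sL]; apply: B_out.
move=> s' us' ls'.
(* [x] enters through the form at s' and [x'] through the divided relation. Divisibility by [dd n]
   is first known with [x] at a late stage k and [x'] at stage n; continuity in [x] then brings both
   to stage n. *)
pose Pf (x x' : nat -> R) := \sum_(m < NN) coef s' x (decode m) * B t m -
  \sum_(s <- ancestors t) x' (var t s) *
    \sum_(m < NN) coef s' x (decode m) * B s m.
have sumB_poly s : polyfun (fun x => \sum_(m < NN) coef s' x (decode m) * B s m).
  apply: polyfun_sum => m; apply: polyfunM; first exact: coef_polyfun.
  exact: (polyfun_const (B s m)).
have formE s k : s \in L -> dd k0 *: tree_form s' k (b s) =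
    tofrac (\sum_(m < NN) coef s' (z k) (decode m) * B s m).
  move=> sL; rewrite (@tree_formE _ _ _ NN) => [|m Nm]; last first.
    apply: dsum_boundP; apply: leq_trans Nm.
    exact: (@leq_bigmax_seq _ L xpredT (fun s => dsum_bound (b s)) s sL isT).
  rewrite scaler_sumr (@rmorph_sum _ _ (@tofrac R)); apply: eq_bigr => m _.
  by rewrite scalerA mulrC -scalerA BE // frac_modZ -tofracM.
have Pf_div n : divides (dd n) (Pf (z n) (z n)).
  have [y yE] := divided_relation n t_leaf ut.
  have [_ /(_ s' us' ls')[k1 k1P]] := tree_in_pred (h y).
  pose k := maxn n k1; have nk : (n <= k)%N := leq_maxl _ _.
  have [zc _] := z_generic.
  have Pf_k : divides (dd n) (Pf (z k) (z n)).
    have [r rE] := k1P k (leq_maxr _ _).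
    exists (r * dd k0); apply/eqP; rewrite -tofrac_eq; apply/eqP.
    transitivity (dd k0 *: tree_form s' k (tree_in u (h (dd n *: y)))); last first.
      by rewrite !linearZ /= rE !frac_modZ -!tofracM; congr tofrac; ring.
    have -> : tree_form s' k (tree_in u (h (dd n *: y))) = tree_form s' k (b t) -
        \sum_(s <- ancestors t) z n (var t s) *: tree_form s' k (b s).
      rewrite yE !linearB; congr (_ - _); rewrite !linear_sum.
      by apply: eq_bigr => s _; rewrite !linearZ.
    rewrite scalerBr formE // scaler_sumr /Pf tofracB; congr (_ - _).
    rewrite (@rmorph_sum _ _ (@tofrac R)); apply: eq_big_seq => s /ancL sL.
    by rewrite scalerA [dd k0 * _]mulrC -scalerA formE // frac_modZ -tofracM.
  have Pfp : polyfun (Pf^~ (z n)).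
    apply: polyfunB; first exact: sumB_poly.
    apply: polyfun_sum => s; apply: polyfunM; last exact: sumB_poly.
    exact: (polyfun_const (z n (var t s))).
  have := polyfun_divides Pfp (zc _ _ nk).
  move=> /(dividesB Pf_k); congr divides; ring.
have Pp : polyfun (fun x => Pf x x).
  apply: polyfunB; first exact: sumB_poly.
  apply: polyfun_sum => s; apply: polyfunM; last exact: sumB_poly.
  exact: (polyfun_var _ (var t s)).
by have [_ zg] := z_generic; apply: (zg _ Pp Pf_div).
Qed.

(** For a leaf m, moving the variable (m,u) in the identity of the root [u] isolates the affine form
    [A m] minus the sum of the x_(t,s) [B s m], whose coefficients must vanish. Once the leaf
    coordinates are gone, the identity of an inner node s' retains only the coordinate s'. *)
Lemma endomorphism_zero s0 : s0 \in t :: ancestors t -> h (tree_basis u s0) = 0.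
Proof.
have [D [NN [A [B [D0 AE BE out vanish]]]]] := endomorphism_relation.
have [dd0 _ _] := ddP.
have u_anc : u \in ancestors t.
  apply/mem_ancestors; split; [exact: below_refl | exact: below_suffix|].
  by apply: contraNneq u_inner => ->.
have Bu m : B u m = 0.
  apply/eqP; rewrite -tofrac_eq0 -BE // /b h_root linear0.
  by rewrite -[X in _ *: X]/(0) scaler0.
have leaf0 m : leaf (decode m) -> A m = 0 /\ forall s, s \in ancestors t -> B s m = 0.
  move=> lm; have [mN|/out//] := ltnP m NN.
  have [um|num] := pselect (suffix u (decode m)); last first.
    have b0 s : b s m = 0.
      apply/eqP; apply: contrapT => /negP bs; apply: num; apply: below_suffix.
      exact: (tree_in_pred (h (tree_basis u s))).1.
    split=> [|s sanc]; apply/eqP; rewrite -tofrac_eq0 -?AE -?BE //.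
      by rewrite b0 scaler0.
    by rewrite b0 scaler0.
  have [x0 [n0 v0]] := vanish u (below_refl u) u_inner.
  apply: (@affine_vanish n0 x0 t) => [|x xx0]; first exact: ancestors_uniq.
  have um' : decode m != u by apply: contraNneq u_inner => <-.
  have coef_upd m' : coef u (update x (var (decode m) u) (dd n0)) (decode m') =
      coef u x (decode m') + (if m' == m then dd n0 else 0).
    rewrite /coef /update; case: eqP => [m'u|_].
      case: eqP => [m'm|_]; last by rewrite addr0.
      by move: um'; rewrite -m'm m'u eqxx.
    have [->|m'm] := eqVneq m' m; first by rewrite lm um eqxx.
    case: ifP => _; last by rewrite addr0.
    case: eqP => [/var_inj[/(can_inj decodeK) mm _]|_]; last by rewrite addr0.
    by move: m'm; rewrite mm eqxx.
  have sum_upd (F : nat -> R) :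
      \sum_(m' < NN) coef u (update x (var (decode m) u) (dd n0)) (decode m') * F m' =
      \sum_(m' < NN) coef u x (decode m') * F m' + dd n0 * F m.
    under eq_bigr => m' _ do rewrite coef_upd mulrDl.
    rewrite big_split /= [X in _ + X](bigD1 (Ordinal mN)) //= eqxx.
    rewrite [X in _ + (_ + X)]big1 ?addr0 // => m' /negbTE.
    by rewrite -val_eqE /= => ->; rewrite mul0r.
  have := v0 _ (update_congruent (var (decode m) u) xx0).
  rewrite sum_upd.
  have -> : \sum_(s <- ancestors t) update x (var (decode m) u) (dd n0) (var t s) *
      (\sum_(m' < NN) coef u (update x (var (decode m) u) (dd n0)) (decode m') * B s m') =
      \sum_(s <- ancestors t) x (var t s) *
        (\sum_(m' < NN) coef u x (decode m') * B s m') +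
      dd n0 * \sum_(s <- ancestors t) x (var t s) * B s m.
    rewrite mulr_sumr -big_split; apply: eq_bigr => s _ /=; rewrite sum_upd.
    (* If m is the leaf [t], the moved variable is also the factor of the term of [u]; that term is
       zero because [h] kills the root vector. *)
    rewrite /update; case: eqP => [/var_inj[_ ->]|_]; last by ring.
    rewrite Bu big1 => [|m' _]; last by rewrite Bu mulr0.
    by ring.
  have v0x := v0 _ xx0; move/eqP: v0x; rewrite subr_eq0 => /eqP -> /eqP.
  rewrite opprD addrACA subrr add0r -mulrBr mulf_eq0 (negbTE (dd0 n0)).
  by move=> /eqP.
have inner0 s' : below u s' -> ~~ leaf s' ->
    A (code s') = 0 /\ forall s, s \in ancestors t -> B s (code s') = 0.
  move=> us' ls'; have [sN|/out//] := ltnP (code s') NN.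
  have [x0 [n0 v0]] := vanish s' us' ls'.
  apply: (@affine_vanish n0 x0 t) => [|x xx0]; first exact: ancestors_uniq.
  have sumE (F : nat -> R) : (forall m, leaf (decode m) -> F m = 0) ->
      \sum_(m < NN) coef s' x (decode m) * F m = F (code s').
    move=> F0; rewrite (bigD1 (Ordinal sN)) //= /coef codeK eqxx mul1r.
    rewrite big1 ?addr0 // => m ms; case: eqP => [ds|_].
      case/eqP: ms; apply: val_inj => /=; rewrite -ds; exact/esym/decodeK.
    by case: ifP => [/andP[/F0 -> _]|_]; rewrite ?mulr0 ?mul0r.
  rewrite -[RHS](v0 x xx0) sumE => [|m /leaf0[] //]; congr (_ - _).
  by apply: eq_big_seq => s sanc; rewrite sumE // => m /leaf0[_ ->].
have all0 m : below u (decode m) -> A m = 0 /\ forall s, s \in ancestors t -> B s m = 0.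
  move=> um; have [/leaf0//|lm] := boolP (leaf (decode m)).
  by rewrite -(decodeK m); apply: inner0.
have b0 s' : (forall m, below u (decode m) -> D *: b s' m = 0) -> h (tree_basis u s') = 0.
  move=> Db; apply: tree_in_inj; rewrite linear0; apply: dsum_ext => m.
  rewrite -/(b s'); apply/eqP; apply: contrapT => /negP bm.
  have um : below u (decode m) by apply: (tree_in_pred (h (tree_basis u s'))).1.
  by move/eqP: bm; apply; apply: (frac_torsion_free D0); apply: Db.
rewrite inE => /orP[/eqP ->|sanc]; apply: b0 => m /all0[A0 B0].
  by rewrite AE A0 tofrac0.
by rewrite BE // B0 // tofrac0.
Qed.

End Endomorphism.

(** Some [dd k] takes each element into the span of the basis vectors, and every node is a leaf or
    an ancestor of one, so [endomorphism_zero] reaches all of them. *)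
Lemma tree_rigid (h : {linear tree_mod u -> tree_mod u}) :
  h (tree_basis u u) = 0 -> forall x, h x = 0.
Proof.
move=> h0; have [dd0 _ _] := ddP.
have hb s : below u s -> h (tree_basis u s) = 0.
  move=> us; have [t lt st] := below_some_leaf s.
  apply: (endomorphism_zero h0 lt (below_trans us st)).
  rewrite inE; have [//|snt] := eqVneq s t.
  by apply/orP; right; apply/mem_ancestors; split=> //; apply: below_suffix.
move=> x; pose c := tree_in u x.
have [k /(_ k (leqnn k))/choice[r rE]] := clear_denominators c.
apply: (Flat_torsion_free (dd0 k)); rewrite -linearZ.
have -> : dd k *: x = \sum_(n < dsum_bound c) r n *: tree_basis u (decode n).
  apply: tree_in_inj; rewrite linearZ linear_sum /= -/c.
  rewrite {1}(dsum_decomp (@dsum_boundP _ _ c)) scaler_sumr.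
  apply: eq_bigr => n _; rewrite -linearZ rE linearZ /=.
  have [cn|cn] := eqVneq (c n) 0.
    have -> : r n = 0 by apply/eqP; rewrite -tofrac_eq0 -rE cn scaler0.
    by rewrite tofrac0 linear0 scale0r.
  rewrite tree_basisE ?decodeK; last exact: (tree_in_pred x).1.
  by rewrite -linearZ; congr (dsum_in _ _ _); rewrite frac_modZ -tofracM mulr1.
rewrite linear_sum big1 // => n _; rewrite linearZ_LR.
have [cn|cn] := eqVneq (c n) 0.
  have -> : r n = 0 by apply/eqP; rewrite -tofrac_eq0 -rE cn scaler0.
  by rewrite scale0r.
by rewrite hb ?scaler0 //; apply: (tree_in_pred x).1.
Qed.

End Rigid.

End TreeModules.

(** * Strictness *)

Section Strictness.
Variable R : idomainType.
Hypotheses (R_countable : countable [set: R]) (R_dedekind : dedekind_domain R)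
  (R_not_field : ~ GRing.field_axiom R).
Variables (d : Order.disp_t) (W : orderType d) (W_omega1 : is_omega1 W).
Variables (f : W -> nat -> W) (f_fund : fundamental_sequences f).
Local Notation ptl := (@plain_tree_length_le R d W f).

Lemma fund_child : exists child : W -> nat -> W,
  forall c i, ~ is_zero c -> is_succ_of (f c i) (child c i).
Proof.
have /choice[g gE] (ci : W * nat) :
    exists b, ~ is_zero ci.1 -> is_succ_of (f ci.1 ci.2) b.
  have [c0|c0] := pselect (is_zero ci.1); first by exists ci.1.
  by have [b bE] := fund_succ f_fund ci.2 c0; exists b.
by exists (fun c i => g (c, i)) => c i; apply: (gE (c, i)).
Qed.

Variables (dd : nat -> R) (ddP : denominators dd).
Variables (z : nat -> nat -> R) (z_generic : generic dd z).
Variables (child : W -> nat -> W)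
  (childP : forall c i, ~ is_zero c -> is_succ_of (f c i) (child c i)).
Variable a : W.

Fixpoint label (u : seq nat) : W :=
  if u is i :: v then child (label v) i else a.

Definition zero_label (u : seq nat) : bool := `[< is_zero (label u) >].

Lemma zero_labelP u : reflect (is_zero (label u)) (zero_label u).
Proof. exact: asboolP. Qed.

Lemma child_lt c i : ~ is_zero c -> (child c i < c)%O.
Proof.
move=> c0; have [lt_c _] := childP i c0.
exact: lt_le_trans lt_c (fund_le f_fund c i).
Qed.

Lemma label_ind (P : seq nat -> Prop) :
  (forall u, zero_label u -> P u) ->
  (forall u, ~~ zero_label u -> (forall i, P (i :: u)) -> P u) ->
  forall u, P u.
Proof.
move=> P0 PS u; move: {2}(label u) (erefl (label u)) => c.
move: c u; apply: (omega1_ind W_omega1) => c IHc u uc.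
have [/P0//|nz] := boolP (zero_label u); apply: PS => // i.
by apply: (IHc (label (i :: u))) => //=; rewrite -uc; apply/child_lt/zero_labelP.
Qed.

Lemma below_some_leaf s : exists2 t, zero_label t & below zero_label s t.
Proof.
elim/label_ind: s => [u u0|u nz IHu]; first by exists u; last exact: below_refl.
by have [t t0 ut] := IHu 0%N; exists t => //; apply: below_child ut.
Qed.

Local Notation X := (tree_mod R_dedekind R_countable z zero_label).

Lemma tree_ptl u : forall (E : Flat R) (p : {linear E -> X u}),
  (forall x, exists y, p y = x) -> fg_kernel p ->
  forall c, is_succ_of c (label u) -> ptl c E.
Proof.
elim/label_ind: u => [u u0|u nz IHu] E p p_surj p_fg c cu.
  have [kappa [kappa_inj kappa_surj]] :=
    tree_leaf R_dedekind R_countable z u0.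
  apply: (leaf_ptl R_dedekind f_fund ddP (q := kappa \o p : {linear E -> frac_mod R}) _ _
    (zero_labelP _ u0) cu).
    by move=> k; have [x <-] := kappa_surj k; have [y <-] := p_surj x; exists y.
  apply: (fg_kernel_comp (e := 0)) => //; first exact: linear0.
  by move=> x kx; exists 0; rewrite scaler0; apply: kappa_inj; rewrite kx linear0.
apply: (node_ptl (p := tree_quot R_dedekind R_countable z nz \o p : {linear E -> _})
  _ _ cu).
- move=> y; have [x <-] := tree_quot_surj ddP z_generic nz y.
  by have [w <-] := p_surj x; exists w.
- apply: (fg_kernel_comp p_surj p_fg); first exact: (tree_quot_basis _ _ _ nz).
  exact: tree_quot_ker.
- move=> i E' p' p'_surj p'_fg; apply: (IHu i _ p') => //=.
  by apply: childP; apply/zero_labelP.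
Qed.

Lemma tree_cover u : exists c : cover (X u),
  ~ factors c id /\ forall n, lifts_ptl f c (f (label u) n).
Proof.
elim/label_ind: u => [u u0|u nz IHu].
  have [kappa [kappa_inj kappa_surj]] :=
    tree_leaf R_dedekind R_countable z u0.
  have [c [c_split c_lifts]] :=
    leaf_cover ddP R_dedekind R_countable R_not_field kappa_inj kappa_surj.
  exists c; split=> // n T; have /zero_labelP z0 := u0.
  rewrite (fund_not_limit f_fund); last by apply/not_limit; left.
  move=> Tptl; apply: c_lifts; case: Tptl z0 => // ? ? ? ? ? ? aS _ _ _ _ a0.
  by case: (zero_not_succ a0 aS).
pose c i := sval (cid (IHu i)).
have c_split i : ~ factors (c i) id by have [] := svalP (cid (IHu i)).
have c_lifts i n : lifts_ptl f (c i) (f (label (i :: u)) n).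
  by have [_] := svalP (cid (IHu i)).
have u0 : ~ is_zero (label u) by apply/zero_labelP.
have [cX [cX_split cX_lifts]] := node_cover W_omega1 f_fund c
  (tree_quot_surj ddP z_generic nz)
  (tree_quot_basis _ _ _ nz) (@tree_quot_ker _ _ _ _ _ _ nz)
  (@tree_rigid _ _ _ _ ddP _ z_generic _ below_some_leaf _ nz).
exists cX; split=> [|n T Tptl]; first exact: cX_split.
apply: (cX_lifts _ (child (label u) n) _ n _ Tptl); first exact: childP.
move=> i j ni T' T'ptl.
(* The labels of the children increase weakly with i, so from i = n on they are at least
   [child (label u) n]; this is why only the covers of a tail need to lift. *)
have [m jm] : exists m, (f (child (label u) n) j <= f (label (i :: u)) m)%O.
  apply: (fund_dominated f_fund) => /=; rewrite leNgt; apply/negP => lt_c.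
  have [_ /(_ _ lt_c)] := childP i u0; rewrite leNgt.
  have [lt_n _] := childP n u0.
  by rewrite (lt_le_trans lt_n (fund_homo f_fund _ ni)).
apply: (c_lifts i m); apply: (ptl_mono R_dedekind W_omega1 f_fund T'ptl jm).
exact: fund_nonlimit.
Qed.

Lemma plain_exact_witness : exists (A B C : Flat R) (i : {linear A -> B})
    (p : {linear B -> C}), [/\ plain_exact R f a A B C i p, ~ split_epi p
  & forall a', is_succ_of a' a -> ~ plain_exact R f a' A B C i p].
Proof.
have [c [c_split c_lifts]] := tree_cover [::].
have [A [i [i_inj iE]]] := Flat_kernel R_dedekind (cover_map c).
exists A, (cover_mod c), (X [::]), i, (cover_map c); split.
- split; first by split=> //; apply: cover_surj.
  move=> T [n Tptl] h; have [t|g gE _] := c_lifts n T Tptl h [::]; first by [].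
  by exists g => x; rewrite -gE.
- by move=> [s sE]; apply: c_split; exists s.
- move=> a' a'a [_ lift]; apply: c_split.
  (* The module at the root has length at most a', so exactness at a' would lift its identity and
     split the cover. *)
  have [|g gE] := lift (X [::]) _ (idfun : {linear X [::] -> X [::]}).
    exists 0%N; rewrite (fund_not_limit f_fund); last by apply/not_limit; right; exists a.
    apply: (tree_ptl (p := (idfun : {linear X [::] -> X [::]}))) => //.
      by move=> x; exists x.
    exists 0%N, (fun=> 0); split=> [[]//|x x0]; exists (fun=> 0).
    by rewrite big_ord0.
  by exists g => x; apply: gE.
Qed.

End Strictness.

Theorem corollary12p17 (R : idomainType)
    (R_countable : countable [set: R])
    (R_dedekind : dedekind_domain R)
    (R_not_field : ~ GRing.field_axiom R)
    (d : Order.disp_t) (W : orderType d) (W_omega1 : is_omega1 W)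
    (f : W -> nat -> W) (f_fund : fundamental_sequences f) :
  (forall a : W,
     exact_structure (plain_exact R f a) /\ nontrivial_class (plain_exact R f a)) /\
  (forall a b : W, (a < b)%O -> proper_sub_class (plain_exact R f b) (plain_exact R f a)).
Proof.
have [dd ddP] := denominators_exist R_countable.
have [z z_generic] := generic_exists ddP R_countable R_not_field.
have [child childP] := fund_child f_fund.
have witness a := plain_exact_witness R_countable R_dedekind R_not_field W_omega1
  f_fund ddP z_generic childP a.
split=> [a|a b ab].
  split; first exact: projectively_generated_exact.
  have [A [B [C [i [p [ip nsplit _]]]]]] := witness a.
  by exists A, B, C, i, p; split=> //; case: ip.
split; first exact: (plain_exact_mono R_dedekind W_omega1 f_fund (ltW ab)).
(* The witness for [a] already fails at the successor a' <= b, and exactness at [b] would imply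
   exactness at a'. *)
have [a' a'a] := omega1_succ W_omega1 a.
have a'b : (a' <= b)%O by have [_] := a'a; apply.
have [A [B [C [i [p [ip _ nip]]]]]] := witness a.
move=> /(_ _ _ _ _ _ ip); move/(plain_exact_mono R_dedekind W_omega1 f_fund a'b).
exact: nip.
Qed.
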